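(* Assume $\mathfrak g\cong\mathfrak{sl}_{n+1}$. Let $m$ be a positive integer, $\zeta\in\mathbf C$ a primitive $m$th root of unity, $\boldsymbol\pi^0=(1-u,1,\dots,1)$ and $\boldsymbol\pi=\left(\prod_{j=0}^{m-1}(1-\zeta^{j-1}u),1,\dots,1\right)$ ($n$-tuples). Then for all $\nu\in P$, $r\in\mathbf Z$ and $s=0,\dots,m-1$, $$\dim_{\mathbf C(q)}L^s(V(\boldsymbol\pi))_{\nu+r\delta}=\frac1m\sum_{d\mid m}\varphi_{r-s}(d)\dim_{\mathbf C(q)}V(\boldsymbol\pi^{1/d})_{\nu/d}=\frac1m\sum_{d\mid m}\varphi_{r-s}(d)\dim_{\mathbf C(q)}\left(V(\boldsymbol\pi^0)^{\otimes m/d}\right)_{\nu/d}.$$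
   Context: Let $\mathfrak g=\mathfrak{sl}_{n+1}$, $n\geq 1$, $I=\{1,\dots,n\}$, Cartan matrix $(a_{ij})$, fundamental weights $\varpi_i$, $P=\sum_i\mathbf Z\varpi_i$. Let $q$ be an indeterminate, $[k]=\frac{q^k-q^{-k}}{q-q^{-1}}$, ${k\brack r}$ the $q$-binomials. $\mathbf U_q^e$ (the quantum affine algebra of $\mathfrak g$ with $C^{\pm1/2}=1$) is the $\mathbf C(q)$-algebra with generators $x^\pm_{i,r}$ ($i\in I,r\in\mathbf Z$), $K_i^{\pm1}$, $D^{\pm1}$, $h_{i,r}$ ($i\in I$, $r\ne0$) and relations: the $K_i$, $D$ are invertible and commute; $K_ih_{j,r}=h_{j,r}K_i$; $K_ix^\pm_{j,r}K_i^{-1}=q^{\pm a_{ij}}x^\pm_{j,r}$; $Dx^\pm_{i,r}D^{-1}=q^rx^\pm_{i,r}$, $Dh_{i,r}D^{-1}=q^rh_{i,r}$; $[h_{i,r},h_{j,s}]=0$; $[h_{i,r},x^\pm_{j,s}]=\pm\frac1r[ra_{ij}]x^\pm_{j,r+s}$; $x^\pm_{i,r+1}x^\pm_{j,s}-q^{\pm a_{ij}}x^\pm_{j,s}x^\pm_{i,r+1}=q^{\pm a_{ij}}x^\pm_{i,r}x^\pm_{j,s+1}-x^\pm_{j,s+1}x^\pm_{i,r}$; $[x^+_{i,r},x^-_{j,s}]=\delta_{ij}\frac{\psi^+_{i,r+s}-\psi^-_{i,r+s}}{q-q^{-1}}$; and for $i\ne j$, $p=1-a_{ij}$ and all integers $r_1,\dots,r_p,s$: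 $\sum_{\sigma\in\Sigma_p}\sum_{k=0}^p(-1)^k{p\brack k}x^\pm_{i,r_{\sigma(1)}}\cdots x^\pm_{i,r_{\sigma(k)}}x^\pm_{j,s}x^\pm_{i,r_{\sigma(k+1)}}\cdots x^\pm_{i,r_{\sigma(p)}}=0$; where $\sum_{r\ge0}\psi^\pm_{i,\pm r}u^{\pm r}=K_i^{\pm1}\exp(\pm(q-q^{-1})\sum_{s\ge1}h_{i,\pm s}u^{\pm s})$ and $\psi^\pm_{i,\mp r}=0$ for $r>0$. $\mathbf U_q\subset\mathbf U_q^e$ is the subalgebra generated by all $x^\pm_{i,r},h_{i,r},K_i^{\pm1}$; $(\mathbf U_q)_k=\{x\in\mathbf U_q:DxD^{-1}=q^kx\}$. The $K_i$ are group-like for the Hopf algebra structure, so weights add in tensor products. For an $n$-tuple $\boldsymbol\pi=(\pi_1,\dots,\pi_n)$ of polynomials with constant term 1, $\pi_i^+=\pi_i$ and $\pi_i^-(u)=u^{\deg\pi_i}\pi_i(u^{-1})/\left.(u^{\deg\pi_i}\pi_i(u^{-1}))\right|_{u=0}$; $V(\boldsymbol\pi)$ is the unique irreducible (finite-dimensional) $\mathbf U_q$-module generated by $v_{\boldsymbol\pi}\ne0$ with $x^+_{i,k}v_{\boldsymbol\pi}=0$, $K_iv_{\boldsymbol\pi}=q^{\deg\pi_i}v_{\boldsymbol\pi}$, $P_i^\pm(u)v_{\boldsymbol\pi}=\pi_i^\pm(u)v_{\boldsymbol\pi}$, with $P_i^\pm(u)=\exp\left(-\sum_{k\ge1}\frac{q^{\pm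 k}h_{i,\pm k}}{[k]}u^k\right)$. For $\mu=\sum\mu_i\varpi_i\in P$, $V_\mu=\{v:K_iv=q^{\mu_i}v\ \forall i\in I\}$; set $V_{\mu}=0$ if $\mu\notin P$ (in particular when $\mu=\nu/d$ is not in $P$). $L(V(\boldsymbol\pi))=V(\boldsymbol\pi)\otimes\mathbf C(q)[t,t^{-1}]$ is the $\mathbf U_q^e$-module with $x(v\otimes t^r)=(xv)\otimes t^{r+k}$ for $x\in(\mathbf U_q)_k$ and $D(v\otimes t^r)=q^rv\otimes t^r$. $L^s(V(\boldsymbol\pi))=\mathbf U_q^e.(v_{\boldsymbol\pi}\otimes t^s)$, $0\le s\le m-1$, are its simple summands. The weight space of weight $\nu+r\delta$ is the set of vectors $w$ with $K_iw=q^{\nu_i}w$ ($i\in I$) and $Dw=q^rw$. For $d\mid m$, $\boldsymbol\pi^{1/d}=(\pi_1^{1/d},\dots,\pi_n^{1/d})$ with $\pi_i^{1/d}(u)=\prod_{j=0}^{m/d-1}\pi_i^0(\zeta^{jd}u)$. Finally $\varphi_k(d)=\varphi(d)\,\frac{\mu(d/\gcd(d,k))}{\varphi(d/\gcd(d,k))}$, where $\varphi$ is the Euler function, $\mu$ the Möbius function, and $\gcd(d,0)=d$. *)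

(* Defs.v *)
From HB Require Import structures.
From mathcomp Require Import all_boot all_order all_algebra perm.
From mathcomp Require Import generic_quotient ring_quotient fraction complex.
From mathcomp Require Import boolp classical_sets functions cardinality reals.
From mathcomp Require Import finmap.
From mathcomp.multinomials Require Import monalg.

Set Implicit Arguments.
Unset Strict Implicit.
Unset Printing Implicit Defensive.

Import GRing.Theory Num.Theory.

Local Open Scope ring_scope.
Local Open Scope quotient_scope.

(* In all signs below, [true] stands for [+] and [false] for [-]. *)
Definition sgi (e : bool) (z : int) : int := if e then z else - z.

Definition sgk (K : fieldType) (e : bool) : K := if e then 1 else -1.

Definition cartan n (i j : 'I_n) : int :=
  if i == j then 2
  else if ((i.+1 == j :> nat) || (j.+1 == i :> nat))%N then -1 else 0.

Section QuantumNumbers.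
Variables (K : fieldType) (q : K).

Definition qint (k : int) : K := (q ^ k - q ^ (- k)) / (q - q^-1).

Definition qfact (p : nat) : K := \prod_(k < p) qint k.+1.

Definition qbin (p k : nat) : K := qfact p / (qfact k * qfact (p - k)).

End QuantumNumbers.

(* A formal power series with coefficients in [A] is the sequence of its
   coefficients.  [exp_coef f r] is the coefficient of [u ^ r] in [exp f]; it is
   meaningful when [f 0 = 0], so that only the powers [f ^ k] with [k <= r]
   contribute. *)

Section Exponential.
Variables (K : fieldType) (A : algType K).
Implicit Types f : nat -> A.

Fixpoint ps_pow f (k : nat) : nat -> A :=
  if k is k'.+1 then fun r => \sum_(i < r.+1) f i * ps_pow f k' (r - i)%N
  else fun r => (r == 0%N)%:R.

Definition exp_coef f (r : nat) : A :=
  \sum_(k < r.+1) (k`!%:R)^-1 *: ps_pow f k r.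

End Exponential.

Notation nzint := {r : int | r != 0}.

(* [gx e i r] is x^e_{i,r}, [gh i r] is h_{i,r}, [gK e i] is K_i^{e1} and
   [gD e] is D^{e1}. *)
Variant gen (n : nat) : Type :=
  | gx of bool & 'I_n & int
  | gh of 'I_n & nzint
  | gK of bool & 'I_n
  | gD of bool.
Arguments gD {n}.

Section GenChoice.
Variable n : nat.

Definition gen_code (y : gen n) :
    (bool * 'I_n * int) + ('I_n * nzint) + (bool * 'I_n) + bool :=
  match y with
  | gx e i r => inl (inl (inl (e, i, r)))
  | gh i r => inl (inl (inr (i, r)))
  | gK e i => inl (inr (e, i))
  | gD e => inr e
  end.

Definition gen_decode c : gen n :=
  match c with
  | inl (inl (inl (e, i, r))) => gx e i r
  | inl (inl (inr (i, r))) => gh i r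
  | inl (inr (e, i)) => gK e i
  | inr e => gD e
  end.

Lemma gen_codeK : cancel gen_code gen_decode. Proof. by case. Qed.

HB.instance Definition _ := Equality.copy (gen n) (can_type gen_codeK).
HB.instance Definition _ := Choice.copy (gen n) (can_type gen_codeK).

End GenChoice.

Section Relations.
Variables (K : fieldType) (q : K) (n : nat) (A : algType K).

(* h_{i,r} for all integers [r], with h_{i,0} := 0. *)
Definition htot (h : 'I_n -> nzint -> A) (i : 'I_n) (r : int) : A :=
  if insub r is Some r' then h i r' else 0.

Variable g : gen n -> A.

Let x e i r := g (gx e i r).
Let h := htot (fun i r => g (gh i r)).
Let Ki i := g (gK true i).
Let Kinv i := g (gK false i).
Let D : A := g (gD true).
Let Dinv : A := g (gD false).

(* psi^e_{i,r}: for [e = true] (resp. [false]) it vanishes for r < 0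
   (resp. r > 0). *)
Definition psi (e : bool) (i : 'I_n) (r : int) : A :=
  if 0 <= sgi e r then
    g (gK e i) * exp_coef
      (fun s : nat => (sgk K e * (q - q^-1)) *: h i (sgi e s)) `|r|%N
  else 0.

(* [uqe_rel a b] lists the defining relations a = b. *)
Inductive uqe_rel : A -> A -> Prop :=
  | rel_KKinv i : uqe_rel (Ki i * Kinv i) 1
  | rel_KinvK i : uqe_rel (Kinv i * Ki i) 1
  | rel_DDinv : uqe_rel (D * Dinv) 1
  | rel_DinvD : uqe_rel (Dinv * D) 1
  | rel_KK i j : uqe_rel (Ki i * Ki j) (Ki j * Ki i)
  | rel_KD i : uqe_rel (Ki i * D) (D * Ki i)
  | rel_Kh i j r : r != 0 -> uqe_rel (Ki i * h j r) (h j r * Ki i)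
  | rel_Kx e i j r :
      uqe_rel (Ki i * x e j r * Kinv i) (q ^ sgi e (cartan i j) *: x e j r)
  | rel_Dx e i r : uqe_rel (D * x e i r * Dinv) (q ^ r *: x e i r)
  | rel_Dh i r : r != 0 -> uqe_rel (D * h i r * Dinv) (q ^ r *: h i r)
  | rel_hh i j r s : r != 0 -> s != 0 ->
      uqe_rel (h i r * h j s - h j s * h i r) 0
  | rel_hx e i j r s : r != 0 ->
      uqe_rel (h i r * x e j s - x e j s * h i r)
        ((sgk K e * (r%:~R^-1 * qint q (r * cartan i j)))
           *: x e j (r + s))
  | rel_xx e i j r s :
      let c := q ^ sgi e (cartan i j) in
      uqe_rel (x e i (r + 1) * x e j s - c *: (x e j s * x e i (r + 1)))
        (c *: (x e i r * x e j (s + 1)) - x e j (s + 1) * x e i r)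
  | rel_xpxm i j r s :
      uqe_rel (x true i r * x false j s - x false j s * x true i r)
        (if i == j then
           (q - q^-1)^-1 *: (psi true i (r + s) - psi false i (r + s))
         else 0)
  | rel_serre e i j (p : nat) (r : 'I_p -> int) s :
      i != j -> p%:Z = 1 - cartan i j ->
      uqe_rel
        (\sum_(sigma : 'S_p) \sum_(k < p.+1)
           ((-1) ^+ k * qbin q p k) *:
           ((\prod_(l < p | (l < k)%N) x e i (r (sigma l))) * x e j s
            * \prod_(l < p | (k <= l)%N) x e i (r (sigma l))))
        0.

End Relations.

(* The trivial representation (x, h act by 0 and K, D by 1) satisfies the
   relations; it is used to see that the ideal of relations is proper. *)

Section Trivial.
Variables (K : fieldType) (q : K) (n : nat) (A : algType K).
Variable g : gen n -> A.

Definition triv_gen (y : gen n) : K :=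
  match y with gK _ _ | gD _ => 1 | _ => 0 end.

Variable f : {rmorphism A -> K}.
Hypothesis fZ : forall c a, f (c *: a) = c * f a.
Hypothesis fg : forall y, f (g y) = triv_gen y.

Lemma triv_htot i r : f (htot (fun i r => g (gh i r)) i r) = 0.
Proof. by rewrite /htot; case: insub => [r'|]; rewrite ?fg ?rmorph0. Qed.

Lemma triv_exp_coef (u : nat -> A) r :
  (forall s, f (u s) = 0) -> f (exp_coef u r) = (r == 0%N)%:R.
Proof.
move=> u0; rewrite /exp_coef rmorph_sum big_ord_recl /= big1 => [|k _].
  by rewrite addr0 fZ invr1 mul1r rmorph_nat.
rewrite fZ rmorph_sum big1 ?mulr0 // => j _.
by rewrite rmorphM /= u0 mul0r.
Qed.

Lemma triv_psi e i r : f (psi q g e i r) = (r == 0)%:R.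
Proof.
rewrite /psi; case: ifP => [_|r_lt0].
  rewrite rmorphM /= fg mul1r triv_exp_coef ?absz_eq0 // => s.
  by rewrite fZ triv_htot mulr0.
by rewrite rmorph0; case: eqP r_lt0 => // ->; case: e.
Qed.

Lemma triv_rel a b : uqe_rel q g a b -> f a = f b.
Proof.
case=> [i|i|||i j|i|i j r _|e i j r|e i r|i r _|i j r s _ _|e i j r s _
       |e i j r s c|i j r s|e i j p r s _ _].
1-12: by rewrite ?(rmorphB, rmorphM, fZ) /= ?(rmorphM, fZ) /= ?fZ
  ?(triv_htot, fg) ?rmorph0 ?rmorph1 ?(mulr0, mul0r, mul1r, subrr).
- by rewrite !rmorphB /= !fZ !rmorphM /= !fg !(mulr0, mul0r).
- rewrite rmorphB !rmorphM /= !fg !mul0r subrr.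
  case: ifP => _; last by rewrite rmorph0.
  by rewrite fZ rmorphB /= !triv_psi subrr mulr0.
- rewrite rmorph0 rmorph_sum big1 // => sigma _; rewrite rmorph_sum big1 // => k _.
  by rewrite fZ !rmorphM /= fg mulr0 mul0r mulr0.
Qed.

End Trivial.

Lemma malg_scalerAr (M : monomType) (K : comNzRingType) (c : K)
    (a b : {malg K[M]}) :
  c *: (a * b) = a * (c *: b).
Proof.
apply/malgP => k.
rewrite mcoeffZ (mcoeffMlw k (fsubset_refl _) (msuppZ_le c b)).
rewrite (mcoeffMl a b) mulr_sumr; apply: eq_bigr => i _.
rewrite mulr_sumr; apply: eq_bigr => j _.
by rewrite mcoeffZ mulrnAr mulrCA.
Qed.

Definition freealg (K : fieldType) (n : nat) := {malg K[{fmonom (gen n)}]}.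

Section FreeAlgebra.
Variables (K : fieldType) (n : nat).

HB.instance Definition _ := GRing.Lalgebra.on (freealg K n).

HB.instance Definition _ :=
  GRing.Lalgebra_isAlgebra.Build K (freealg K n) (@malg_scalerAr _ K).

Definition fgen (y : gen n) : freealg K n := << fmu y >>.

End FreeAlgebra.

(* Quotient of a noncommutative algebra by a proper two-sided ideal; only the
   commutative case is in the library. *)

HB.mixin Record isTwoSidedIdeal (R : nzRingType) (S : R -> bool) := {
  ideal_mull : forall a x : R, x \in S -> a * x \in S;
  ideal_mulr : forall a x : R, x \in S -> x * a \in S;
  ideal_proper : 1 \notin S
}.

#[short(type="twoSidedIdeal")]
HB.structure Definition TwoSidedIdeal (R : nzRingType) :=
  {S of GRing.ZmodClosed R S & isTwoSidedIdeal R S}.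

Section QuotientAlgebra.
Variables (K : fieldType) (A : algType K) (I : twoSidedIdeal A).

Definition quotalg := Quotient.quot (I : zmodClosed A).

HB.instance Definition _ := EqQuotient.on quotalg.
HB.instance Definition _ := GRing.Zmodule.on quotalg.

Local Notation pi := (\pi_quotalg).

Lemma quotalg_eqP (x y : A) : reflect (pi x = pi y) (x - y \in I).
Proof.
apply: (iffP idP) => [Ixy|exy]; first by apply/eqP; rewrite -Quotient.idealrBE.
by have := eqxx (pi x); rewrite {2}exy -Quotient.idealrBE.
Qed.

Lemma quotalg_repr (x : A) : repr (pi x) - x \in I.
Proof. by apply/quotalg_eqP; rewrite reprK. Qed.

Definition quotalg_one : quotalg := lift_cst quotalg 1.
Definition quotalg_mul := lift_op2 quotalg *%R.
Definition quotalg_scale (c : K) := lift_op1 quotalg ( *:%R c).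

Lemma quotalg_pi1 : pi 1 = quotalg_one.
Proof. by unlock quotalg_one. Qed.

Lemma quotalg_piD x y : pi (x + y) = pi x + pi y.
Proof. exact: raddfD. Qed.

Lemma quotalg_piM x y : pi (x * y) = quotalg_mul (pi x) (pi y).
Proof.
unlock quotalg_mul; apply: esym; apply/quotalg_eqP.
rewrite -[_ * _](subrK (x * repr (pi y))) -mulrBl -addrA -mulrBr.
apply: rpredD; first exact/ideal_mulr/quotalg_repr.
exact/ideal_mull/quotalg_repr.
Qed.

Lemma quotalg_piZ c x : pi (c *: x) = quotalg_scale c (pi x).
Proof.
unlock quotalg_scale; apply: esym; apply/quotalg_eqP; rewrite -scalerBr -mulr_algl.
by apply: ideal_mull; exact: quotalg_repr.
Qed.

Fact quotalg_mulA : associative quotalg_mul.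
Proof.
move=> x y z; rewrite -[x]reprK -[y]reprK -[z]reprK.
by rewrite -!quotalg_piM mulrA.
Qed.

Fact quotalg_mul1l : left_id quotalg_one quotalg_mul.
Proof.
by move=> x; rewrite -[x]reprK -quotalg_pi1 -quotalg_piM mul1r.
Qed.

Fact quotalg_mul1r : right_id quotalg_one quotalg_mul.
Proof. by move=> x; rewrite -[x]reprK -quotalg_pi1 -quotalg_piM mulr1. Qed.

Fact quotalg_mulDl : left_distributive quotalg_mul +%R.
Proof.
move=> x y z; rewrite -[x]reprK -[y]reprK -[z]reprK.
by rewrite -!(quotalg_piD, quotalg_piM) mulrDl.
Qed.

Fact quotalg_mulDr : right_distributive quotalg_mul +%R.
Proof.
move=> x y z; rewrite -[x]reprK -[y]reprK -[z]reprK.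
by rewrite -!(quotalg_piD, quotalg_piM) mulrDr.
Qed.

Fact quotalg_1neq0 : quotalg_one != 0.
Proof.
rewrite -quotalg_pi1; have -> : 0 = pi 0 by rewrite raddf0.
by apply/negP => /eqP/quotalg_eqP; rewrite subr0 (negbTE ideal_proper).
Qed.

HB.instance Definition _ := GRing.Zmodule_isNzRing.Build quotalg
  quotalg_mulA quotalg_mul1l quotalg_mul1r quotalg_mulDl quotalg_mulDr
  quotalg_1neq0.

Fact quotalg_scaleA a b u :
  quotalg_scale a (quotalg_scale b u) = quotalg_scale (a * b) u.
Proof. by rewrite -[u]reprK -!quotalg_piZ scalerA. Qed.

Fact quotalg_scale1 : left_id 1 quotalg_scale.
Proof. by move=> u; rewrite -[u]reprK -quotalg_piZ scale1r. Qed.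

Fact quotalg_scaleDr : right_distributive quotalg_scale +%R.
Proof.
move=> a u v; rewrite -[u]reprK -[v]reprK.
by rewrite -!(quotalg_piD, quotalg_piZ) scalerDr.
Qed.

Fact quotalg_scaleDl u :
  {morph (fun a => quotalg_scale a u) : a b / a + b >-> a + b}.
Proof.
move=> a b; rewrite -[u]reprK.
by rewrite -!(quotalg_piD, quotalg_piZ) scalerDl.
Qed.

HB.instance Definition _ := GRing.Zmodule_isLmodule.Build K quotalg
  quotalg_scaleA quotalg_scale1 quotalg_scaleDr quotalg_scaleDl.

Fact quotalg_scaleAl a (u v : quotalg) : a *: (u * v) = (a *: u) * v.
Proof.
rewrite -[u]reprK -[v]reprK.
by rewrite /GRing.scale /GRing.mul /= -!(quotalg_piM, quotalg_piZ) scalerAl.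
Qed.

HB.instance Definition _ := GRing.Lmodule_isLalgebra.Build K quotalg
  quotalg_scaleAl.

Fact quotalg_scaleAr a (u v : quotalg) : a *: (u * v) = u * (a *: v).
Proof.
rewrite -[u]reprK -[v]reprK.
by rewrite /GRing.scale /GRing.mul /= -!(quotalg_piM, quotalg_piZ) scalerAr.
Qed.

HB.instance Definition _ := GRing.Lalgebra_isAlgebra.Build K quotalg
  quotalg_scaleAr.

End QuotientAlgebra.

Section Uqe.
Variables (K : fieldType) (q : K) (n : nat).
Local Notation F := (freealg K n).

Inductive uqe_ideal_gen : F -> Prop :=
  | ideal_rel a b : uqe_rel q (@fgen K n) a b -> uqe_ideal_gen (a - b)
  | ideal_0 : uqe_ideal_gen 0
  | ideal_add a b :
      uqe_ideal_gen a -> uqe_ideal_gen b -> uqe_ideal_gen (a + b)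
  | ideal_mul c a d : uqe_ideal_gen a -> uqe_ideal_gen (c * a * d).

Definition uqe_ideal : pred F := fun a => `[< uqe_ideal_gen a >].

Lemma uqe_idealP a : reflect (uqe_ideal_gen a) (a \in uqe_ideal).
Proof. exact: asboolP. Qed.

Lemma uqe_ideal_zmod_closed : zmod_closed uqe_ideal.
Proof.
split=> [|a b /uqe_idealP Ia /uqe_idealP Ib]; apply/uqe_idealP.
  exact: ideal_0.
apply: ideal_add => //.
by have := ideal_mul (-1) 1 Ib; rewrite mulN1r mulr1.
Qed.

HB.instance Definition _ :=
  GRing.isZmodClosed.Build F uqe_ideal uqe_ideal_zmod_closed.

Definition triv_mon (m : {fmonom (gen n)}) : K :=
  \prod_(y <- (m : seq (gen n))) triv_gen K y.

Lemma triv_mon_mmorphism : mmorphism triv_mon.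
Proof.
split=> [a b|]; rewrite /triv_mon; first by rewrite fmM big_cat.
by rewrite fm1 big_nil.
Qed.

HB.instance Definition _ :=
  monalg.isMultiplicative.Build {fmonom (gen n)} K triv_mon triv_mon_mmorphism.

Definition triv : {rmorphism F -> K} := mmap idfun triv_mon.

Lemma triv_ideal a : a \in uqe_ideal -> triv a = 0.
Proof.
have trivE x y : uqe_rel q (@fgen K n) x y -> triv x = triv y.
  apply: triv_rel => [c z|y0]; first exact: linearZ.
  by rewrite /triv /fgen /= mmapU mul1r /triv_mon fmU big_seq1.
move/uqe_idealP; elim=> [x y /trivE e||x y _ ex _ ey|c x d _ ex].
- by rewrite rmorphB e subrr.
- by rewrite rmorph0.
- by rewrite rmorphD /= ex ey addr0.
- by rewrite !rmorphM /= ex mulr0 mul0r.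
Qed.

Lemma uqe_ideal1 : 1 \notin uqe_ideal.
Proof. by apply/negP => /triv_ideal/eqP; rewrite rmorph1 oner_eq0. Qed.

Lemma uqe_ideal_mull (c a : F) : a \in uqe_ideal -> c * a \in uqe_ideal.
Proof.
move=> /uqe_idealP Ia; apply/uqe_idealP.
by rewrite -[c * a]mulr1; exact: ideal_mul.
Qed.

Lemma uqe_ideal_mulr (c a : F) : a \in uqe_ideal -> a * c \in uqe_ideal.
Proof.
move=> /uqe_idealP Ia; apply/uqe_idealP.
by rewrite -[a]mul1r; exact: ideal_mul.
Qed.

HB.instance Definition _ :=
  isTwoSidedIdeal.Build F uqe_ideal uqe_ideal_mull uqe_ideal_mulr uqe_ideal1.

End Uqe.

Definition Uqe (K : fieldType) (q : K) (n : nat) :=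
  @quotalg K (freealg K n) (TwoSidedIdeal.clone _ (@uqe_ideal K q n) _).

HB.instance Definition _ (K : fieldType) (q : K) (n : nat) :=
  GRing.Algebra.on (Uqe q n).

Inductive gen_subalg (K : fieldType) (A : algType K) (S : A -> Prop) :
    A -> Prop :=
  | gsub_in a : S a -> gen_subalg S a
  | gsub_1 : gen_subalg S 1
  | gsub_add a b : gen_subalg S a -> gen_subalg S b -> gen_subalg S (a + b)
  | gsub_scale c a : gen_subalg S a -> gen_subalg S (c *: a)
  | gsub_mul a b : gen_subalg S a -> gen_subalg S b -> gen_subalg S (a * b).

Definition is_gD n (y : gen n) : bool := if y is gD _ then true else false.

Section Uq.
Variables (K : fieldType) (q : K) (n : nat).

Definition ugen (y : gen n) : Uqe q n := \pi_(Uqe q n) (@fgen K n y).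

Definition uq_pred : pred (Uqe q n) := fun a =>
  `[< gen_subalg (fun b => exists2 y : gen n, ~~ is_gD y & b = ugen y) a >].

Lemma uq_subalg_closed : subalg_closed uq_pred.
Proof.
split=> [|c a b /asboolP Ua /asboolP Ub|a b /asboolP Ua /asboolP Ub];
  apply/asboolP.
- exact: gsub_1.
- by apply: gsub_add => //; apply: gsub_scale.
- exact: gsub_mul.
Qed.

HB.instance Definition _ :=
  GRing.isSubalgClosed.Build K (Uqe q n) uq_pred uq_subalg_closed.

Record Uq := MkUq { uq_val :> Uqe q n; uq_valP : uq_val \in uq_pred }.

HB.instance Definition _ := [isSub for uq_val].
HB.instance Definition _ := [Choice of Uq by <:].
HB.instance Definition _ := [SubChoice_isSubAlgebra of Uq by <:].

Lemma ugen_uq (y : gen n) : ~~ is_gD y -> ugen y \in uq_pred.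
Proof. by move=> yD; apply/asboolP/gsub_in; exists y. Qed.

Definition uqgen (y : gen n) (yD : ~~ is_gD y) : Uq := MkUq (ugen_uq yD).

Definition uq_x e i r : Uq := @uqgen (gx e i r) isT.
Definition uq_K e i : Uq := @uqgen (gK e i) isT.
Definition uq_h i r : Uq := htot (fun i r => @uqgen (gh i r) isT) i r.

Definition uq_deg (k : int) (x : Uq) : Prop :=
  ugen (gD true) * (x : Uqe q n) * ugen (gD false) = q ^ k *: (x : Uqe q n).

(* The coefficient of [u ^ r] in P_i^e(u). *)
Definition uq_P (e : bool) (i : 'I_n) (r : nat) : Uq :=
  exp_coef (fun k : nat =>
    - (q ^ sgi e k / qint q k) *: uq_h i (sgi e k)) r.

End Uq.

(* [rep A V]: left [A]-module structures on the [K]-space [V] *)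

Record rep (K : fieldType) (A : algType K) (V : lmodType K) := Rep {
  act :> A -> V -> V;
  actDl : forall a b v, act (a + b) v = act a v + act b v;
  actZl : forall c a v, act (c *: a) v = c *: act a v;
  actDr : forall a v w, act a (v + w) = act a v + act a w;
  actZr : forall c a v, act a (c *: v) = c *: act a v;
  act1 : forall v, act 1 v = v;
  actM : forall a b v, act (a * b) v = act a (act b v)
}.

Section Modules.
Variables (K : fieldType) (q : K) (n : nat).

Definition pisgn (e : bool) (p : {poly K}) : {poly K} :=
  if e then p
  else let p' := \poly_(k < size p) p`_((size p).-1 - k) in (p'.[0])^-1 *: p'.

(* [is_V pi rho v]: the module [(V, rho)] is V(pi), with v_pi = [v]. *)
Record is_V (pi : 'I_n -> {poly K}) (V : vectType K) (rho : rep (Uq q n) V)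
    (v : V) : Prop := IsV {
  V_neq0 : v != 0;
  V_gen : forall w, exists a, w = rho a v;
  V_irr : forall W : {vspace V},
    (forall a w, w \in W -> rho a w \in W) -> W = 0%VS \/ W = fullv;
  V_x : forall i k, rho (uq_x q true i k) v = 0;
  V_K : forall i, rho (uq_K q true i) v = q ^+ (size (pi i)).-1 *: v;
  V_P : forall e i r, rho (uq_P q e i r) v = (pisgn e (pi i))`_r *: v
}.

(* The weight [mu] is given by its coordinates on the fundamental weights;
   [k i] is the action of K_i. *)
Definition wtspace (V : vectType K) (k : 'I_n -> V -> V) (mu : 'I_n -> rat) :
    {vspace V} :=
  if [forall i, mu i \is a Num.int] then
    (\bigcap_i lker (linfun (k i) - q ^ numq (mu i) *: \1%VF))%VS
  else 0%VS.

Definition V_wt (V : vectType K) (rho : rep (Uq q n) V) (mu : 'I_n -> rat) :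
    {vspace V} :=
  wtspace (fun i => rho (uq_K q true i)) mu.

End Modules.

(* Tensor powers, in coordinates with respect to a basis of [V] *)

Section TensorPower.
Variables (K : fieldType) (V : vectType K) (k : nat).

Local Notation b := (vbasis {:V}).
Local Notation index := {ffun 'I_k -> 'I_(\dim {:V})}.

Definition tpow := {ffun index -> K^o}.
HB.instance Definition _ := Vector.on tpow.

Definition tpure (v : 'I_k -> V) : tpow :=
  [ffun c : index => \prod_j coord b (c j) (v j)].

(* The linear map f (x) ... (x) f; see [tmap_pure]. *)
Definition tmap (f : V -> V) (t : tpow) : tpow :=
  \sum_(c : index) (t c : K) *: tpure (fun j => f b`_(c j)).

Lemma tpure_basis (t : tpow) :
  t = \sum_(c : index) (t c : K) *: tpure (fun j => b`_(c j)).
Proof.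
apply/ffunP => c; rewrite sum_ffunE (bigD1 c) //= big1 ?addr0 => [|c' c'c].
  rewrite !ffunE big1 ?scaler1 ?mulr1 => [|j _]; first by rewrite /GRing.scale /= mulr1.
  by rewrite coord_free ?eqxx // (basis_free (vbasisP _)).
rewrite !ffunE; have [j cj] : exists j, c' j != c j.
  apply/existsP; apply: contra_neqT c'c => /existsPn h.
  by apply/ffunP => j; apply/eqP; rewrite -[_ == _]negbK h.
rewrite (bigD1 j) //= coord_free ?(basis_free (vbasisP _)) //.
by rewrite (negbTE cj) mul0r scaler0.
Qed.

Lemma tmap_pure (f : {linear V -> V}) (v : 'I_k -> V) :
  tmap f (tpure v) = tpure (f \o v).
Proof.
apply/ffunP => c; rewrite sum_ffunE [RHS]ffunE /=.
under [RHS]eq_bigr => j _.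
  rewrite [v j](coord_vbasis (memvf _)) linear_sum linear_sum /=.
  under eq_bigr => l _ do rewrite !linearZ /=.
  over.
rewrite bigA_distr_bigA; apply: eq_bigr => c' _.
by rewrite !ffunE /= big_split.
Qed.

End TensorPower.

(* The K_i are group-like: they act on the tensor power by K_i (x) ... (x) K_i. *)
Definition tensor_wt (K : fieldType) (q : K) (n : nat) (V : vectType K)
    (rho : rep (Uq q n) V) (k : nat) (mu : 'I_n -> rat) : {vspace tpow V k} :=
  wtspace q (fun i => tmap (k := k) (rho (uq_K q true i))) mu.

(* The space V (x) K[t, t^-1]: finitely supported families [f : int -> V], where
   [f] stands for the sum of the [f r (x) t ^ r]. *)

Section Loop.
Variables (K : fieldType) (V : lmodType K).

Definition finsupp : pred (int -> V) := fun f =>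
  `[< finite_set [set r | f r != 0]%classic >].

Lemma finsupp_submod_closed : submod_closed finsupp.
Proof.
split=> [|c f g /asboolP fS /asboolP gS]; apply/asboolP.
  suff -> : [set r | (0 : int -> V) r != 0]%classic = set0 by exact: finite_set0.
  by apply/seteqP; split => r //=; rewrite eqxx.
apply: (@sub_finite_set _ _ ([set r | f r != 0] `|` [set r | g r != 0])%classic).
  move=> r /= h; have [fr0|fr] := eqVneq (f r) 0; last by left.
  right; apply: contraNneq h => gr0.
  by rewrite /GRing.add /GRing.scale /= fr0 gr0 scaler0 addr0.
by rewrite finite_setU.
Qed.

HB.instance Definition _ :=
  GRing.isSubmodClosed.Build K (int -> V) finsupp finsupp_submod_closed.

Record loop := Loop { loop_val :> int -> V; loop_valP : loop_val \in finsupp }.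

HB.instance Definition _ := [isSub for loop_val].
HB.instance Definition _ := [Choice of loop by <:].
HB.instance Definition _ := [SubChoice_isSubLmodule of loop by <:].

Definition lpure_fun (v : V) (r : int) : int -> V :=
  fun k => if k == r then v else 0.

Lemma lpure_finsupp v r : lpure_fun v r \in finsupp.
Proof.
apply/asboolP; apply: (@sub_finite_set _ _ [set r]%classic) => //.
by move=> k /=; rewrite /lpure_fun; have [//|_] := eqVneq k r; rewrite eqxx.
Qed.

(* v (x) t ^ r *)
Definition lpure (v : V) (r : int) : loop := Loop (lpure_finsupp v r).

End Loop.

Section LoopModule.
Variables (K : fieldType) (q : K) (n : nat) (V : lmodType K).

(* [is_loop rho L]: [L] is the U_q^e-module structure of L(V, rho). *)
Definition is_loop (rho : rep (Uq q n) V) (L : rep (Uqe q n) (loop V)) : Prop :=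
  (forall (k : int) (a : Uq q n), uq_deg k a ->
     forall v r, L (a : Uqe q n) (lpure v r) = lpure (rho a v) (r + k)) /\
  (forall v r, L (ugen q (gD true)) (lpure v r) = q ^ r *: lpure v r).

(* L^s = U_q^e.(v (x) t ^ s) *)
Definition Lsub (L : rep (Uqe q n) (loop V)) (v : V) (s : int) :
    loop V -> Prop :=
  fun w => exists a, w = L a (lpure v s).

Definition Lwt (L : rep (Uqe q n) (loop V)) (nu : 'I_n -> int) (r : int) :
    loop V -> Prop :=
  fun w => (forall i, L (ugen q (gK true i)) w = q ^ nu i *: w) /\
           L (ugen q (gD true)) w = q ^ r *: w.

End LoopModule.

Definition has_dim (K : fieldType) (V : lmodType K) (W : V -> Prop) (k : nat) :
    Prop :=
  exists e : 'I_k -> V,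
    [/\ forall i, W (e i),
        forall c : 'I_k -> K, \sum_i c i *: e i = 0 -> forall i, c i = 0
      & forall w, W w -> exists c : 'I_k -> K, w = \sum_i c i *: e i].

Definition moebius (d : nat) : rat :=
  if all (fun p => logn p d == 1%N) (primes d) then (-1) ^+ size (primes d)
  else 0.

Definition phi_k (k : int) (d : nat) : rat :=
  (totient d)%:R * moebius (d %/ gcdn d `|k|)
    / (totient (d %/ gcdn d `|k|))%:R.

Section Drinfeld.
Variables (K : fieldType) (n : nat).

Definition pi0 : 'I_n -> {poly K} :=
  fun i => if i == 0%N :> nat then 1 - 'X else 1.

Definition pi_full (m : nat) (zeta : K) : 'I_n -> {poly K} :=
  fun i => if i == 0%N :> nat then
    \prod_(j < m) (1 - zeta ^ (j%:Z - 1) *: 'X) else 1.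

(* pi ^ (1/d) *)
Definition pi_root (m : nat) (zeta : K) (d : nat) : 'I_n -> {poly K} :=
  fun i => \prod_(j < m %/ d) (pi0 i \Po (zeta ^+ (j * d) *: 'X)).

End Drinfeld.
Arguments pi0 : clear implicits.

Section RationalFunctions.
Variable R : realType.

Definition Cq : fieldType := {fraction {poly R[i]}}.
Definition qvar : Cq := tofrac ('X : {poly R[i]}).
Definition Cq_const (z : R[i]) : Cq := tofrac (z%:P).

End RationalFunctions.

(* Main.v *)
From HB Require Import structures.
Require Import Defs.
From mathcomp Require Import all_boot all_order all_algebra.
From mathcomp Require Import generic_quotient fraction complex reals.
From mathcomp Require Import boolp classical_sets functions cardinality.
From mathcomp Require Import finmap.
From mathcomp.multinomials Require Import monalg.
From mathcomp Require Import zify ring lra.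
Import Order.TTheory GRing.Theory Num.Theory.

Set Implicit Arguments.
Unset Strict Implicit.
Unset Printing Implicit Defensive.

Local Open Scope ring_scope.

(** The module [V(pi)] has an explicit form. For [pi] concentrated at the first
   node, with distinct inverse roots [b_1, ..., b_M] none of whose ratios is
   [q^2], it is a tensor product of [M] evaluation modules of the natural
   representation, and the [h_{i,r}] are simultaneously diagonalisable: the
   eigenvectors are indexed by the configurations [c] that put each of [M] boxes in
   one of the states [0, ..., n], and the weight of such a vector is the sum of the
   weights of the states. Raising and lowering operators move one box at a time, by
   closed formulas that contain the spectral parameter [b_j q^i] of the box.

   Such formulas define an irreducible family of operators ([model_top],
   [model_gen]) in which the commutators of a lowering operator with raising
   operators and with Cartan elements have the prescribed values. The delicate one
   is [x^+] with [x^-]: the eigenvalues of [psi^+] and [psi^-] expand one rational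
   function at [0] and at infinity, and their difference is given by partial
   fractions ([psi_partial_fractions]). These commutators are enough to compare the operators
   with any given [V(pi)]: the subspace of [V(pi) + model] spanned by the words in
   lowering operators applied to the pair of highest weight vectors is stable under
   everything, and weights together with irreducibility show that it is the graph
   of an isomorphism ([model_unique]). Hence [V(pi^(1/d))] in weight [nu/d], and
   likewise the [m/d]-th tensor power of [V(pi^0)], has as dimension the number of
   configurations of [m/d] boxes of that weight ([V_wt_dim], [tensor_wt_dim]). This
   is the second equality.

   For [V(pi)] itself the parameters are all [m]-th roots of unity. Rotating the
   boxes multiplies the parameters by [zeta], and this makes an element of degree
   [k] of [U_q] shift the character of the rotation by [k]. Therefore the part of
   [L^s] in degree [r] consists of the vectors on which the rotation acts by
   [zeta^-(r - s)] ([Lwt_model]); equality, and not just inclusion, holds because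
   the [h_{1,k}] with [k] a nonzero multiple of [m] act on the highest weight vector by nonzero
   scalars. In weight [nu] its dimension is the number of orbits of rotation on
   configurations of weight [nu] on whose stabilisers that character is trivial.

   The configurations fixed by a rotation of order [d] are the [d]-fold
   repetitions of configurations of [m/d] boxes ([card_fixed]), and [phi_k] is the
   Ramanujan sum attached to the rotations of order [d]. Counting orbits with a
   character in the manner of Burnside ([sum_orbits], with [sum_phi_k] for the
   stabilisers) then gives the first equality. *)

(** * Divisor sums of Ramanujan sums *)

Lemma perm_primesM a b : (0 < a)%N -> (0 < b)%N -> coprime a b ->
  perm_eq (primes (a * b)) (primes a ++ primes b).
Proof.
move=> a0 b0 cab; apply: uniq_perm.
- exact: primes_uniq.
- by rewrite cat_uniq !primes_uniq -coprime_has_primes ?cab.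
- by move=> p; rewrite mem_cat primesM.
Qed.

Lemma moebiusM a b : (0 < a)%N -> (0 < b)%N -> coprime a b ->
  moebius (a * b) = moebius a * moebius b.
Proof.
move=> a0 b0 cab; rewrite /moebius.
have pe := perm_primesM a0 b0 cab.
rewrite (perm_all _ pe) all_cat (perm_size pe) size_cat.
have -> : all (fun p => logn p (a * b) == 1%N) (primes a)
   = all (fun p => logn p a == 1%N) (primes a).
  apply: eq_in_all => p pa; rewrite lognM // [logn p b]lognE.
  case: (boolP [&& _, _ & _]) => [/and3P[pp _ pb]|]; last by rewrite addn0.
  have := coprime_has_primes a0 b0; rewrite cab => /esym/hasPn/(_ p).
  by rewrite mem_primes pp b0 pb pa => /(_ isT).
have -> : all (fun p => logn p (a * b) == 1%N) (primes b)
   = all (fun p => logn p b == 1%N) (primes b).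
  apply: eq_in_all => p pa; rewrite lognM // [logn p a]lognE.
  case: (boolP [&& _, _ & _]) => [/and3P[pp _ pb]|]; last by rewrite add0n.
  have := coprime_has_primes a0 b0; rewrite cab => /esym/hasPn/(_ p pa).
  by rewrite /= mem_primes pp a0 pb.
case: (all _ (primes a)); case: (all _ (primes b)); rewrite /= ?mul0r ?mulr0 //.
by rewrite exprD.
Qed.

Lemma gcdn_coprimeMl a b k : coprime a b ->
  gcdn (a * b) k = (gcdn a k * gcdn b k)%N.
Proof.
move=> cab; apply/eqP; rewrite eqn_dvd; apply/andP; split; last first.
  rewrite Gauss_dvd.
    by rewrite !dvdn_gcd !dvdn_gcdr dvdn_mulr ?dvdn_gcdl // dvdn_mull ?dvdn_gcdl.
  exact: (coprime_dvdl (dvdn_gcdl a k) (coprime_dvdr (dvdn_gcdl b k) cab)).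
rewrite !muln_gcdr !muln_gcdl !dvdn_gcd dvdn_gcdl.
by rewrite (dvdn_mull _ (dvdn_gcdr _ _)) (dvdn_mulr _ (dvdn_gcdr _ _))
           (dvdn_mull _ (dvdn_gcdr _ _)).
Qed.

Lemma phi_kM k a b : (0 < a)%N -> (0 < b)%N -> coprime a b ->
  phi_k k (a * b) = phi_k k a * phi_k k b.
Proof.
move=> a0 b0 cab; rewrite /phi_k gcdn_coprimeMl //.
set ga := gcdn a _; set gb := gcdn b _.
have gaa : (ga %| a)%N by exact: dvdn_gcdl.
have gbb : (gb %| b)%N by exact: dvdn_gcdl.
have ga0 : (0 < ga)%N by rewrite gcdn_gt0 a0.
have gb0 : (0 < gb)%N by rewrite gcdn_gt0 b0.
have -> : ((a * b) %/ (ga * gb) = (a %/ ga) * (b %/ gb))%N.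
  by rewrite -{1}(divnK gaa) -{1}(divnK gbb) mulnACA mulnK ?muln_gt0 ?ga0.
have a'0 : (0 < a %/ ga)%N by rewrite divn_gt0 // dvdn_leq.
have b'0 : (0 < b %/ gb)%N by rewrite divn_gt0 // dvdn_leq.
have c' : coprime (a %/ ga) (b %/ gb).
  apply: (coprime_dvdl (dvdn_div gaa)); exact: (coprime_dvdr (dvdn_div gbb)).
rewrite moebiusM // !totient_coprime // !natrM invfM.
by ring.
Qed.

(** [phi_k k (p ^ j)] is the totient while [p ^ j] divides [k]; at the next
   exponent it equals minus the partial sum reached so far, and it vanishes
   afterwards. *)
Lemma sum_phi_k_pfactor k p a : prime p ->
  \sum_(j < a.+1) phi_k k (p ^ j) = if (p ^ a %| `|k|)%N then (p ^ a)%:R else 0.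
Proof.
move=> pp; have p0 := prime_gt0 pp.
have phiE j : (p ^ j %| `|k|)%N -> phi_k k (p ^ j) = (totient (p ^ j))%:R.
  move=> /gcdn_idPl; rewrite /phi_k => ->.
  rewrite divnn expn_gt0 p0 /= /moebius /= expr0.
  by rewrite mulr1 divr1.
elim: a => [|a IHa].
  by rewrite big_ord_recl big_ord0 addr0 dvd1n phiE // dvd1n.
rewrite big_ord_recr /= IHa.
have [dS|ndS] := boolP (p ^ a.+1 %| `|k|)%N.
  rewrite (dvdn_trans (dvdn_exp2l p (leqnSn a)) dS) phiE //.
  by rewrite totient_pfactor //= -natrD -mulSn prednK // expnS.
have [d|nd] := boolP (p ^ a %| `|k|)%N; last first.
  rewrite add0r /phi_k.
  suff -> : moebius (p ^ a.+1 %/ gcdn (p ^ a.+1) `|k|) = 0 by rewrite mulr0 mul0r.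
  have /(dvdn_pfactor _ _ pp) [t ta gE] := dvdn_gcdl (p ^ a.+1) `|k|.
  have tlt : (t < a)%N.
    rewrite ltnNge; apply: contra nd => le_at.
    by apply: dvdn_trans (dvdn_gcdr (p ^ a.+1) _); rewrite gE dvdn_exp2l.
  rewrite gE -expnB // /moebius.
  have -> : (a.+1 - t = (a - t).-1.+2)%N by lia.
  by rewrite primesX // primes_prime //= pfactorK.
have gE : gcdn (p ^ a.+1) `|k| = (p ^ a)%N.
  have /(dvdn_pfactor _ _ pp) [t ta gE] := dvdn_gcdl (p ^ a.+1) `|k|.
  rewrite gE; congr (_ ^ _)%N; apply/eqP; rewrite eqn_leq; apply/andP; split.
    rewrite -ltnS ltn_neqAle ta andbT; apply: contra ndS => /eqP e.
    by rewrite -e -gE dvdn_gcdr.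
  have := prime_gt1 pp => /dvdn_Pexp2l <-.
  by rewrite -gE dvdn_gcd d dvdn_exp2l.
rewrite /phi_k gE expnS mulnK ?expn_gt0 ?p0 // -expnS /moebius primes_prime //=.
rewrite (pfactorK 1) // ?eqxx /= totient_pfactor // totient_prime //=.
have pp1 : (p.-1)%:R != 0 :> rat.
  by rewrite pnatr_eq0 -lt0n -ltnS prednK ?prime_gt1.
rewrite natrM expr1; field.
by rewrite pp1.
Qed.

Lemma sum_divisorsM (F : nat -> rat) a b :
  (0 < a)%N -> (0 < b)%N -> coprime a b ->
  \sum_(d <- divisors (a * b)) F d
  = \sum_(d <- divisors a) \sum_(e <- divisors b) F (d * e)%N.
Proof.
move=> a0 b0 cab; rewrite -(big_allpairs_dep (h := fun x y => (x * y)%N)).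
apply: perm_big; apply: uniq_perm; first exact: divisors_uniq.
  rewrite allpairs_uniq ?divisors_uniq // => -[d e] [d' e'].
  case/allpairsP=> -[x y] /=; rewrite -!dvdn_divisors // => -[xa yb [-> ->]].
  case/allpairsP=> -[x' y'] /=; rewrite -!dvdn_divisors // => -[xa' yb' [-> ->]].
  have c u w : (u %| a)%N -> (w %| b)%N -> coprime u w.
    by move=> ua wb; exact: (coprime_dvdl ua (coprime_dvdr wb cab)).
  move=> E; suff [-> ->] : x = x' /\ y = y' by [].
  split; apply/eqP; rewrite eqn_dvd; apply/andP; split.
  - by rewrite -(@Gauss_dvdl _ _ y') ?c // -E dvdn_mulr.
  - by rewrite -(@Gauss_dvdl _ _ y) ?c // E dvdn_mulr.
  - by rewrite -(@Gauss_dvdr _ x') 1?coprime_sym ?c // -E dvdn_mull.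
  - by rewrite -(@Gauss_dvdr _ x) 1?coprime_sym ?c // E dvdn_mull.
move=> d; rewrite -dvdn_divisors ?muln_gt0 ?a0 //.
apply/idP/allpairsP => [dab|[[x y] /= []]]; last first.
  by rewrite -!dvdn_divisors // => xa yb ->; rewrite dvdn_mul.
exists (gcdn a d, gcdn b d) => /=; rewrite -!dvdn_divisors // !dvdn_gcdl; split=> //.
by rewrite -gcdn_coprimeMl //; apply/esym/gcdn_idPr.
Qed.

(** [phi_k k d] is the Ramanujan sum of the [k]-th powers of the primitive
   [d]-th roots of unity, so the left-hand side is the sum of the [k]-th powers
   of all [e]-th roots of unity. Here the value comes from multiplicativity in
   [d], which leaves the case of prime powers. *)
Lemma sum_phi_k k e : (0 < e)%N ->
  \sum_(d <- divisors e) phi_k k d = if (e %| `|k|)%N then e%:R else 0.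
Proof.
have [N] := ubnP e; elim: N e => // N IHN e /ltnSE eN e0.
have [->|e1] := eqVneq e 1%N.
  by rewrite dvd1n big_seq1 /phi_k gcd1n divn1 /moebius /= expr0 mulr1 divr1.
have {}e1 : (1 < e)%N by rewrite ltn_neqAle eq_sym e1.
have pp := pdiv_prime e1; set p := pdiv e in pp.
have [e' ce eE] := pfactor_coprime pp e0; set a := logn p e in eE.
have a0 : (0 < a)%N by rewrite logn_gt0 mem_primes pp e0 pdiv_dvd.
have pa0 : (0 < p ^ a)%N by rewrite expn_gt0 prime_gt0.
have e'0 : (0 < e')%N by move: e0; rewrite eE muln_gt0; case/andP.
have cpe : coprime (p ^ a) e' by rewrite coprimeXl.
rewrite eE mulnC sum_divisorsM // Gauss_dvd //.
transitivity ((\sum_(d <- divisors (p ^ a)) phi_k k d)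
   * (\sum_(d <- divisors e') phi_k k d)).
  rewrite mulr_suml big_seq [RHS]big_seq; apply: eq_bigr => d.
  rewrite -dvdn_divisors // => dpa.
  rewrite mulr_sumr big_seq [RHS]big_seq; apply: eq_bigr => d'.
  rewrite -dvdn_divisors // => de'.
  apply: phi_kM; rewrite ?(dvdn_gt0 _ dpa) ?(dvdn_gt0 _ de') //.
  exact: (coprime_dvdl dpa (coprime_dvdr de' cpe)).
rewrite (IHN e') //; last first.
  suff: (e' < e' * p ^ a)%N by rewrite -eE => /leq_trans; apply.
  rewrite ltn_Pmulr //; apply: leq_trans (prime_gt1 pp) _.
  by rewrite -{1}(expn1 p) leq_exp2l ?prime_gt1.
have -> : \sum_(d <- divisors (p ^ a)) phi_k k d = \sum_(j < a.+1) phi_k k (p ^ j).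
  rewrite -(big_mkord xpredT (fun j => phi_k k (p ^ j))) -[RHS](big_map (expn p) xpredT).
  apply: perm_big; apply: uniq_perm; first exact: divisors_uniq.
    rewrite map_inj_uniq ?iota_uniq //.
    by move=> x y /eqP; rewrite eqn_exp2l ?prime_gt1 // => /eqP.
  move=> d; rewrite -dvdn_divisors //.
  apply/(dvdn_pfactor _ _ pp)/mapP => [[j ja ->]|[j]].
    by exists j => //; rewrite mem_index_iota.
  by rewrite mem_index_iota => ja ->; exists j.
rewrite sum_phi_k_pfactor // natrM.
by case: ifP => _; rewrite ?mul0r //=; case: ifP; rewrite ?mulr0.
Qed.

(** * Exponentials of power series and partial fractions *)

Section Exponentials.
Variable K : fieldType.
Hypothesis char0 : forall n, n.+1%:R != 0 :> K.
Implicit Types (p psi chi : {poly K}) (N r k : nat).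

Lemma fact_neq0 k : (k`!)%:R != 0 :> K.
Proof. by have := fact_gt0 k; case: (k`!)%N. Qed.

Lemma coef_exp_small p k r : p`_0 = 0 -> (r < k)%N -> (p ^+ k)`_r = 0.
Proof.
move=> p0; elim: k r => // k IHk r rk; rewrite exprS coefM big1 // => -[[|i] /= ir] _.
  by rewrite p0 mul0r.
by rewrite IHk ?mulr0 //; lia.
Qed.

Lemma ps_pow_coef (f : nat -> K^o) N k r : (r < N)%N ->
  ps_pow f k r = ((\poly_(i < N) (f i : K)) ^+ k)`_r.
Proof.
elim: k r => [|k IHk] r rN; first by rewrite expr0 coef1.
rewrite exprS coefM /=; apply: eq_bigr => -[i /= ir] _.
by rewrite IHk ?coef_poly; [rewrite ifT //; lia | lia].
Qed.

Definition texp N p : {poly K} := \sum_(k < N) (k`!%:R)^-1 *: p ^+ k.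

(** Below order [N] the exponential is a polynomial, which makes products and
   derivatives of polynomials available. *)
Lemma exp_coef_texp (f : nat -> K^o) N r : f 0%N = 0 -> (r < N)%N ->
  exp_coef f r = (texp N (\poly_(i < N) (f i : K)))`_r.
Proof.
move=> f0 rN; set p := \poly_(i < N) _.
have p0 : p`_0 = 0 by rewrite coef_poly f0 if_same.
rewrite /texp coef_sum /exp_coef.
rewrite (big_ord_widen N (fun k => (k`!%:R)^-1 *: ps_pow f k r)) // big_mkcond /=.
apply: eq_bigr => k _; rewrite coefZ; case: ltnP => kr.
  by rewrite (ps_pow_coef _ _ rN).
by rewrite coef_exp_small ?mulr0.
Qed.

(** The equation [psi' = p' psi] modulo ['X^(N - 1)]. It characterises [exp p]
   modulo ['X^N] among the series with the same constant term, and turns products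
   of solutions into sums of exponents. *)
Definition logder N p psi :=
  forall r, (r.+1 < N)%N -> psi^`()`_r = (p^`() * psi)`_r.

Lemma logder_texp N p : p`_0 = 0 -> logder N p (texp N p).
Proof.
move=> p0 r; case: N => // N; rewrite ltnS => rN.
have -> : (texp N.+1 p)^`() = p^`() * texp N p.
  rewrite /texp big_ord_recl expr0 derivD derivZ derivE scaler0 add0r.
  rewrite raddf_sum mulr_sumr; apply: eq_bigr => k _ /=.
  rewrite derivZ deriv_exp /= -scalerAr -scaler_nat scalerA; congr (_ *: _).
  by rewrite /bump add1n factS natrM invfM mulrAC mulVf ?mul1r ?fact_neq0.
rewrite /texp big_ord_recr /= mulrDr coefD -scalerAr coefZ.
rewrite [X in _ + _ * X]coefM [X in _ + _ * X]big1 ?mulr0 ?addr0 // => -[i /= ir] _.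
by rewrite (@coef_exp_small p) ?mulr0 //; lia.
Qed.

(** The equation gives [r + 1] times the coefficient of degree [r + 1] in terms
   of the lower ones. *)
Lemma logder_uniq N p psi chi : psi`_0 = chi`_0 ->
  logder N p psi -> logder N p chi -> forall r, (r < N)%N -> psi`_r = chi`_r.
Proof.
move=> e0 lp lc r; have [n] := ubnP r; elim: n r => // n IHn [|r] rn rN //.
have := lp _ rN; have := lc _ rN; rewrite !coef_deriv !coefM => hc hp.
apply: (mulIf (char0 r)); rewrite !mulr_natr hp hc.
by apply: eq_bigr => -[i /= ir] _; rewrite IHn //; lia.
Qed.

Lemma coefM_eql N p psi chi : (forall r, (r < N)%N -> psi`_r = chi`_r) ->
  forall r, (r < N)%N -> (psi * p)`_r = (chi * p)`_r.
Proof.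
move=> e r rN; rewrite !coefM; apply: eq_bigr => -[i /= ir] _; rewrite e //; lia.
Qed.

Lemma logderM N p1 p2 psi1 psi2 : logder N p1 psi1 -> logder N p2 psi2 ->
  logder N (p1 + p2) (psi1 * psi2).
Proof.
move=> l1 l2 r rN; case: N => // N in rN l1 l2 *.
rewrite derivM derivD mulrDl !coefD mulrA; congr (_ + _).
  exact: (@coefM_eql N).
rewrite mulrC [psi1 * _]mulrC mulrA; exact: (@coefM_eql N).
Qed.

Lemma logder0 N : logder N 0 1.
Proof. by move=> r _; rewrite derivE deriv0 mul0r. Qed.

Lemma logder_prod N (I : finType) (p psi : I -> {poly K}) :
  (forall i, logder N (p i) (psi i)) -> logder N (\sum_i p i) (\prod_i psi i).
Proof.
by move=> h; apply: (big_rec2 (fun a b => logder N a b)) => [|i a b _];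
  [exact: logder0 | exact: logderM].
Qed.

(** Truncation of [1 / (1 - x u)]. *)
Definition geo N (x : K) : {poly K} := \poly_(k < N) x ^+ k.
(** Truncation of [- log (1 - x u)]. *)
Definition tlog N (x : K) : {poly K} := \poly_(k < N) (x ^+ k / k%:R).

Lemma tlog_deriv N x r : (r.+1 < N)%N -> (tlog N x)^`()`_r = x ^+ r.+1.
Proof.
by move=> rN; rewrite coef_deriv coef_poly rN -[LHS]mulr_natr mulfVK ?char0.
Qed.

Lemma logder_geo N x : logder N (tlog N x) (geo N x).
Proof.
move=> r rN; rewrite coef_deriv coefM coef_poly rN.
rewrite (eq_bigr (fun _ => x ^+ r.+1)) ?sumr_const ?card_ord // => -[i /= ir] _.
rewrite tlog_deriv ?coef_poly; last by lia.
by rewrite ifT; [rewrite -exprD; congr (_ ^+ _); lia | lia].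
Qed.

Lemma logder_lin N z : logder N (- tlog N z) (1 - z *: 'X).
Proof.
move=> r rN; rewrite derivN derivB derivZ derivX derivE sub0r coefN coefZ coef1.
rewrite mulNr coefN mulrBr mulr1 -scalerAr coefB coefZ coefMX.
case: r rN => [|r] rN /=; rewrite tlog_deriv //; first by rewrite mulr0 subr0 mulr1 expr1.
by rewrite tlog_deriv ?(ltnW rN) // -exprS subrr mulr0.
Qed.

(** The exponent is the sum of [log (1 - z_j u) - log (1 - x_j u)] over [j], and
   each factor of the product solves the equation of its own logarithm. *)
Lemma exp_coef_quot (I : finType) (x z : I -> K) (f : nat -> K^o) N r :
  (forall k, f k = \sum_j (x j ^+ k - z j ^+ k) / k%:R) -> (r < N)%N ->
  exp_coef f r = (\prod_j (geo N (x j) * (1 - z j *: 'X)))`_r.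
Proof.
move=> fE rN; have f0 : f 0%N = 0.
  by rewrite fE big1 // => j _; rewrite invr0 mulr0.
rewrite (exp_coef_texp f0 rN).
set p := \poly_(i < N) _.
have pE : p = \sum_j (tlog N (x j) - tlog N (z j)).
  apply/polyP => i; rewrite coef_poly coef_sum.
  case: ltnP => iN.
    by rewrite fE; apply: eq_bigr => j _; rewrite coefB !coef_poly iN mulrBl.
  by rewrite big1 // => j _; rewrite coefB !coef_poly ltnNge iN subrr.
have p0 : p`_0 = 0 by rewrite coef_poly f0 if_same.
have N0 : (0 < N)%N by exact: leq_ltn_trans rN.
apply: (@logder_uniq N p) => //; last 2 first.
- exact: logder_texp.
- by rewrite pE; apply: logder_prod => j; apply: logderM;
    [exact: logder_geo | exact: logder_lin].
rewrite -!horner_coef0 horner_prod big1; last first.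
  move=> j _; rewrite hornerM hornerD hornerN hornerZ hornerX hornerC mulr0 subr0 mulr1 horner_coef0 coef_poly N0.
  by rewrite expr0.
case: N N0 {rN p0 pE} @p => // N _ p; rewrite /texp big_ord_recl expr0 hornerD.
rewrite hornerZ hornerC fact0 invr1 mulr1 horner_sum big1 ?addr0 // => k _.
by rewrite hornerZ horner_exp horner_coef0 coef_poly /= f0 /= expr0n mulr0.
Qed.

Lemma geo_lin N x r : (r < N)%N -> (geo N x * (1 - x *: 'X))`_r = (1 : {poly K})`_r.
Proof.
move=> rN; rewrite mulrBr mulr1 -scalerAr coefB coefZ coefMX coef_poly rN coef1.
case: r rN => [|r] rN /=; first by rewrite mulr0 subr0.
by rewrite coef_poly (ltnW rN) -exprS subrr.
Qed.

Lemma coef_prod1 N (I : finType) (P : pred I) (F : I -> {poly K}) :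
  (forall i r, (r < N)%N -> (F i)`_r = (1 : {poly K})`_r) ->
  forall r, (r < N)%N -> (\prod_(i | P i) F i)`_r = (1 : {poly K})`_r.
Proof.
move=> F1; apply: (big_ind (fun p => forall r, (r < N)%N -> p`_r = (1 : {poly K})`_r)) => //.
  by move=> p s hp hs r rN; rewrite (coefM_eql s hp rN) mul1r hs.
by move=> i _; exact: F1.
Qed.

Lemma prod_lin_size (I : Type) (s : seq I) (P : pred I) (a b : I -> K) :
  (size (\prod_(i <- s | P i) ((a i)%:P + b i *: 'X) : {poly K})%R <= (count P s).+1)%N /\
  (\prod_(i <- s | P i) ((a i)%:P + b i *: 'X))`_(count P s) = \prod_(i <- s | P i) b i.
Proof.
elim: s => [|i s [IH1 IH2]]; first by rewrite !big_nil size_poly1 coef1.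
rewrite !big_cons; case: ifP => Pi /=; rewrite Pi ?add0n //.
set Q := \prod_(i <- _ | _) _ in IH1 IH2 *; rewrite mulrDl -scalerAl mul_polyC.
split.
  apply: leq_trans (size_polyD _ _) _; rewrite geq_max; apply/andP; split.
    by apply: leq_trans (size_scale_leq _ _) _; exact: leqW.
  by apply: leq_trans (size_scale_leq _ _) _; rewrite (leq_trans (size_polyMleq _ _)) // size_polyX.
rewrite coefD !coefZ coefXM /= add1n /= IH2.
by rewrite (leq_sizeP _ _ IH1) ?mulr0 ?add0r.
Qed.

Variables (I : finType) (p y : I -> K).
Hypotheses (p0 : forall j, p j != 0) (y0 : forall j, y j != 0) (yI : injective y).

(** The coefficient of [1 / (1 - y_j u)] in the partial fractions of
   [prod_l (p_l - p_l^-1 y_l u) / (1 - y_l u)]. *)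
Definition residue j :=
  (p j - (p j)^-1) *
  \prod_(l | l != j) ((p l * y j - (p l)^-1 * y l) / (y j - y l)).

Let lin j : {poly K} := 1 - y j *: 'X.

(** With [#|I|] factors, the difference of the two sides has degree less than
   [#|I|] because the top coefficients agree, and it vanishes at the [#|I|]
   points [1 / y_j]. *)
Lemma partial_fractions :
  \prod_j ((p j)%:P - ((p j)^-1 * y j) *: 'X) =
  (\prod_j (p j)^-1) *: \prod_j lin j
  + \sum_j residue j *: \prod_(l | l != j) lin l.
Proof.
have linE j : lin j = 1%:P + (- y j) *: 'X by rewrite scaleNr.
apply/eqP; rewrite -subr_eq0; set D := _ - _.
have szD : (size D <= #|I|)%N.
  have cI : count xpredT (index_enum I) = #|I| by rewrite count_predT cardT enumT.
  have [s1 c1] := prod_lin_size (index_enum I) xpredT p (fun j => - ((p j)^-1 * y j)).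
  have [s2 c2] := prod_lin_size (index_enum I) xpredT (fun=> 1) (fun j => - y j).
  rewrite cI in s1 c1 s2 c2.
  have e1 : \prod_j ((p j)%:P - ((p j)^-1 * y j) *: 'X)
     = \prod_j ((p j)%:P + (- ((p j)^-1 * y j)) *: 'X).
    by apply: eq_bigr => j _; rewrite scaleNr.
  have e2 : \prod_j lin j = \prod_j (1%:P + (- y j) *: 'X) by exact: eq_bigr.
  have sR : (size (\sum_j residue j *: \prod_(l | l != j) lin l : {poly K})%R <= #|I|)%N.
    apply: leq_trans (size_sum _ _ _) _; apply/bigmax_leqP => j _.
    apply: leq_trans (size_scale_leq _ _) _.
    have [+ _] := prod_lin_size (index_enum I) (predC1 j) (fun=> 1) (fun l => - y l).
    rewrite -(eq_bigr _ (fun l _ => linE l)) /= => /leq_trans; apply.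
    by rewrite -[X in (_ < X)%N]cI count_predT -(count_predC (predC1 j)) -addn1 leq_add2l
       -has_count; apply/hasP; exists j; rewrite ?mem_index_enum //= negbK.
  apply/leq_sizeP => i; rewrite leq_eqVlt => /predU1P[<-|ltIi]; last first.
    rewrite /D !(coefD, coefN, coefZ) e1 e2 (leq_sizeP _ _ s1) ?(leq_sizeP _ _ s2) //.
    by rewrite (leq_sizeP _ _ sR) ?(ltnW ltIi) // mulr0 addr0 subr0.
  rewrite /D !(coefD, coefN, coefZ) e1 e2 c1 c2 (leq_sizeP _ _ sR) // addr0.
  rewrite -big_split /=; apply/eqP; rewrite subr_eq0; apply/eqP.
  by apply: eq_bigr => j _; rewrite mulrN.
have rootD j : root D (y j)^-1.
  have linj : (lin j).[(y j)^-1] = 0.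
    by rewrite !hornerE mulfV ?subrr.
  rewrite /root /D hornerD hornerN hornerD !hornerZ horner_prod.
  rewrite [X in _ * X.[_]](bigD1 j) //= hornerM linj mul0r mulr0 add0r.
  rewrite horner_sum [X in _ - X](bigD1 j) //= [X in _ - (_ + X)]big1 => [|l lj]; last first.
    by rewrite hornerZ (bigD1 j) 1?eq_sym //= hornerM linj mul0r mulr0.
  rewrite addr0 hornerZ (bigD1 j) //= /residue horner_prod -mulrA -big_split /=.
  rewrite subr_eq0; apply/eqP; congr (_ * _).
    by rewrite !hornerE mulfK.
  apply: eq_bigr => l lj; rewrite !hornerE.
  have yjl : y j - y l != 0 by rewrite subr_eq0 (inj_eq yI) eq_sym.
  by field; rewrite y0 p0 yjl.
have := @max_poly_roots _ D [seq (y j)^-1 | j <- enum I].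
have [//|D0] := eqVneq D 0 => /(_ isT).
have -> : all (root D) [seq (y j)^-1 | j <- enum I].
  by apply/allP => _ /mapP[j _ ->].
rewrite map_inj_uniq ?enum_uniq => [/(_ isT isT)|]; last first.
  by move=> j l /invr_inj/yI.
by rewrite size_map -cardE => /leq_trans/(_ szD); rewrite ltnn.
Qed.

Lemma exp_coef_partial_fractions (f : nat -> K^o) r :
  (forall k, f k = \sum_j (1 - (p j)^-1 ^+ (2 * k)) * y j ^+ k / k%:R) ->
  (\prod_j p j) * exp_coef f r =
  (r == 0)%:R * (\prod_j (p j)^-1) + \sum_j residue j * y j ^+ r.
Proof.
move=> fE; pose N := r.+1; have rN : (r < N)%N by [].
rewrite (@exp_coef_quot _ y (fun j => (p j)^-1 ^+ 2 * y j) f N) //; last first.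
  move=> k; rewrite fE; apply: eq_bigr => j _.
  by rewrite exprMn -exprM mulrBl mul1r.
rewrite -coefZ -mul_polyC rmorph_prod big_split /= mulrCA -big_split /=.
have -> : \prod_j ((p j)%:P * (1 - ((p j)^-1 ^+ 2 * y j) *: 'X)) =
   \prod_j ((p j)%:P - ((p j)^-1 * y j) *: 'X).
  apply: eq_bigr => j _; rewrite mulrBr mulr1 mul_polyC scalerA mulrA expr2.
  by rewrite mulrA mulfV // mul1r.
rewrite partial_fractions mulrDr coefD -scalerAr coefZ -big_split /=.
rewrite (@coef_prod1 N) //; last by move=> i k kN; exact: geo_lin.
rewrite coef1 mulrC; congr (_ + _); rewrite mulr_sumr coef_sum.
apply: eq_bigr => j _; rewrite -scalerAr coefZ; congr (_ * _).
rewrite (bigD1 j) //= -mulrA -big_split /= mulrC.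
rewrite (@coefM_eql N _ _ 1) ?mul1r ?coef_poly ?rN //.
by apply: coef_prod1 => i k kN; exact: geo_lin.
Qed.

End Exponentials.

(** * An explicit module on functions of box configurations *)

(** Each of [M] boxes, one for every spectral parameter, is in one of the states
   [0, ..., n], which index a basis of the natural representation. *)
Definition config n M := {ffun 'I_M -> 'I_n.+1}.

Definition box n (d : bool) (i : 'I_n) : 'I_n.+1 :=
  if d then widen_ord (leqnSn n) i else lift ord0 i.

Arguments box : simpl never.

Lemma box_eq n d (i k : 'I_n) : (box d i == box d k) = (i == k).
Proof.
case: d; rewrite -val_eqE //=; exact: eqSS.
Qed.

Lemma box_neq n (i k : 'I_n) : (box true i == box false k) = (i == k.+1 :> nat).
Proof. by rewrite -val_eqE. Qed.

Definition eps n (i : 'I_n) (s : 'I_n.+1) : int :=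
  (s == box true i)%:Z - (s == box false i)%:Z.

Lemma eps_cartan n (i k : 'I_n) :
  eps i (box true k) - eps i (box false k) = cartan i k.
Proof.
rewrite /eps /cartan -!val_eqE /= /bump /= !add1n.
by repeat (case: eqP => ?); rewrite /=; lia.
Qed.

(** The module below is the tensor product of the evaluation modules of the
   natural representation at the parameters [b_j], in a basis of common
   eigenvectors of the [h_{i,r}], one for each configuration. A raising or
   lowering operator moves a single box between the states [i] and [i + 1]; the
   box [j] then contributes the power [beta i j ^ r] of its parameter. *)
Section Model.
Variables (K : fieldType) (q : K) (n M : nat) (b : 'I_M -> K).
Hypothesis char0 : forall r, r.+1%:R != 0 :> K.
Hypotheses (q0 : q != 0) (qq0 : q - q^-1 != 0).
Hypotheses (b0 : forall j, b j != 0) (bI : injective b).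
Hypothesis bq : forall j l, q * b j - q^-1 * b l != 0.

Implicit Types (i k : 'I_n) (j l : 'I_M) (r s t : int) (d e : bool).

Local Notation fconfig := (config n M).
Local Notation model := {ffun fconfig -> K^o}.
Implicit Types (c : fconfig) (x y : model).

Definition upd c j (a : 'I_n.+1) : fconfig := [ffun l => if l == j then a else c l].

Lemma updE c j a l : upd c j a l = if l == j then a else c l.
Proof. by rewrite ffunE. Qed.

Lemma upd_upd c j a a' : upd (upd c j a) j a' = upd c j a'.
Proof. by apply/ffunP => l; rewrite !updE; case: (l == j). Qed.

Lemma upd_id c j a : c j = a -> upd c j a = c.
Proof. by move=> <-; apply/ffunP => l; rewrite ffunE; case: eqP => [->|]. Qed.

Lemma updC c j l a a' : j != l -> upd (upd c j a) l a' = upd (upd c l a') j a.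
Proof.
move=> jl; apply/ffunP => m; rewrite !ffunE; case: eqP => [->|//].
by rewrite eq_sym (negbTE jl).
Qed.

Definition wt i c : int := \sum_j eps i (c j).
Definition Kval e i c : K := q ^ sgi e (wt i c).
Definition beta i j : K := b j * q ^+ i.
(** The eigenvalue of [h_{i,r}] on a box in state [a], up to the power of its
   parameter: [q^-r [r] / r] in state [i], [- q^r [r] / r] in state [i + 1], and
   [0] in the other states. *)
Definition hval i r (a : 'I_n.+1) : K :=
  (1 - q ^ (- (2 * r * eps i a))) / (r%:~R * (q - q^-1)).
Definition Hval i r c : K := \sum_j hval i r (c j) * beta i j ^ r.

(** Exchange factors between a moving box of parameter [u] and a box of
   parameter [w]. Raising operators see the boxes in state [i + 1] and lowering
   operators those in state [i]; with this normalisation operators on different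
   boxes commute and the composite of two opposite moves of one box is, up
   to a scalar, a residue of the [psi]-series. *)
Definition cf d (u w : K) : K :=
  if d then (q * w - q^-1 * u) / (w - u) else (q * u - q^-1 * w) / (u - w).
Arguments cf : simpl never.
Definition Coef d i j c : K :=
  \prod_(l | l != j) if c l == box (~~ d) i then cf d (b j) (b l) else 1.

(** Operators act on functions of configurations, so the value at [c] is read
   off the configuration from which the box [j] has been moved. *)
Definition xop1 d i j x : model :=
  [ffun c : fconfig => if c j == box d i then Coef d i j c * x (upd c j (box (~~ d) i)) else 0].
Definition xop d i r x : model := \sum_j beta i j ^ r *: xop1 d i j x.
Definition diag_op (F : fconfig -> K) x : model := [ffun c => F c * x c].

Definition psival e i t c : K :=
  if 0 <= sgi e t then
    Kval e i c * exp_coef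
      (fun s : nat => (sgk K e * (q - q^-1)) * Hval i (sgi e s) c : K^o) `|t|%N
  else 0.

Lemma xopE d i r x c : xop d i r x c =
  \sum_j (if c j == box d i then
    beta i j ^ r * (Coef d i j c * x (upd c j (box (~~ d) i))) else 0).
Proof.
rewrite /xop sum_ffunE; apply: eq_bigr => j _; rewrite !ffunE.
by case: ifP => _; rewrite ?scaler0.
Qed.

Lemma xop1_linear d i j (a : K) x y : xop1 d i j (a *: x + y) = a *: xop1 d i j x + xop1 d i j y.
Proof.
apply/ffunP => c; rewrite !ffunE; case: ifP => _; last by rewrite scaler0 addr0.
by rewrite mulrDr; congr (_ + _); rewrite /GRing.scale /= mulrCA.
Qed.

Lemma xop_linear d i r (a : K) x y : xop d i r (a *: x + y) = a *: xop d i r x + xop d i r y.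
Proof.
rewrite /xop scaler_sumr -big_split /=; apply: eq_bigr => j _.
by rewrite xop1_linear scalerDr !scalerA mulrC.
Qed.

Lemma diag_op_linear F (a : K) x y : diag_op F (a *: x + y) = a *: diag_op F x + diag_op F y.
Proof.
by apply/ffunP => c; rewrite !ffunE mulrDr; congr (_ + _); rewrite /GRing.scale /= mulrCA.
Qed.

Lemma q_sum (I : Type) (s : seq I) (P : pred I) (F : I -> int) :
  q ^ (\sum_(i <- s | P i) F i) = \prod_(i <- s | P i) q ^ F i.
Proof. by apply: (big_morph (fun z => q ^ z)) => [u w|//]; exact: expfzDr. Qed.

Lemma wt_upd i c j a : wt i (upd c j a) = wt i c - eps i (c j) + eps i a.
Proof.
rewrite /wt (bigD1 j) //= [in RHS](bigD1 j) //= updE eqxx.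
rewrite (eq_bigr (fun l => eps i (c l))); last by move=> l /negbTE lj; rewrite updE lj.
by ring.
Qed.

Lemma wt_updX i k c j d : c j = box d k ->
  wt i (upd c j (box (~~ d) k)) = wt i c - sgi d (cartan i k).
Proof.
by move=> cj; rewrite wt_upd cj -eps_cartan; case: d cj => _ /=; ring.
Qed.

Lemma Kval_xop e i d k r x :
  diag_op (Kval e i) (xop d k r x) =
  q ^ sgi d (sgi e (cartan i k)) *: xop d k r (diag_op (Kval e i) x).
Proof.
apply/ffunP => c; rewrite !ffunE !xopE mulr_sumr scaler_sumr; apply: eq_bigr => j _.
case: eqP => cj; last by rewrite mulr0 scaler0.
rewrite ffunE /Kval (wt_updX _ cj) /GRing.scale /=.
have -> : sgi e (wt i c) = sgi d (sgi e (cartan i k)) + sgi e (wt i c - sgi d (cartan i k)).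
  by case: (e); case: (d) => /=; ring.
by rewrite expfzDr //; ring.
Qed.

Lemma Hval_upd i r c j a :
  Hval i r (upd c j a) = Hval i r c + (hval i r a - hval i r (c j)) * beta i j ^ r.
Proof.
rewrite /Hval (bigD1 j) //= [in RHS](bigD1 j) //= updE eqxx.
rewrite (eq_bigr (fun l => hval i r (c l) * beta i l ^ r)).
  by ring.
by move=> l /negbTE lj; rewrite updE lj.
Qed.

(** The shift by [q ^ i] in [beta i j] is made for this identity: at a
   neighbouring node the moved box has the parameter [q^+-1] times the one of the
   operator. *)
Lemma hval_diff i k r j :
  (hval i r (box true k) - hval i r (box false k)) * beta i j ^ r =
  r%:~R^-1 * qint q (r * cartan i k) * beta k j ^ r.
Proof.
have key : (q ^ (- (2 * r * eps i (box false k))) - q ^ (- (2 * r * eps i (box true k))))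
      * q ^ (i%:Z * r) = (q ^ (r * cartan i k) - q ^ (- (r * cartan i k))) * q ^ (k%:Z * r).
  rewrite !mulrBl -!expfzDr //.
  have a0 := eps_cartan i k.
  have [ik|nik] := eqVneq i k.
    rewrite ik /cartan /eps !box_eq box_neq [box false k == _]eq_sym box_neq !eqxx.
    have -> : (k == k.+1 :> nat) = false by lia.
    by rewrite /=; congr (q ^ _ - q ^ _); ring.
  move: nik; rewrite /cartan /eps -!val_eqE /= /bump /= !add1n => /negbTE nik.
  have nki : (k == i :> nat) = false by rewrite eq_sym.
  rewrite !eqSS nik ?nki /=.
  case: (eqVneq (k : nat) i.+1) => [->|ki] /=.
    have -> : (i.+2 == i) = false by lia.
    by rewrite /=; congr (q ^ _ - q ^ _); lia.
  case: (eqVneq k.+1 (i : nat)) => [<-|ki'] /=.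
    by rewrite /=; congr (q ^ _ - q ^ _); lia.
  by rewrite !subrr !mulr0 !subrr.
have -> : hval i r (box true k) - hval i r (box false k) =
    (q ^ (- (2 * r * eps i (box false k))) - q ^ (- (2 * r * eps i (box true k))))
      / (r%:~R * (q - q^-1)).
  by rewrite /hval -mulrBl; congr (_ / _); ring.
rewrite /qint /beta !expfzMl.
rewrite !exprnP !exprz_exp invfM.
by transitivity (r%:~R^-1 * (q - q^-1)^-1 * b j ^ r *
  ((q ^ (- (2 * r * eps i (box false k))) - q ^ (- (2 * r * eps i (box true k))))
      * q ^ (i%:Z * r))); [|rewrite key]; ring.
Qed.

Lemma Hval_xop i r d k s x :
  diag_op (Hval i r) (xop d k s x) - xop d k s (diag_op (Hval i r) x) =
  (sgk K d * (r%:~R^-1 * qint q (r * cartan i k))) *: xop d k (r + s) x.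
Proof.
apply/ffunP => c; rewrite !ffunE !xopE mulr_sumr scaler_sumr -sumrB; apply: eq_bigr => j _.
case: eqP => cj; last by rewrite mulr0 scaler0 subrr.
rewrite ffunE Hval_upd cj /GRing.scale /= expfzDr ?mulf_neq0 ?expf_neq0 //.
have := hval_diff i k r j.
set P := beta i j ^ r; set Q := beta k j ^ r; set R := _ * qint _ _.
rewrite /sgk; case: d cj => _ /= e.
  transitivity ((hval i r (box true k) - hval i r (box false k)) * P *
    (beta k j ^ s * (Coef true k j c * x (upd c j (box false k))))); first by ring.
  by rewrite e; ring.
transitivity (- ((hval i r (box true k) - hval i r (box false k)) * P *
    (beta k j ^ s * (Coef false k j c * x (upd c j (box true k)))))); first by ring.
by rewrite e; ring.
Qed.

Lemma Coef_upd_same d i j c a : Coef d i j (upd c j a) = Coef d i j c.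
Proof. by apply: eq_bigr => l /negbTE lj; rewrite updE lj. Qed.

Lemma Coef_upd d i l j c a : j != l ->
  Coef d i l (upd c j a) * (if c j == box (~~ d) i then cf d (b l) (b j) else 1)
  = Coef d i l c * (if a == box (~~ d) i then cf d (b l) (b j) else 1).
Proof.
move=> jl; rewrite /Coef (bigD1 j) //= [in RHS](bigD1 j) //= updE eqxx.
rewrite (eq_bigr (fun m => if c m == box (~~ d) i then cf d (b l) (b m) else 1)).
  by ring.
by move=> m /andP[_ /negbTE mj]; rewrite updE mj.
Qed.

Lemma cf_neq0 d j l : j != l -> cf d (b j) (b l) != 0.
Proof.
move=> jl; rewrite /cf; case: d; rewrite mulf_neq0 ?bq ?invr_eq0 ?subr_eq0 ?(inj_eq bI) //.
by rewrite eq_sym.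
Qed.

Lemma Coef_neq0 d i j c : Coef d i j c != 0.
Proof.
apply/prodf_neq0 => l lj; case: ifP; rewrite ?oner_eq0 // => _.
by apply: cf_neq0; rewrite eq_sym.
Qed.

(** When the two boxes interact, moving either one first adds or removes the same
   exchange factor. *)
Lemma xop1_comm i j k l x : j != l -> xop1 true i j (xop1 false k l x) = xop1 false k l (xop1 true i j x).
Proof.
move=> jl; have lj : l != j by rewrite eq_sym.
apply/ffunP => c; rewrite !ffunE /= (negbTE jl) (negbTE lj).
case: (c j =P box true i) => cj; case: (c l =P box false k) => cl; rewrite ?mulr0 //.
rewrite (updC _ _ _ jl) !mulrA; congr (_ * _).
have cfT : cf true (b j) (b l) = cf false (b l) (b j) by [].
have := Coef_upd false k c (box false i) jl; have := Coef_upd true i c (box true k) lj.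
rewrite /= cj cl !box_eq cfT [box true k == _]eq_sym [k == i]eq_sym.
set F := cf false _ _; set u := if _ then F else 1; set w := if _ then F else 1.
have w0 : w != 0 by rewrite /w; case: ifP; rewrite ?oner_neq0 ?cf_neq0.
move=> eT eF; apply: (mulIf w0).
transitivity (Coef true i j c * w * Coef false k l (upd c j (box false i))); first by ring.
transitivity (Coef true i j (upd c l (box true k)) * (Coef false k l c * w)); last by ring.
by rewrite -eT -eF; ring.
Qed.

Lemma box_TF i : (box true i == box false i) = false.
Proof. by rewrite box_neq; apply/eqP; lia. Qed.

Lemma xop1_same i k j x :
  xop1 true i j (xop1 false k j x) - xop1 false k j (xop1 true i j x) =
  (i == k)%:R *: diag_op (fun c => (eps i (c j))%:~R * (Coef true i j c * Coef false i j c)) x.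
Proof.
apply/ffunP => c; rewrite !ffunE /= !eqxx !box_eq !Coef_upd_same !upd_upd.
rewrite [k == i]eq_sym; have [<-|ik] := eqVneq i k; last first.
  by rewrite /GRing.scale /= mul0r; case: ifP; case: ifP; rewrite ?mulr0 ?subr0.
rewrite scale1r /eps.
have [cT|cT] := eqVneq (c j) (box true i).
  by rewrite cT box_TF upd_id // subr0 mul1r mulrA.
have [cF|cF] := eqVneq (c j) (box false i); last by rewrite !subr0 !mul0r.
by rewrite upd_id //= !sub0r mulN1r mulNr mulrCA mulrA.
Qed.

Lemma xop_comm i k r s x :
  xop true i r (xop false k s x) - xop false k s (xop true i r x) =
  (i == k)%:R *: diag_op (fun c => \sum_j (eps i (c j))%:~R *
     (Coef true i j c * Coef false i j c) * beta i j ^ (r + s)) x.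
Proof.
have XX d e i' k' r' s' y : xop d i' r' (xop e k' s' y) =
    \sum_j \sum_l (beta i' j ^ r' * beta k' l ^ s') *: xop1 d i' j (xop1 e k' l y).
  apply: eq_bigr => j _; rewrite /xop (big_morph (xop1 d i' j) (id1 := 0) (op1 := +%R)).
  - rewrite scaler_sumr; apply: eq_bigr => l _.
    have := xop1_linear d i' j (beta k' l ^ s') (xop1 e k' l y) 0.
    rewrite addr0 => ->; rewrite scalerDr scalerA.
    have -> : xop1 d i' j 0 = 0; last by rewrite scaler0 addr0.
    by apply/ffunP => c; rewrite !ffunE mulr0 if_same.
  - by move=> u w; have := xop1_linear d i' j 1 u w; rewrite !scale1r.
  - by apply/ffunP => c; rewrite !ffunE mulr0 if_same.
rewrite !XX [X in _ - X]exchange_big -sumrB /=.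
transitivity (\sum_j (beta i j ^ r * beta k j ^ s) *:
    (xop1 true i j (xop1 false k j x) - xop1 false k j (xop1 true i j x))).
  apply: eq_bigr => j _; rewrite -sumrB (bigD1 j) //= big1 ?addr0 => [|l lj].
    by rewrite [beta k j ^ s * _]mulrC -scalerBr.
  by rewrite xop1_comm 1?eq_sym // [beta k l ^ s * _]mulrC subrr.
under eq_bigr do rewrite xop1_same.
case: eqP => [<-|_]; last by rewrite scale0r big1 // => j _; rewrite scale0r scaler0.
apply/ffunP => c; rewrite sum_ffunE scale1r !ffunE mulr_suml; apply: eq_bigr => j _.
rewrite scale1r !ffunE /GRing.scale /= expfzDr ?mulf_neq0 ?expf_neq0 //.
by ring.
Qed.

(** The eigenvalues of [psi^+] and [psi^-] are the coefficients of the expansions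
   of one rational function at [0] and at infinity, so their difference is a sum
   over its poles, one for each box in state [i] or [i + 1]. *)
Lemma psi_partial_fractions i t c :
  psival true i t c - psival false i t c =
  (q - q^-1) * \sum_j (eps i (c j))%:~R *
     (Coef true i j c * Coef false i j c) * beta i j ^ t.
Proof.
pose p j := q ^ eps i (c j); pose y j := beta i j.
have p0 j : p j != 0 by rewrite expfz_neq0.
have y0 j : y j != 0 by rewrite mulf_neq0 ?expf_neq0.
have yI : injective y by move=> j l /(mulIf (expf_neq0 i q0))/bI.
have resE j : residue p y j =
    (q - q^-1) * ((eps i (c j))%:~R * (Coef true i j c * Coef false i j c)).
  rewrite /residue mulrA; congr (_ * _).
    rewrite /p /eps; case: eqP => [->|_]; first by rewrite box_TF /= !subr0 mulr1z mulr1 expr1z.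
    case: eqP => _ /=; last by rewrite subr0 expr0z invr1 subrr mulr0.
    by rewrite sub0r mulrN1z mulrN1 opprB exprN1 invrK.
  rewrite /Coef -big_split; apply: eq_bigr => l lj /=.
  have bjl : b j - b l != 0 by rewrite subr_eq0 (inj_eq bI) eq_sym.
  have blj : b l - b j != 0 by rewrite subr_eq0 (inj_eq bI).
  have qi : q ^+ i != 0 by rewrite expf_neq0.
  have yjl : y j - y l = (b j - b l) * q ^+ i by rewrite -mulrBl.
  rewrite yjl /p /eps /y /beta /cf; case: eqP => [->|_].
    by rewrite box_TF /= subr0 expr1z; field; rewrite q0 bjl qi.
  case: eqP => _ /=.
    by rewrite sub0r exprN1; field; rewrite ?q0 ?bjl ?blj ?qi ?oner_neq0.
  by rewrite (_ : 0%:Z - 0%:Z = 0) // expr0z; field; rewrite ?bjl ?qi ?oner_neq0.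
have wtE : q ^ wt i c = \prod_j p j by rewrite /wt q_sum.
have wtN : q ^ (- wt i c) = \prod_j (p j)^-1.
  by rewrite -invr_expz wtE -prodfV.
have sc (s : nat) (m : int) u :
    (q - q^-1) * ((1 - q ^ m) / (s%:~R * (q - q^-1)) * u) = (1 - q ^ m) * u / s%:R :> K.
  rewrite -pmulrn; case: s => [|s]; first by rewrite mul0r invr0 !(mulr0, mul0r).
  move: (q - q^-1) qq0 (char0 s) => Q Q0; move: (s.+1%:R : K) => S S0;
  by move: (1 - q ^ m) => w; field; rewrite ?S0 ?Q0.
have fT (s : nat) : ((sgk K true * (q - q^-1)) * Hval i (sgi true s) c : K) =
    \sum_j (1 - (p j)^-1 ^+ (2 * s)) * y j ^+ s / s%:R.
  rewrite /Hval mul1r mulr_sumr; apply: eq_bigr => j _; rewrite sc.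
  congr ((1 - _) * _ / _); rewrite /p invr_expz exprnP exprz_exp PoszM.
  by congr (_ ^ _); ring.
(* The expansion at infinity is the one at [0] with all [p_j] and [y_j]
   inverted, which changes the sign of the residues. *)
have fF (s : nat) : ((sgk K false * (q - q^-1)) * Hval i (sgi false s) c : K) =
    \sum_j (1 - ((p j)^-1)^-1 ^+ (2 * s)) * (y j)^-1 ^+ s / s%:R.
  rewrite /Hval mulN1r mulNr mulr_sumr -sumrN; apply: eq_bigr => j _ /=.
  rewrite invrK /hval mulrNz mulNr invrN mulrN mulNr mulrN opprK sc.
  congr ((1 - _) * _ / _); first by rewrite /p exprnP exprz_exp PoszM; congr (_ ^ _); ring.
  by rewrite exprVn exprnN.
have resV j : residue (fun l => (p l)^-1) (fun l => (y l)^-1) j = - residue p y j.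
  rewrite /residue invrK -mulNr opprB; congr (_ * _); apply: eq_bigr => l lj.
  have yjl : y j - y l != 0 by rewrite subr_eq0 (inj_eq yI) eq_sym.
  have ylj : y l - y j != 0 by rewrite subr_eq0 (inj_eq yI).
  by field; rewrite ?mulN1r ?y0 ?p0 ?yjl ?ylj ?oner_neq0.
have pos (a : nat) := exp_coef_partial_fractions char0 p0 y0 yI a fT.
have neg (a : nat) := exp_coef_partial_fractions char0 (fun j => invr_neq0 (p0 j))
    (fun j => invr_neq0 (y0 j)) (inj_comp invr_inj yI) a fF.
transitivity (\sum_j residue p y j * beta i j ^ t); last first.
  by rewrite mulr_sumr; apply: eq_bigr => j _; rewrite resE !mulrA.
have expc0 (f : nat -> K^o) : exp_coef f 0 = 1.
  by rewrite /exp_coef big_ord_recl big_ord0 addr0 /= invr1 scale1r.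
rewrite /psival /Kval /sgi wtE wtN; case: t => [[|t]|t].
- rewrite oppr0 lexx pos expc0 mulr1 eqxx mul1r addrAC subrr add0r.
  by apply: eq_bigr => j _; rewrite expr0 expr0z.
- by rewrite /= subr0 pos /= mul0r add0r.
- rewrite NegzE opprK /= neg /= mul0r !add0r -sumrN.
  apply: eq_bigr => j _; rewrite resV mulNr opprK; congr (_ * _).
  by rewrite exprVn exprnN.
Qed.

Lemma xop_commutator i k r s x :
  xop true i r (xop false k s x) - xop false k s (xop true i r x) =
  if i == k then
    (q - q^-1)^-1 *: (diag_op (psival true i (r + s)) x - diag_op (psival false i (r + s)) x)
  else 0.
Proof.
rewrite xop_comm; case: eqP => _; last by rewrite scale0r.
apply/ffunP => c; rewrite scale1r !ffunE -mulrBl psi_partial_fractions /GRing.scale /=.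
by rewrite !mulrA mulVf // mul1r.
Qed.

Definition delta_fun c : model := [ffun c' => (c' == c)%:R].
Definition top_config : fconfig := [ffun=> ord0].

Lemma delta_fun_sum x : x = \sum_c (x c : K) *: delta_fun c.
Proof.
apply/ffunP => c; rewrite sum_ffunE (bigD1 c) //= big1 ?addr0 => [|c' c'c].
  by rewrite !ffunE eqxx /GRing.scale /= mulr1.
by rewrite !ffunE eq_sym (negbTE c'c) scaler0.
Qed.

Lemma xop_top i r : xop true i r (delta_fun top_config) = 0.
Proof.
apply/ffunP => c; rewrite xopE big1 ?ffunE // => j _; case: ifP => // _.
rewrite !ffunE; case: eqP => [/ffunP/(_ j)|]; last by rewrite !mulr0.
by rewrite !ffunE eqxx => /(congr1 val).
Qed.

Lemma xop1_delta i j c : c j = box true i ->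
  xop1 false i j (delta_fun c) = Coef false i j c *: delta_fun (upd c j (box false i)).
Proof.
move=> cj; apply/ffunP => c'; rewrite !ffunE /GRing.scale /=.
have [->|ne] := eqVneq c' (upd c j (box false i)).
  by rewrite updE !eqxx Coef_upd_same upd_upd upd_id // eqxx.
case: eqP => c'j; last by rewrite mulr0.
rewrite mulr0; case: eqP => [e|]; last by rewrite mulr0.
by case/eqP: ne; rewrite -e upd_upd upd_id.
Qed.

Definition height c := (\sum_j c j)%N.

Lemma height_upd i j c : c j = box false i -> height c = (height (upd c j (box true i))).+1.
Proof.
move=> cj; rewrite /height (bigD1 j) //= [in RHS](bigD1 j) //= updE eqxx cj.
rewrite [in RHS](eq_bigr (fun l => c l : nat)); first by rewrite /box /= /bump /= add1n addSn.
by move=> l /negbTE lj; rewrite updE lj.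
Qed.

Lemma height_gt0 c : (0 < height c)%N -> exists i j, c j = box false i.
Proof.
rewrite lt0n sum_nat_eq0 negb_forall => /existsP[j /= cj].
have ci : ((c j).-1 < n)%N by have := ltn_ord (c j); lia.
exists (Ordinal ci), j; apply: val_inj; rewrite /= /bump /=; lia.
Qed.

Lemma height0 c : height c = 0%N -> c = top_config.
Proof.
move/eqP; rewrite sum_nat_eq0 => /forallP h; apply/ffunP => j; rewrite ffunE.
by apply: val_inj; apply/eqP; exact: h.
Qed.

Section Irreducible.
Variable P : model -> Prop.
Hypotheses (PD : forall x y, P x -> P y -> P (x + y)).
Hypotheses (PZ : forall (a : K) x, P x -> P (a *: x)).
Hypotheses (PX : forall d i r x, P x -> P (xop d i r x)).

(** The parameters are distinct, so interpolation over the loop index [r]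
   isolates the move of one box. *)
Lemma xop1_stable d i j x : P x -> P (xop1 d i j x).
Proof.
move=> Px; have P0 : P 0 by rewrite -(scale0r x); exact: PZ.
(* [L] takes the value [1] at the parameter of the box [j] and [0] at those of
   the other boxes. *)
pose L : {poly K} := \prod_(l | l != j) ((beta i j - beta i l)^-1 *: ('X - (beta i l)%:P)).
have LE l : L.[beta i l] = (l == j)%:R.
  rewrite /L horner_prod; have [->|lj] := eqVneq l j.
    rewrite big1 // => m mj; rewrite hornerZ !hornerE mulVf // subr_eq0.
    by apply: contra mj => /eqP/(mulIf (expf_neq0 i q0))/bI ->.
  by rewrite (bigD1 l) //= hornerZ !hornerE subrr mulr0 mul0r.
have -> : xop1 d i j x = \sum_(a < size L) L`_a *: xop d i a x.
  rewrite /xop; under [RHS]eq_bigr do rewrite scaler_sumr.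
  rewrite exchange_big /= (bigD1 j) //= [X in _ + X]big1 ?addr0 => [|l lj].
    under eq_bigr do rewrite scalerA -exprnP.
    by rewrite -scaler_suml -horner_coef LE eqxx scale1r.
  under eq_bigr do rewrite scalerA -exprnP.
  by rewrite -scaler_suml -horner_coef LE (negbTE lj) scale0r.
by apply: (big_ind P) => // a _; apply/PZ/PX.
Qed.

(** Moving a box down in a configuration of maximal height of the support gives
   a nonzero function whose maximal height is smaller. *)
Lemma model_top x : P x -> x != 0 -> P (delta_fun top_config).
Proof.
move=> Px x0; have [c xc] : exists c, x c != 0.
  apply/existsP; apply: contraNT x0 => /existsPn h; apply/eqP/ffunP => c.
  by rewrite ffunE; have /negPn/eqP := h c.
have [m cm] : {c | x c != 0 & forall c', x c' != 0 -> (height c' <= height c)%N}.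
  by case: (@arg_maxnP _ c (fun c => x c != 0) height xc) => m mx mm; exists m.
move: {c xc x0} cm; have [N] := ubnP (height m).
elim: N x m Px => // N IHN x m Px mN xm mmax.
have [h0|hm] := posnP (height m).
  have -> : delta_fun top_config = (x top_config : K)^-1 *: x; last exact: PZ.
  have xc0 : x top_config != 0 by rewrite -(height0 h0).
  apply/ffunP => c; rewrite !ffunE; have [->|cc0] := eqVneq c top_config.
    by rewrite /GRing.scale /= mulVf.
  apply/esym/eqP; rewrite /GRing.scale /= mulf_eq0; apply/orP; right.
  apply: contraR cc0 => /mmax; rewrite h0 leqn0 => /eqP/height0 ->.
  by [].
have [i [j mj]] := height_gt0 hm.
have hmE := height_upd mj.
apply: (IHN (xop1 true i j x) (upd m j (box true i))); first exact: xop1_stable.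
- by rewrite -ltnS -hmE.
- rewrite ffunE updE !eqxx /= upd_upd (upd_id mj); exact: (mulf_neq0 (R := K) (Coef_neq0 _ _ _ _) xm).
- move=> c'; rewrite ffunE; case: (c' j =P box true i) => [c'j|_] /=; last by rewrite eqxx.
  rewrite mulf_eq0 => /norP[_ /mmax]; rewrite hmE.
  have h' := @height_upd i j (upd c' j (box false i)).
  rewrite h'; last by rewrite updE eqxx.
  by rewrite upd_upd upd_id.
Qed.

Lemma model_gen : P (delta_fun top_config) -> forall x, P x.
Proof.
move=> P0; have Pd c : P (delta_fun c).
  have [N] := ubnP (height c); elim: N c => // N IHN c cN.
  have [h0|hc] := posnP (height c); first by rewrite (height0 h0).
  have [i [j cj]] := height_gt0 hc.
  have hE := height_upd cj.
  set c' := upd c j (box true i) in hE.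
  have c'j : c' j = box true i by rewrite updE eqxx.
  have : P (xop1 false i j (delta_fun c')) by apply/xop1_stable/IHN; rewrite -ltnS -hE.
  rewrite xop1_delta // upd_upd upd_id // => /(PZ (Coef false i j c')^-1).
  by rewrite scalerA mulVf ?Coef_neq0 // scale1r.
move=> x; rewrite [x]delta_fun_sum; apply: (big_ind P) => //; last by move=> c _; exact: PZ.
by rewrite -(scale0r (delta_fun top_config)); exact: PZ.
Qed.

End Irreducible.
End Model.

Arguments diag_op : simpl never.
Arguments xop : simpl never.

(** * Relations of the quantum affine algebra *)

Section Morphisms.
Variables (K : fieldType) (q : K) (n : nat) (A B : algType K) (f : {lrmorphism A -> B}).

Lemma rmorph_exp_coef (u : nat -> A) r : f (exp_coef u r) = exp_coef (f \o u) r.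
Proof.
have powE k s : f (ps_pow u k s) = ps_pow (f \o u) k s.
  elim: k s => [|k IHk] s /=; first by rewrite rmorph_nat.
  by rewrite rmorph_sum; apply: eq_bigr => i _; rewrite rmorphM /= IHk.
by rewrite /exp_coef rmorph_sum; apply: eq_bigr => k _; rewrite /= linearZ /= powE.
Qed.

Lemma rmorph_htot h i r : f (@htot K n A h i r) = @htot K n B (fun i r => f (h i r)) i r.
Proof. by rewrite /htot; case: insub => [?|]; rewrite ?rmorph0. Qed.

Lemma rmorph_psi (g : gen n -> A) e i r : f (psi q g e i r) = psi q (f \o g) e i r.
Proof.
rewrite /psi; case: ifP => _; last by rewrite rmorph0.
rewrite rmorphM /= rmorph_exp_coef; congr (_ * exp_coef _ _).
by apply/funext => s; rewrite /= linearZ /= rmorph_htot.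
Qed.

End Morphisms.

Section QuotientMap.
Variables (K : fieldType) (q : K) (n : nat).

Local Open Scope quotient_scope.

Definition upi (a : freealg K n) : Uqe q n := \pi_(Uqe q n) a.

Fact upi_zmod : zmod_morphism upi.
Proof. by move=> a b; rewrite /upi raddfB. Qed.
Fact upi_monoid : monoid_morphism upi.
Proof. by split=> [|a b]; [exact: quotalg_pi1 | exact: quotalg_piM]. Qed.
Fact upi_scal : scalable upi.
Proof. by move=> c a; exact: quotalg_piZ. Qed.

HB.instance Definition _ := GRing.isZmodMorphism.Build (freealg K n) (Uqe q n) upi upi_zmod.
HB.instance Definition _ := GRing.isMonoidMorphism.Build (freealg K n) (Uqe q n) upi upi_monoid.
HB.instance Definition _ := GRing.isScalable.Build K (freealg K n) (Uqe q n) *:%R upi upi_scal.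

Lemma upi_rel a b : uqe_rel q (@fgen K n) a b -> upi a = upi b.
Proof. by move=> ab; apply/quotalg_eqP/uqe_idealP/ideal_rel. Qed.

Lemma upi_gen (y : gen n) : upi (fgen K y) = ugen q y. Proof. by []. Qed.
Lemma upi1 : upi 1 = 1. Proof. exact: rmorph1. Qed.
Lemma upi0 : upi 0 = 0. Proof. exact: rmorph0. Qed.
Lemma upiB a b : upi (a - b) = upi a - upi b. Proof. exact: rmorphB. Qed.
Lemma upiM a b : upi (a * b) = upi a * upi b. Proof. exact: rmorphM. Qed.
Lemma upiZ c a : upi (c *: a) = c *: upi a. Proof. exact: linearZ. Qed.
Lemma upi_htot i r : upi (htot (fun i a => fgen K (gh i a)) i r) =
  htot (fun i a => ugen q (gh i a)) i r.
Proof. exact: rmorph_htot. Qed.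
Lemma upi_psi e i r : upi (psi q (@fgen K n) e i r) = psi q (@ugen K q n) e i r.
Proof. exact: rmorph_psi. Qed.

Lemma upi_commutator a b c : upi (a * b - b * a) = upi c ->
  upi a * upi b - upi b * upi a = upi c.
Proof.
by move=> <-; apply/esym/(etrans (upiB _ _)); congr (_ - _); exact: upiM.
Qed.
Lemma upi_prod2 a b c : upi (a * b) = upi c -> upi a * upi b = upi c.
Proof. by move=> <-; rewrite (upiM a b). Qed.
Lemma upi_prod3 a b c d : upi (a * b * c) = upi d -> upi a * upi b * upi c = upi d.
Proof. by move=> <-; rewrite (upiM (a * b) c) (upiM a b). Qed.

End QuotientMap.

Section UqVal.
Variables (K : fieldType) (q : K) (n : nat).

Fact uq_val_zmod : zmod_morphism (@uq_val K q n).
Proof. by move=> a b; rewrite -[LHS]/(\val _) raddfB. Qed.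
Fact uq_val_monoid : monoid_morphism (@uq_val K q n).
Proof. by split. Qed.
Fact uq_val_scal : scalable (@uq_val K q n).
Proof. by move=> c a; rewrite -[LHS]/(\val _) linearZ. Qed.

HB.instance Definition _ :=
  GRing.isZmodMorphism.Build (Uq q n) (Uqe q n) (@uq_val K q n) uq_val_zmod.
HB.instance Definition _ :=
  GRing.isMonoidMorphism.Build (Uq q n) (Uqe q n) (@uq_val K q n) uq_val_monoid.
HB.instance Definition _ :=
  GRing.isScalable.Build K (Uq q n) (Uqe q n) *:%R (@uq_val K q n) uq_val_scal.

End UqVal.

Section UqRelations.
Variables (K : fieldType) (q : K) (n : nat).
Hypothesis q0 : q != 0.
Local Notation U := (Uq q n).
Local Notation x := (uq_x q).
Local Notation Kk := (uq_K q).
Local Notation h := (uq_h q).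
Implicit Types (i j k : 'I_n) (r s : int) (e : bool).

Lemma uq_hE i r : uq_val (h i r) = htot (fun i a => ugen q (gh i a)) i r.
Proof. by rewrite rmorph_htot. Qed.

Definition uq_psi e i r : U :=
  if 0 <= sgi e r then
    Kk e i * exp_coef (fun s : nat => (sgk K e * (q - q^-1)) *: h i (sgi e s)) `|r|%N
  else 0.

Lemma uq_psiE e i r : uq_val (uq_psi e i r) = psi q (@ugen K q n) e i r.
Proof.
rewrite /uq_psi /psi; case: ifP => // _.
rewrite rmorphM /= rmorph_exp_coef.
congr (_ * exp_coef _ _); apply/funext => s /=.
by rewrite uq_hE.
Qed.

Lemma htot_val (A : algType K) (g : 'I_n -> nzint -> A) i a : htot g i (val a) = g i a.
Proof. by rewrite /htot valK. Qed.

(* From here on these constants only occur as atoms. *)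
Opaque fgen htot psi.

Lemma Uqe_KVK i : ugen q (gK true i) * ugen q (gK false i) = 1.
Proof. by rewrite -upi1 -(upi_rel (rel_KKinv q (@fgen K n) i)) upiM. Qed.

Lemma Uqe_VKK i : ugen q (gK false i) * ugen q (gK true i) = 1.
Proof. by rewrite -upi1 -(upi_rel (rel_KinvK q (@fgen K n) i)) upiM. Qed.

Lemma uq_KKV i : Kk true i * Kk false i = 1.
Proof. by apply: val_inj; exact: Uqe_KVK. Qed.

Lemma uq_KVK i : Kk false i * Kk true i = 1.
Proof. by apply: val_inj; exact: Uqe_VKK. Qed.

Lemma uq_Kx' i e j r :
  Kk true i * x e j r * Kk false i = q ^ sgi e (cartan i j) *: x e j r.
Proof.
apply: val_inj; rewrite /= ?linearZ ?rmorphM /=.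
by have := upi_prod3 (upi_rel (rel_Kx q (@fgen K n) e i j r)); rewrite upiZ.
Qed.

Lemma uq_Kx d i e j r :
  Kk d i * x e j r = q ^ sgi d (sgi e (cartan i j)) *: (x e j r * Kk d i).
Proof.
have K1 : Kk true i * x e j r = q ^ sgi e (cartan i j) *: (x e j r * Kk true i).
  by rewrite -(mulr1 (_ * _)) -(uq_KVK i) mulrA uq_Kx' scalerAl.
case: d => //=; rewrite -{1}(mulr1 (x e j r)) -(uq_KKV i) 2!mulrA.
have -> : Kk false i * x e j r * Kk true i = q ^ (- sgi e (cartan i j)) *: x e j r.
  rewrite -mulrA (_ : x e j r * _ = q ^ (- sgi e (cartan i j)) *: (Kk true i * x e j r)).
    by rewrite -scalerAr mulrA uq_KVK mul1r.
  by rewrite K1 scalerA -expfzDr // addNr expr0z scale1r.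
by rewrite scalerAl.
Qed.

Lemma uq_hx i r e j s : r != 0 ->
  h i r * x e j s = x e j s * h i r
    + (sgk K e * (r%:~R^-1 * qint q (r * cartan i j))) *: x e j (r + s).
Proof.
move=> r0; apply/eqP; rewrite addrC -subr_eq; apply/eqP/val_inj.
rewrite /= ?linearZ ?rmorphB ?rmorphM /= uq_hE.
have := upi_commutator (upi_rel (rel_hx q (@fgen K n) e i j s r0)).
by rewrite upiZ upi_htot.
Qed.

Lemma uq_xx i j r s :
  x true i r * x false j s = x false j s * x true i r +
    if i == j then (q - q^-1)^-1 *: (uq_psi true i (r + s) - uq_psi false i (r + s)) else 0.
Proof.
apply/eqP; rewrite addrC -subr_eq; apply/eqP/val_inj.
rewrite /= ?rmorphB ?rmorphM /=.
rewrite (upi_commutator (upi_rel (rel_xpxm q (@fgen K n) i j r s))).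
case: eqP => _; last by rewrite upi0.
by rewrite /= upiZ upiB !upi_psi !uq_psiE.
Qed.

Lemma uq_stable (V : lmodType K) (rho : rep U V) (N : V -> Prop) :
  (forall v w, N v -> N w -> N (v + w)) -> (forall c v, N v -> N (c *: v)) ->
  (forall e i r v, N v -> N (rho (x e i r) v)) ->
  (forall i r v, N v -> N (rho (h i r) v)) ->
  (forall e i v, N v -> N (rho (Kk e i) v)) ->
  forall a v, N v -> N (rho a v).
Proof.
move=> ND NZ Nx Nh NK a v Nv; have /asboolP := uq_valP a.
move: {-1}(uq_val a) (erefl (uq_val a)) => u ea ua; elim: ua a ea v Nv => {u}.
- move=> u [y yD ->] a ea v Nv; case: y yD ea => // [e i r|i r|e i] _ ea.
  + have -> : a = x e i r by exact: val_inj.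
    exact: Nx.
  + have -> : a = h i (val r); last exact: Nh.
    by apply: val_inj; rewrite /= uq_hE ea htot_val.
  + have -> : a = Kk e i by exact: val_inj.
    exact: NK.
- by move=> a ea v Nv; rewrite (_ : a = 1) ?act1 //; apply: val_inj.
- move=> u w uS IHu wS IHw a ea v Nv.
  have Uu : u \in @uq_pred K q n by exact/asboolP.
  have Uw : w \in @uq_pred K q n by exact/asboolP.
  rewrite (_ : a = MkUq Uu + MkUq Uw); last exact: val_inj.
  by rewrite actDl; apply: ND; [exact: IHu | exact: IHw].
- move=> c u uS IHu a ea v Nv.
  have Uu : u \in @uq_pred K q n by exact/asboolP.
  rewrite (_ : a = c *: MkUq Uu); last exact: val_inj.
  by rewrite actZl; apply: NZ; exact: IHu.
- move=> u w uS IHu wS IHw a ea v Nv.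
  have Uu : u \in @uq_pred K q n by exact/asboolP.
  have Uw : w \in @uq_pred K q n by exact/asboolP.
  rewrite (_ : a = MkUq Uu * MkUq Uw); last exact: val_inj.
  by rewrite actM; apply: (IHu (MkUq Uu)) => //; exact: (IHw (MkUq Uw)).
Qed.

End UqRelations.

(** * Highest weight vectors and Drinfeld polynomials *)

Section RepLinear.
Variables (K : fieldType) (A : algType K) (V : lmodType K) (rho : rep A V).

Lemma rep0r a : rho a 0 = 0.
Proof. by have := actZr rho 0 a 0; rewrite !scale0r. Qed.

Lemma rep0l v : rho 0 v = 0.
Proof. by have := actZl rho 0 0 v; rewrite !scale0r. Qed.

Lemma repBl a b v : rho (a - b) v = rho a v - rho b v.
Proof. by rewrite actDl; congr (_ + _); have := actZl rho (-1) b v; rewrite !scaleN1r. Qed.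

Lemma rep_suml (I : Type) (s : seq I) (P : pred I) (F : I -> A) v :
  rho (\sum_(i <- s | P i) F i) v = \sum_(i <- s | P i) rho (F i) v.
Proof. by apply: (big_morph (fun a => rho a v)) => [a b|]; [exact: actDl | exact: rep0l]. Qed.

Lemma rep_sumr a (I : Type) (s : seq I) (P : pred I) (F : I -> V) :
  rho a (\sum_(i <- s | P i) F i) = \sum_(i <- s | P i) rho a (F i).
Proof. by apply: (big_morph (rho a)) => [v w|]; [exact: actDr | exact: rep0r]. Qed.

Section Eigen.
Variables (f : nat -> A) (g : nat -> K^o) (v : V).
Hypotheses (f0 : f 0%N = 0) (g0 : g 0%N = 0).

Lemma ps_pow1 (B : algType K) (u : nat -> B) r : ps_pow u 1 r = u r.
Proof.
rewrite /= (bigD1 ord_max) //= subnn eqxx mulr1 big1 ?addr0 // => -[i ir] /=.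
by rewrite -val_eqE /= => ne; rewrite (_ : (r - i == 0)%N = false) ?mulr0 //; lia.
Qed.

Lemma rep_ps_pow r k : (forall s, (s < r)%N -> rho (f s) v = (g s : K) *: v) ->
  (k != 1)%N || (rho (f r) v == (g r : K) *: v) ->
  forall s, (s <= r)%N -> rho (ps_pow f k s) v = (ps_pow g k s : K) *: v.
Proof.
move=> H; elim: k => [|k IHk] k1 s sr.
  by rewrite /=; case: eqP => _; rewrite ?act1 ?scale1r // rep0l scale0r.
have [k0|k0] := eqVneq k 0%N.
  move: k1; rewrite k0 !ps_pow1 orFb => /eqP k1.
  by move: sr; rewrite leq_eqVlt => /predU1P[->//|]; exact: H.
rewrite /= rep_suml scaler_suml; apply: eq_bigr => -[i /= iS] _; rewrite actM.
case: i iS => [|i] iS; first by rewrite f0 g0 !rep0l mul0r scale0r.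
have [si|si] := eqVneq i.+1 s.
  rewrite -si subnn; case: (k) k0 => // k' _ /=.
  by rewrite !big_ord_recl !big_ord0 f0 g0 !mul0r !addr0 mulr0 scale0r rep0l rep0r.
have lt : (i.+1 < r)%N by lia.
have [k1'|k1'] := eqVneq k 1%N; last first.
  by rewrite IHk ?k1' //; [rewrite actZr H // scalerA mulrC | lia].
rewrite k1' !ps_pow1 H; last by lia.
by rewrite actZr H // scalerA mulrC.
Qed.

(** The coefficient of degree [r] of [exp f] is [f r] plus a polynomial in the
   lower coefficients of [f], which already act as scalars on [v]. *)
Lemma rep_exp_coef_triangular r : (0 < r)%N ->
  (forall s, (s < r)%N -> rho (f s) v = (g s : K) *: v) ->
  rho (exp_coef f r) v = (exp_coef g r : K) *: v -> rho (f r) v = (g r : K) *: v.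
Proof.
case: r => // r _ H; rewrite /exp_coef rep_suml scaler_suml.
rewrite !big_ord_recl !actZl (@rep_ps_pow r.+1 0) //.
have scK (c : K) (a : K^o) : (c *: a : K) *: v = c *: ((a : K) *: v) by rewrite scalerA.
rewrite !scK => /addrI.
rewrite [X in _ + X = _](eq_bigr (fun k : 'I_r =>
    ((bump 0 (bump 0 k))`!%:R^-1 *: ps_pow g (bump 0 (bump 0 k)) r.+1 : K) *: v)).
  by move/addIr; rewrite !ps_pow1 !invr1 !scale1r.
by move=> k _; rewrite actZl (@rep_ps_pow r.+1) // scK.
Qed.

End Eigen.
End RepLinear.

Section DrinfeldPolynomial.
Variables (K : fieldType).
Implicit Types (p : {poly K}) (s : seq K).

Let lin (b : K) : {poly K} := 1 - b *: 'X.

Lemma size_lin b : b != 0 -> size (lin b) = 2%N.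
Proof.
move=> b0; rewrite /lin addrC size_polyDl ?size_polyN size_scale ?size_polyX //.
by rewrite size_poly1.
Qed.

Lemma size_prod_lin s : all (fun b => b != 0) s ->
  size (\prod_(b <- s) lin b) = (size s).+1.
Proof.
elim: s => [|b s IHs] /=; first by rewrite big_nil size_poly1.
case/andP=> b0 /IHs{}IHs; rewrite big_cons size_mul ?size_lin ?IHs //.
  by rewrite -size_poly_eq0 size_lin.
by rewrite -size_poly_eq0 IHs.
Qed.

(** [rev d p] is [u^d p(1/u)]. *)
Let rev d p : {poly K} := \poly_(k < d.+1) p`_(d - k).

Lemma rev_lin d b p : (size p <= d.+1)%N ->
  rev d.+1 (lin b * p) = ('X - b%:P) * rev d p.
Proof.
move=> sp; apply/polyP => k.
rewrite /lin mulrBl mul1r -scalerAl mulrBl mul_polyC coef_poly !coefB !coefZ !coefXM.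
rewrite !coef_poly; case: k => [|k].
  by rewrite /= !subn0 /= (leq_sizeP _ _ sp).
rewrite !ltnS subSS /=; case: (ltngtP k d) => kd.
- by rewrite subn_eq0 leqNgt kd /= subnS.
- by rewrite !mulr0 subrr.
- by rewrite kd subnn eqxx mulr0.
Qed.

(** Reversing the coefficients inverts the roots, and the normalisation restores
   the constant term [1]. *)
Lemma pisgn_prod_lin e s : all (fun b => b != 0) s ->
  pisgn e (\prod_(b <- s) lin b) = \prod_(b <- s) lin (if e then b else b^-1).
Proof.
case: e => //= s0; rewrite size_prod_lin //=.
have revE : rev (size s) (\prod_(b <- s) lin b) = \prod_(b <- s) ('X - b%:P).
  elim: s s0 => [|b s IHs] /=.
    rewrite !big_nil => _; apply/polyP => k; rewrite coef_poly coef1.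
    by case: k => [|k] /=; rewrite ?coef1.
  by case/andP=> b0 s0; rewrite !big_cons rev_lin ?IHs // size_prod_lin.
rewrite -[X in (X.[0])^-1 *: _]/(rev _ _) -[X in _ *: X]/(rev _ _) revE horner_prod.
elim: s s0 {revE} => [|b s IHs] /=; first by rewrite !big_nil invr1 scale1r.
case/andP=> b0 /IHs{}IHs; rewrite !big_cons -IHs -[lin b^-1 * _]scalerAr.
rewrite invfM mulrC -scalerA scalerAl; congr (_ *: (_ * _)).
rewrite !hornerE /lin invrN scaleNr scalerBr opprB; congr (_ - _).
by rewrite -mul_polyC -rmorphM mulVf.
Qed.

End DrinfeldPolynomial.

Section HighestWeight.
Variables (K : fieldType) (q : K) (n M : nat) (b : 'I_M -> K).
Hypothesis char0 : forall r, r.+1%:R != 0 :> K.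
Hypotheses (q0 : q != 0) (qroot : forall k, q ^+ k.+1 != 1).
Hypotheses (b0 : forall j, b j != 0).

Lemma q_subV_neq0 : q - q^-1 != 0.
Proof.
rewrite subr_eq0; apply: contraNneq (qroot 1) => e.
by rewrite expr2 {2}e mulfV.
Qed.
Let qq0 := q_subV_neq0.

Lemma q_expz_neq1 (z : int) : z != 0 -> q ^ z != 1.
Proof.
case: z => [[|k]|k] //= _; first exact: qroot.
by rewrite NegzE -exprnN invr_eq1 qroot.
Qed.

Lemma qint_neq0 (z : int) : z != 0 -> qint q z != 0.
Proof.
move=> z0; rewrite /qint mulf_neq0 ?invr_eq0 //.
have -> : q ^ z - q ^ (- z) = q ^ (- z) * (q ^ (2 * z) - 1).
  by rewrite mulrBr -expfzDr // mulr1; congr (q ^ _ - _); lia.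
by rewrite mulf_neq0 ?expfz_neq0 // subr_eq0 q_expz_neq1 // mulf_neq0.
Qed.

Definition drinfeld (i : 'I_n) : {poly K} :=
  if i == 0%N :> nat then \prod_j (1 - b j *: 'X) else 1.

Local Notation top_config := (top_config n M).

Lemma eps_top (i : 'I_n) j : eps i (top_config j) = (i == 0%N :> nat)%:Z.
Proof. by rewrite ffunE /eps -!val_eqE /= subr0 eq_sym. Qed.

Lemma Hval0 (i : 'I_n) c : Hval q b i 0 c = 0.
Proof. by rewrite /Hval big1 // => j _; rewrite /hval mulr0 mul0r oppr0 expr0z subrr !mul0r. Qed.

Let zroot e (i : 'I_n) j := if i == 0%N :> nat then (if e then b j else (b j)^-1) else 0.

Lemma prod_zroot e i : \prod_j (1 - zroot e i j *: 'X) = pisgn e (drinfeld i).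
Proof.
rewrite /zroot /drinfeld; case: ifP => _.
  rewrite -(big_map b xpredT (fun z => 1 - z *: 'X)) pisgn_prod_lin.
    by rewrite big_map; apply: eq_bigr => j _.
  by apply/allP => _ /mapP[j _ ->].
have := @pisgn_prod_lin K e [::] isT.
rewrite !big_nil => ->; by rewrite big1 // => j _; rewrite scale0r subr0.
Qed.

(** On the top configuration [- q^k h_{i,k} / [k]] has the eigenvalue
   [- sum_j b_j^k / k] at the first node, which is the coefficient of
   [sum_j log (1 - b_j u)]. *)
Lemma P_eigenvalue e i r :
  exp_coef (fun s : nat =>
    - (q ^ sgi e s / qint q s) * Hval q b i (sgi e s) top_config : K^o) r
  = (pisgn e (drinfeld i))`_r.
Proof.
(* With all [x_j = 0] the quotient is a polynomial. *)
rewrite (@exp_coef_quot _ char0 _ (fun=> 0) (zroot e i) _ r.+1) //.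
  rewrite -prod_zroot big_split /= big1 ?mul1r // => j _.
  apply/polyP => k; rewrite coef_poly coef1 expr0n.
  by case: ltnP => //; case: k.
move=> [|s].
  rewrite (_ : sgi e 0 = 0); last by case: (e).
  by rewrite Hval0 mulr0 big1 // => j _; rewrite invr0 mulr0.
rewrite /Hval mulr_sumr; apply: eq_bigr => j _.
rewrite expr0n /= sub0r /hval eps_top /zroot.
case: eqP => [i0|_]; last by rewrite mulr0 oppr0 expr0z subrr expr0n oppr0 !(mul0r, mulr0).
rewrite /beta i0 expr0 !mulr1.
have -> : b j ^ sgi e s.+1 = (if e then b j else (b j)^-1) ^+ s.+1.
  by case: (e) => //=; rewrite exprVn exprnN.
rewrite [LHS]mulrA [RHS]mulNr [_ / s.+1%:R]mulrC -[RHS]mulNr; congr (_ * _); rewrite mulNr; congr (- _).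
have S0 : s.+1%:R != 0 :> K by exact: char0.
rewrite /qint; set Q := q ^ s.+1%:Z.
have Q0 : Q != 0 by rewrite expfz_neq0.
have QQ : Q - Q^-1 != 0.
  by have := @qint_neq0 s.+1 isT; rewrite mulf_eq0 => /norP[]; rewrite -/Q -invr_expz.
case: (e) => /=.
  have -> : q ^ (- (2 * s.+1%:Z)) = (Q * Q)^-1.
    by rewrite -expfzDr // invr_expz; congr (_ ^ _); lia.
  rewrite -invr_expz -/Q -pmulrn; move: (q - q^-1) qq0 => w w0.
  have e1 : 1 - (Q * Q)^-1 = (Q - Q^-1) / Q by field.
  rewrite e1; move: (Q - Q^-1) QQ (s.+1%:R : K) S0 => u u0 t t0.
  by field; rewrite ?u0 ?t0 ?w0 ?Q0.
have -> : q ^ (- (2 * - s.+1%:Z)) = Q * Q.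
  by rewrite -expfzDr //; congr (_ ^ _); lia.
rewrite -invr_expz -/Q mulrNz -pmulrn; move: (q - q^-1) qq0 => w w0.
have e1 : 1 - Q * Q = - (Q - Q^-1) * Q by field.
rewrite e1; move: (Q - Q^-1) QQ (s.+1%:R : K) S0 => u u0 t t0.
by field; rewrite ?oppr_eq0 ?u0 ?t0 ?w0 ?Q0.
Qed.

Variables (V : vectType K) (rho : rep (Uq q n) V) (v : V).
Hypothesis hV : is_V drinfeld rho v.

Lemma uq_h0 (i : 'I_n) : uq_h q i 0 = 0.
Proof. by rewrite /uq_h /htot insubF. Qed.

Lemma highest_h i r : rho (uq_h q i r) v = Hval q b i r top_config *: v.
Proof.
have main e k : rho (uq_h q i (sgi e k%:Z)) v = Hval q b i (sgi e k) top_config *: v.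
  have [N] := ubnP k; elim: N k => // N IHN k kN.
  have [->|k0] := posnP k.
    rewrite (_ : sgi e 0 = 0); last by case: (e).
    by rewrite uq_h0 rep0l Hval0 scale0r.
  pose a (s : nat) := - (q ^ sgi e s / qint q s).
  have a0 : a k != 0.
    by rewrite oppr_eq0 mulf_neq0 ?expfz_neq0 // invr_eq0 qint_neq0 // -lt0n.
  pose f (s : nat) := a s *: uq_h q i (sgi e s).
  pose g (s : nat) : K^o := a s * Hval q b i (sgi e s) top_config.
  have fg : rho (f k) v = (g k : K) *: v.
    apply: rep_exp_coef_triangular => //.
    - by rewrite /f (_ : sgi e 0 = 0) ?uq_h0 ?scaler0 //; case: (e).
    - by rewrite /g (_ : sgi e 0 = 0) ?Hval0 ?mulr0 //; case: (e).
    - by move=> s sk; rewrite /f /g actZl IHN ?scalerA //; exact: (leq_trans sk (ltnSE kN)).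
    - by rewrite (V_P hV) (P_eigenvalue e i k).
  by move: fg; rewrite /f /g actZl -scalerA => /(scalerI a0).
case: r => k; first exact: (main true k).
by have := main false k.+1; rewrite /sgi NegzE.
Qed.

Lemma wt_top (i : 'I_n) : wt i top_config = ((i == 0%N :> nat) * M)%N.
Proof.
rewrite /wt (eq_bigr (fun=> (i == 0%N :> nat)%:Z)) => [|j _]; last by rewrite eps_top.
by rewrite sumr_const card_ord -[LHS]mulr_natr natz PoszM.
Qed.

Lemma highest_K e i : rho (uq_K q e i) v = Kval q e i top_config *: v.
Proof.
have KT : rho (uq_K q true i) v = q ^ wt i top_config *: v.
  rewrite (V_K hV) wt_top /drinfeld; case: eqP => _ /=; last by rewrite size_poly1 mul0n.
  rewrite -(big_map b xpredT (fun z => 1 - z *: 'X)) size_prod_lin.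
    by rewrite size_map -[index_enum _]enumT size_enum_ord mul1n.
  by apply/allP => _ /mapP[j _ ->].
case: e; first exact: KT.
have k0 : q ^ wt i top_config != 0 by rewrite expfz_neq0.
apply: (scalerI k0); rewrite -actZr -KT -actM uq_KVK act1 /Kval /=.
by rewrite scalerA -expfzDr // subrr expr0z scale1r.
Qed.

End HighestWeight.

(** * The irreducible module is the explicit one *)

(** A subspace of maximal dimension among those contained in [N] is equal to
   [N]. *)
Lemma vspace_of_pred (K : fieldType) (V : vectType K) (N : V -> Prop) :
  N 0 -> (forall v w, N v -> N w -> N (v + w)) -> (forall c v, N v -> N (c *: v)) ->
  exists W : {vspace V}, forall v, v \in W <-> N v.
Proof.
move=> N0 ND NZ; pose sub (W : {vspace V}) := forall v, v \in W -> N v.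
pose P d := `[< exists2 W : {vspace V}, sub W & \dim W = d >].
have exP : exists d, P d.
  by exists 0%N; apply/asboolP; exists 0%VS; rewrite ?dimv0 // => v; rewrite memv0 => /eqP->.
have leP d : P d -> (d <= \dim {:V})%N.
  by case/asboolP=> W _ <-; exact/dimvS/subvf.
case: (ex_maxnP exP leP) => d /asboolP[W WN dW] dmax.
exists W => v; split=> [|Nv]; first exact: WN.
have /dmax : P (\dim (W + <[v]>)%VS).
  apply/asboolP; exists (W + <[v]>)%VS => // u /memv_addP[w wW [t /vlineP[c ->] ->]].
  by apply: ND; [exact: WN | exact: NZ].
rewrite -dW => le; have /eqP-> : W == (W + <[v]>)%VS by rewrite eqEdim addvSl.
exact: (subvP (addvSr W _) _ (memv_line v)).
Qed.

Section Uniqueness.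
Variables (K : fieldType) (q : K) (n M : nat) (b : 'I_M -> K).
Hypothesis char0 : forall r, r.+1%:R != 0 :> K.
Hypotheses (q0 : q != 0) (qroot : forall k, q ^+ k.+1 != 1).
Hypotheses (b0 : forall j, b j != 0) (bI : injective b).
Hypothesis bq : forall j l, q * b j - q^-1 * b l != 0.
Variables (V : vectType K) (rho : rep (Uq q n) V) (v : V).
Hypothesis hV : is_V (@drinfeld K n M b) rho v.

Local Notation model := {ffun config n M -> K^o}.
Local Notation top := (delta_fun K (top_config n M)).
Let qq0 := q_subV_neq0 q0 qroot.
Implicit Types (w : V) (x : model) (i k : 'I_n) (r s : int) (e d : bool).

(** The submodule of [V + model] generated by the pair of highest weight vectors:
   words in the lowering operators suffice to span it, because raising operators
   and Cartan elements can be moved to the right. It turns out to be the graph of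
   an isomorphism. *)
Inductive joint : V -> model -> Prop :=
  | joint_top : joint v top
  | joint_add w x w' x' : joint w x -> joint w' x' -> joint (w + w') (x + x')
  | joint_scale c w x : joint w x -> joint (c *: w) (c *: x)
  | joint_lower k s w x : joint w x ->
      joint (rho (uq_x q false k s) w) (xop q b false k s x).

Lemma joint0 : joint 0 0.
Proof. by rewrite -(scale0r v) -(scale0r top); exact/joint_scale/joint_top. Qed.

Lemma joint_sum (I : Type) (t : seq I) (P : pred I) (F : I -> V) (G : I -> model) :
  (forall j, P j -> joint (F j) (G j)) ->
  joint (\sum_(j <- t | P j) F j) (\sum_(j <- t | P j) G j).
Proof.
by move=> h; apply: (big_rec2 (fun u y => joint u y)) => [|i u y Pi];
  [exact: joint0 | exact/joint_add/h].
Qed.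

Lemma diag_op_top F : diag_op F top = (F (top_config n M) : K) *: top.
Proof.
apply/ffunP => c; rewrite !ffunE /GRing.scale /=.
by have [->|_] := eqVneq c (top_config n M); rewrite ?mulr0.
Qed.

Lemma diag_opD (F : config n M -> K) x y : diag_op F (x + y) = diag_op F x + diag_op F y.
Proof. by have := diag_op_linear F 1 x y; rewrite !scale1r. Qed.

Lemma diag_opZ (F : config n M -> K) (a : K) x : diag_op F (a *: x) = a *: diag_op F x.
Proof. by apply/ffunP => c; rewrite !ffunE /GRing.scale /= mulrCA. Qed.

Lemma xopD d i r x y : xop q b d i r (x + y) = xop q b d i r x + xop q b d i r y.
Proof. by have := xop_linear q b d i r 1 x y; rewrite !scale1r. Qed.

Lemma xop0 d i r : xop q b d i r (0 : model) = 0.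
Proof. by apply: (addrI (xop q b d i r 0)); rewrite -xopD !addr0. Qed.

Lemma xopZ d i r (a : K) x : xop q b d i r (a *: x) = a *: xop q b d i r x.
Proof. by have := xop_linear q b d i r a x 0; rewrite xop0 !addr0. Qed.

Lemma joint_K e i w x : joint w x -> joint (rho (uq_K q e i) w) (diag_op (Kval q e i) x).
Proof.
elim=> {w x} [|w x w' x' _ IH _ IH'|c w x _ IH|k s w x _ IH].
- rewrite diag_op_top (highest_K q0 b0 hV); exact/joint_scale/joint_top.
- by rewrite diag_opD actDr; exact: joint_add.
- by rewrite diag_opZ actZr; exact: joint_scale.
rewrite -actM uq_Kx // Kval_xop // actZl actM.
have -> : sgi e (sgi false (cartan i k)) = sgi false (sgi e (cartan i k)) by case: (e).
exact/joint_scale/joint_lower.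
Qed.

Lemma joint_h i r w x : joint w x -> joint (rho (uq_h q i r) w) (diag_op (Hval q b i r) x).
Proof.
elim=> {w x} [|w x w' x' _ IH _ IH'|c w x _ IH|k s w x wx IH].
- rewrite diag_op_top (highest_h char0 q0 qroot b0 hV); exact/joint_scale/joint_top.
- by rewrite diag_opD actDr; exact: joint_add.
- by rewrite diag_opZ actZr; exact: joint_scale.
have [->|r0] := eqVneq r 0.
  rewrite uq_h0 rep0l [X in joint _ X](_ : _ = 0); first exact: joint0.
  by apply/ffunP => c; rewrite !ffunE Hval0 mul0r.
rewrite -actM uq_hx // actDl actM actZl.
have := Hval_xop q0 qq0 b0 i r false k s x => /(canRL (subrK _)) ->.
rewrite [X in joint _ X]addrC.
by apply: joint_add; [exact: joint_lower | exact/joint_scale/joint_lower].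
Qed.

Lemma joint_exp i (a : K) (t : bool) (r : nat) w x : joint w x ->
  joint (rho (exp_coef (fun s : nat => a *: uq_h q i (sgi t s)) r) w)
        (diag_op (fun c => exp_coef (fun s : nat => a * Hval q b i (sgi t s) c : K^o) r) x).
Proof.
move=> wx.
have pw (k u : nat) : joint (rho (ps_pow (fun s : nat => a *: uq_h q i (sgi t s)) k u) w)
   (diag_op (fun c => ps_pow (fun s : nat => a * Hval q b i (sgi t s) c : K^o) k u) x).
  elim: k u => [|k IHk] u /=.
    rewrite [X in joint _ X](_ : _ = ((u == 0%N)%:R : K) *: x); last by apply/ffunP => c; rewrite !ffunE.
    have -> : ((u == 0%N)%:R : Uq q n) = ((u == 0%N)%:R : K) *: 1 by rewrite scaler_nat.
    by rewrite actZl act1; exact: joint_scale.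
  rewrite rep_suml [X in joint _ X](_ : _ = \sum_(l < u.+1) a *: diag_op (Hval q b i (sgi t l))
     (diag_op (fun c => ps_pow (fun s : nat => a * Hval q b i (sgi t s) c : K^o) k (u - l)) x)).
    by apply: joint_sum => l _; rewrite actM actZl; exact/joint_scale/joint_h.
  apply/ffunP => c; rewrite sum_ffunE ffunE mulr_suml; apply: eq_bigr => l _.
  by rewrite !ffunE /GRing.scale /= !mulrA.
rewrite /exp_coef rep_suml [X in joint _ X](_ : _ = \sum_(k < r.+1) (k`!%:R^-1 : K) *:
     diag_op (fun c => ps_pow (fun s : nat => a * Hval q b i (sgi t s) c : K^o) k r) x).
  by apply: joint_sum => k _; rewrite actZl; exact: joint_scale.
apply/ffunP => c; rewrite sum_ffunE ffunE mulr_suml; apply: eq_bigr => k _.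
by rewrite !ffunE /GRing.scale /= !mulrA.
Qed.

(** Each [psi] is a polynomial in the [h_{i,r}] and [K_i], evaluated in the same
   way on both summands. *)
Lemma joint_psi e i r w x :
  joint w x -> joint (rho (uq_psi q e i r) w) (diag_op (psival q b e i r) x).
Proof.
move=> wx; rewrite /uq_psi /psival; case: ifP => _; last first.
  rewrite rep0l [X in joint _ X](_ : _ = 0); first exact: joint0.
  by apply/ffunP => c; rewrite !ffunE mul0r.
rewrite actM [X in joint _ X](_ : _ = diag_op (Kval q e i) (diag_op (fun c => exp_coef
    (fun s : nat => (sgk K e * (q - q^-1)) * Hval q b i (sgi e s) c : K^o) `|r|) x)).
  exact/joint_K/joint_exp.
by apply/ffunP => c; rewrite !ffunE mulrA.
Qed.

Lemma joint_raise i r w x :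
  joint w x -> joint (rho (uq_x q true i r) w) (xop q b true i r x).
Proof.
elim=> {w x} [|w x w' x' _ IH _ IH'|c w x _ IH|k s w x wx IH].
- by rewrite (V_x hV) xop_top; exact: joint0.
- by rewrite xopD actDr; exact: joint_add.
- by rewrite xopZ actZr; exact: joint_scale.
rewrite -actM uq_xx // actDl actM.
have := xop_commutator char0 q0 qq0 b0 bI bq i k r s x => /(canRL (subrK _)) ->.
rewrite [X in joint _ X]addrC; apply: joint_add; first exact: joint_lower.
case: ifP => _; last by rewrite rep0l; exact: joint0.
rewrite actZl repBl; apply: joint_scale.
by apply: joint_add; rewrite -?scaleN1r -?[- diag_op _ _]scaleN1r;
  [|apply: joint_scale]; exact: joint_psi.
Qed.

(** The element [K] of the sum of the positive coroots, which takes the value [2]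
   on every simple root. It bounds weights with a single operator. *)
Definition height_elt : Uq q n := \prod_(i < n) uq_K q true i ^+ (i.+1 * (n - i)).

Lemma sum_height k : \sum_(i < n) (i.+1 * (n - i))%N%:Z * cartan i k = 2.
Proof.
(* [a] vanishes at [0] and [n + 1], so the end nodes behave like the others. *)
pose a (u : nat) : int := u%:Z * (n.+1%:Z - u%:Z).
have aE (i : 'I_n) : (i.+1 * (n - i))%N%:Z = a i.+1.
  by rewrite /a PoszM -subzn ?(ltnW (ltn_ord i)) //; congr (_ * _); lia.
under eq_bigr do rewrite aE.
have cE (i : 'I_n) : cartan i k = 2 * (i == k)%:R - (i.+1 == k :> nat)%:R - (k.+1 == i :> nat)%:R.
  rewrite /cartan -val_eqE /=; repeat (case: eqP => ?); rewrite /=; lia.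
transitivity (2 * a k.+1 - a k - a k.+2); last by rewrite /a; lia.
transitivity (\sum_(i < n) 2 * (a i.+1 * (i == k)%:R)
  - \sum_(i < n) a i.+1 * (i.+1 == k :> nat)%:R - \sum_(i < n) a i.+1 * (k.+1 == i :> nat)%:R).
  by rewrite -!sumrB; apply: eq_bigr => i _; rewrite cE; ring.
congr (_ - _ - _).
- rewrite (bigD1 k) //= eqxx mulr1 big1 ?addr0 // => i /negbTE->.
  by rewrite !mulr0.
- case: k cE => [[|k] kn] _ /=.
    by rewrite big1 ?/a ?mul0r // => i _; rewrite mulr0.
  have kn' : (k < n)%N by lia.
  rewrite (bigD1 (Ordinal kn')) //= eqxx mulr1 big1 ?addr0 // => i.
  by rewrite -val_eqE /= eqSS => /negbTE->; rewrite mulr0.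
have [kn'|kn'] := ltnP k.+1 n.
  rewrite (bigD1 (Ordinal kn')) //= eqxx mulr1 big1 ?addr0 // => i.
  by rewrite -val_eqE /= eq_sym => /negbTE->; rewrite mulr0.
rewrite big1 => [|i _].
  have e : n.+1%:Z - k.+2%:Z = 0 by have := ltn_ord k; lia.
  by rewrite /a e mulr0.
by rewrite (_ : (k.+1 == i :> nat) = false) ?mulr0 //; have := ltn_ord i; lia.
Qed.

Lemma height_elt_x k s :
  height_elt * uq_x q false k s = (q ^- 2) *: (uq_x q false k s * height_elt).
Proof.
have pow i a : uq_K q true i ^+ a * uq_x q false k s =
    q ^ (- (a%:Z * cartan i k)) *: (uq_x q false k s * uq_K q true i ^+ a).
  elim: a => [|a IHa]; first by rewrite !expr0 mul1r mulr1 mul0r expr0z scale1r.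
  rewrite exprS -mulrA IHa -scalerAr [uq_K _ _ _ * (_ * _)]mulrA uq_Kx //= -!scalerAl scalerA -mulrA.
  rewrite -expfzDr //; apply: (congr1 (fun u => q ^ u *: _)); lia.
have -> : q ^- 2 = q ^ (- \sum_(i < n) (i.+1 * (n - i))%N%:Z * cartan i k).
  by rewrite sum_height exprnN.
rewrite /height_elt; elim: (index_enum _) => [|i t IHt]; first by rewrite !big_nil mul1r mulr1 oppr0 expr0z scale1r.
rewrite !big_cons -mulrA IHt -scalerAr (mulrA (uq_K q true i ^+ _) (uq_x _ _ _ _)) pow -scalerAl scalerA -mulrA.
rewrite -expfzDr // -opprD addrC; exact: erefl.
Qed.

Let T w := rho height_elt w.
Let tau : K := \prod_(i < n) Kval q true i (top_config n M) ^+ (i.+1 * (n - i)).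

Lemma T_top : T v = tau *: v.
Proof.
rewrite /T /tau /height_elt; elim/big_rec2: _ => [|i c a _ IH].
  by rewrite act1 scale1r.
rewrite actM IH actZr mulrC -scalerA; congr (_ *: _).
elim: (_ * _)%N => [|m IHm]; first by rewrite !expr0 act1 scale1r.
by rewrite !exprS actM IHm actZr (highest_K q0 b0 hV) scalerA mulrC.
Qed.

(** Sums of eigenvectors of [height_elt] below the eigenvalue of [v]. *)
Inductive lower : V -> Prop :=
  | lower_eigen (m : nat) w : T w = (tau / q ^+ (2 * m.+1)) *: w -> lower w
  | lower_add w w' : lower w -> lower w' -> lower (w + w').

Lemma lower_scale c w : lower w -> lower (c *: w).
Proof.
elim=> [m u Tu|u u' _ IH _ IH']; last by rewrite scalerDr; exact: lower_add.
by apply: (lower_eigen (m := m)); rewrite /T actZr -/(T u) Tu !scalerA mulrC.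
Qed.

Lemma T_lower k s (a : nat) w : T w = (tau / q ^+ (2 * a)) *: w ->
  T (rho (uq_x q false k s) w) = (tau / q ^+ (2 * a.+1)) *: rho (uq_x q false k s) w.
Proof.
rewrite /T -actM height_elt_x actZl actM => ->; rewrite actZr scalerA; congr (_ *: _).
by rewrite mulnS exprD [(q ^+ 2 * _)^-1]invfM mulrCA.
Qed.

Lemma lower_x k s w : lower w -> lower (rho (uq_x q false k s) w).
Proof.
elim=> [m u Tu|u u' _ IH _ IH']; last by rewrite actDr; exact: lower_add.
by apply: (lower_eigen (m := m.+1)); exact: T_lower.
Qed.

(** A product of factors [T - a] kills any given element of [lower] and multiplies
   [v] by a nonzero scalar, as [q] is not a root of unity. *)
Lemma not_lower_top : ~ lower v.
Proof.
(* [ann u t] applies to [u] one factor for each entry of [t]. *)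
pose ann := foldr (fun (m : nat) u => T u - (tau / q ^+ (2 * m.+1)) *: u).
have TD u u' : T (u + u') = T u + T u' by exact: actDr.
have TZ c u : T (c *: u) = c *: T u by exact: actZr.
have annD t u u' : ann (u + u') t = ann u t + ann u' t.
  by elim: t => //= m t ->; rewrite TD scalerDr opprD addrACA.
have annZ t c u : ann (c *: u) t = c *: ann u t.
  by elim: t => //= m t ->; rewrite TZ scalerBr !scalerA mulrC.
have annT t u : ann (T u) t = T (ann u t).
  by elim: t => //= m t ->; rewrite -!scaleNr TD TZ.
have annC t t' u : ann (ann u t') t = ann (ann u t) t'.
  elim: t' => //= m t' IH; rewrite -!scaleNr annD annZ annT IH.
  by [].
have ann0 t : ann 0 t = 0 by have := annZ t 0 0; rewrite !scale0r.
have lowE u : lower u -> exists t, ann u t = 0.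
  elim=> [m {}u Tu|u1 u2 _ [t1 e1] _ [t2 e2]].
    by exists [:: m]; rewrite /= Tu subrr.
  exists (t1 ++ t2); rewrite (_ : ann _ _ = ann (ann (u1 + u2) t2) t1); last exact: foldr_cat.
  by rewrite annD e2 addr0 annC e1 ann0.
case/lowE=> t; suff -> : ann v t = (\prod_(m <- t) (tau - tau / q ^+ (2 * m.+1))) *: v.
  move/eqP; rewrite scaler_eq0 (negbTE (V_neq0 hV)) orbF; apply/negP; rewrite prodf_seq_neq0.
  apply/allP => m _ /=; rewrite -{1}[tau]mulr1 -mulrBr mulf_neq0 //.
    by apply/prodf_neq0 => i _; rewrite expf_neq0 // expfz_neq0.
  by rewrite subr_eq0 eq_sym invr_eq1 mulnS; exact: qroot.
elim: t => [|m t IH]; first by rewrite big_nil scale1r.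
by rewrite big_cons /= IH TZ T_top !scalerA -scalerBl mulrC -mulrBl.
Qed.

(** A nonempty word in the lowering operators gives an element of [lower] on one
   side and a function that vanishes at the top configuration on the other. *)
Lemma joint_lowerP w x : joint w x -> lower (w - (x (top_config n M) : K) *: v).
Proof.
elim=> {w x} [|w x w' x' _ IH _ IH'|c w x _ IH|k s w x _ IH].
- rewrite ffunE eqxx scale1r subrr; apply: (lower_eigen (m := 0%N)).
  by rewrite /T rep0r scaler0.
- rewrite ffunE scalerDl opprD addrACA; exact: lower_add.
- by rewrite ffunE -scalerA -scalerBr; exact: lower_scale.
have -> : xop q b false k s x (top_config n M) = 0.
  rewrite xopE big1 // => j _; case: eqP => //; rewrite ffunE => /(congr1 val) /=.
  by rewrite /box /=.
rewrite scale0r subr0 -[w](subrK ((x (top_config n M) : K) *: v)) actDr.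
apply: lower_add; first exact: lower_x.
rewrite actZr; apply/lower_scale/(lower_eigen (m := 0%N))/T_lower.
by rewrite muln0 expr0 divr1 T_top.
Qed.

Lemma joint_no_top : ~ joint 0 top.
Proof.
move/joint_lowerP; rewrite ffunE eqxx scale1r sub0r => /(lower_scale (-1)).
by rewrite scaleN1r opprK; exact: not_lower_top.
Qed.

Lemma joint_opp w x : joint w x -> joint (- w) (- x).
Proof. by rewrite -scaleN1r -[- x]scaleN1r; exact: joint_scale. Qed.

(** The elements [x] with [(0, x)] in [joint] form a submodule of the model, which
   contains [top] as soon as it is nonzero. *)
Lemma joint_inj_l x : joint 0 x -> x = 0.
Proof.
move=> Jx; apply: contrapT => /eqP x0; apply: joint_no_top.
apply: (model_top q0 qq0 bI bq (P := joint 0) _ _ _ Jx x0).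
- by move=> y z Jy Jz; rewrite -[0]addr0; exact: joint_add.
- by move=> c y Jy; rewrite -(scaler0 V c); exact: joint_scale.
- move=> d i r y Jy; rewrite -(rep0r rho (uq_x q d i r)).
  by case: d; [exact: joint_raise | exact: joint_lower].
Qed.

(** The elements [w] with [(w, 0)] in [joint] form a submodule of [V]; if it is
   not zero it contains [v], and then [joint] contains [(0, top)]. *)
Lemma joint_inj_r w : joint w 0 -> w = 0.
Proof.
pose N u := joint u 0.
have ND u u' : N u -> N u' -> N (u + u') by move=> h h'; rewrite /N -[0]addr0; exact: joint_add.
have NZ c u : N u -> N (c *: u).
  by move=> h; rewrite /N -(scaler0 _ c); exact: joint_scale.
have [W WN] := vspace_of_pred joint0 ND NZ.
have diag_op0 F : diag_op F (0 : model) = 0 by apply/ffunP => c; rewrite !ffunE mulr0.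
have stab a u : u \in W -> rho a u \in W.
  move=> /WN Nu; apply/WN; refine (@uq_stable _ _ _ _ rho N ND NZ _ _ _ a u Nu); clear u Nu.
  - move=> e i r u' h; rewrite /N -(xop0 e i r).
    by case: e; [exact: joint_raise | exact: joint_lower].
  - by move=> i r u' h; rewrite /N -(diag_op0 (Hval q b i r)); exact: joint_h.
  - by move=> e i u' h; rewrite /N -(diag_op0 (Kval q e i)); exact: joint_K.
case: (V_irr hV stab) => [W0|Wf] Jw.
  by apply/eqP; rewrite -memv0 -W0; exact/WN.
have : N v by apply/WN; rewrite Wf memvf.
move/joint_opp/(joint_add joint_top); rewrite subrr oppr0 addr0 => /joint_no_top.
by [].
Qed.

Lemma joint_total_r x : exists w, joint w x.
Proof.
apply: (model_gen q0 qq0 bI bq (P := fun x => exists w, joint w x)).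
- by move=> y z [w Jw] [u Ju]; exists (w + u); exact: joint_add.
- by move=> c y [w Jw]; exists (c *: w); exact: joint_scale.
- move=> d i r y [w Jw]; exists (rho (uq_x q d i r) w).
  by case: d; [exact: joint_raise | exact: joint_lower].
- by exists v; exact: joint_top.
Qed.

Lemma joint_total_l w : exists x, joint w x.
Proof.
have [a ->] := V_gen hV w.
apply: (@uq_stable _ _ _ _ rho (fun w => exists x, joint w x)).
- by move=> u u' [x Jx] [y Jy]; exists (x + y); exact: joint_add.
- by move=> c u [x Jx]; exists (c *: x); exact: joint_scale.
- move=> e i r u [x Jx]; exists (xop q b e i r x).
  by case: e; [exact: joint_raise | exact: joint_lower].
- by move=> i r u [x Jx]; exists (diag_op (Hval q b i r) x); exact: joint_h.
- by move=> e i u [x Jx]; exists (diag_op (Kval q e i) x); exact: joint_K.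
- by exists top; exact: joint_top.
Qed.

Record model_iso (phi : model -> V) : Prop := ModelIso {
  iso_linear : forall (c : K) x y, phi (c *: x + y) = c *: phi x + phi y;
  iso_inj : injective phi;
  iso_surj : forall w, exists x, w = phi x;
  iso_top : phi top = v;
  iso_x : forall d i r x, phi (xop q b d i r x) = rho (uq_x q d i r) (phi x);
  iso_h : forall i r x, phi (diag_op (Hval q b i r) x) = rho (uq_h q i r) (phi x);
  iso_K : forall e i x, phi (diag_op (Kval q e i) x) = rho (uq_K q e i) (phi x)
}.

(** [joint] projects onto both summands and meets each of them trivially, so it is
   the graph of an isomorphism. *)
Theorem model_unique : exists phi, model_iso phi.
Proof.
pose phi x := sval (cid (joint_total_r x)).
have phiJ x : joint (phi x) x by rewrite /phi; case: cid.
have phiE w x : joint w x -> phi x = w.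
  move=> Jw; apply/eqP; rewrite -subr_eq0; apply/eqP/joint_inj_r.
  by rewrite -(subrr x); apply: joint_add => //; exact: joint_opp.
exists phi; split.
- by move=> c x y; apply: phiE; apply: joint_add => //; exact: joint_scale.
- move=> x y e; apply/eqP; rewrite -subr_eq0; apply/eqP/joint_inj_l.
  by rewrite -(subrr (phi x)) {2}e; apply: joint_add => //; exact: joint_opp.
- by move=> w; have [x Jx] := joint_total_l w; exists x; rewrite (phiE _ _ Jx).
- exact/phiE/joint_top.
- move=> d i r x; apply: phiE.
  by case: d; [exact: joint_raise | exact: joint_lower].
- by move=> i r x; apply/phiE/joint_h.
- by move=> e i x; apply/phiE/joint_K.
Qed.

End Uniqueness.

(** * Weight spaces of the irreducible modules and of tensor powers *)

Section Families.
Variables (K : fieldType) (V : vectType K) (I : finType) (e : I -> V).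

Definition free_family := forall a : I -> K, \sum_i a i *: e i = 0 -> forall i, a i = 0.

Lemma free_codomP : free (codom e) <-> free_family.
Proof.
have nthE (i : 'I_#|I|) : (codom_tuple e)`_i = e (enum_val i) by rewrite /= nth_codom.
have sumE (a : I -> K) :
    \sum_i a i *: e i = \sum_(i < #|I|) a (enum_val i) *: (codom_tuple e)`_i.
  rewrite (reindex enum_val (onW_bij _ (@enum_val_bij I))) /=.
  by apply: eq_bigr => i _; rewrite -nthE.
split=> [/(@freeP _ _ _ (codom_tuple e)) h a a0 i|h].
  by rewrite -(enum_rankK i); apply: (h (a \o enum_val)); rewrite -sumE.
apply/(@freeP _ _ _ (codom_tuple e)) => a a0 i; rewrite -(enum_valK i).
apply: (h (a \o enum_rank)); rewrite sumE -[RHS]a0.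
by apply: eq_bigr => j _; rewrite /= enum_valK.
Qed.

End Families.

Section WeightDimension.
Variables (K : fieldType) (q : K).
Hypotheses (q0 : q != 0) (qroot : forall k, q ^+ k.+1 != 1).

Lemma q_expz_inj : injective (fun z : int => q ^ z).
Proof.
move=> y z /= e; apply/eqP; rewrite -subr_eq0; apply/negPn/negP => /(q_expz_neq1 qroot).
by rewrite expfzDr // e -expfzDr // subrr expr0z eqxx.
Qed.

Lemma linfun_of (V : vectType K) (f : V -> V) :
  (forall c u w, f (c *: u + w) = c *: f u + f w) -> forall u, linfun f u = f u.
Proof.
move=> fL u; pose L := GRing.isLinear.Build K V V *:%R f fL.
by pose F : {linear V -> V} := HB.pack f L; exact: (lfunE F u).
Qed.

Variables (n : nat) (V : vectType K) (I : finType) (e : I -> V) (w : 'I_n -> I -> int).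
Variable k : 'I_n -> V -> V.
Hypothesis kL : forall i c u u', k i (c *: u + u') = c *: k i u + k i u'.
Hypothesis ke : forall i x, k i (e x) = q ^ w i x *: e x.
Hypotheses (eF : free_family e) (eS : forall v, exists a : I -> K, v = \sum_x a x *: e x).

Lemma wtspace_dim (mu : 'I_n -> rat) :
  \dim (wtspace q k mu) = #|[set x | [forall i, (w i x)%:~R == mu i]]|.
Proof.
rewrite /wtspace; case: forallP => [muZ|muZ]; last first.
  rewrite dimv0; apply/esym/eqP; rewrite cards_eq0; apply/eqP/setP => x.
  rewrite !inE; apply/negP => /forallP h; apply: muZ => i.
  by rewrite -(eqP (h i)) intr_int.
set W := (\bigcap_i _)%VS; set S := [set x | _].
have k0 i : k i 0 = 0 by have := kL i (-1) 0 0; rewrite scaler0 add0r scaleN1r addNr.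
have kS i (a : I -> K) : k i (\sum_x a x *: e x) = \sum_x (a x * q ^ w i x) *: e x.
  rewrite (big_morph (k i) (id1 := 0) (op1 := +%R)) //.
    apply: eq_bigr => x _; have := kL i (a x) (e x) 0.
    by rewrite k0 !addr0 => ->; rewrite ke scalerA.
  by move=> u u'; have := kL i 1 u u'; rewrite !scale1r.
have WP (a : I -> K) : (\sum_x a x *: e x \in W) <-> forall x, x \notin S -> a x = 0.
  have inW : (\sum_x a x *: e x \in W) <->
      forall i, k i (\sum_x a x *: e x) = q ^ numq (mu i) *: \sum_x a x *: e x.
    split=> [|h].
      rewrite memvE => /subv_bigcapP h i; apply/eqP; rewrite -subr_eq0.
      by have := h i isT; rewrite -memvE memv_ker !lfun_simp linfun_of.
    rewrite memvE; apply/subv_bigcapP => i _; rewrite -memvE memv_ker.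
    by rewrite !lfun_simp linfun_of // h subrr.
  have muE i : mu i = (numq (mu i))%:~R by rewrite numqK.
  split=> [/inW h x|h].
    rewrite inE => /forallPn[i wx].
    have /eqP := h i; rewrite kS scaler_sumr -subr_eq0 -sumrB.
    under eq_bigr do rewrite scalerA -scalerBl.
    move/eqP/eF/(_ x)/eqP; rewrite [_ ^ _ * a x]mulrC -mulrBr mulf_eq0 => /predU1P[//|].
    rewrite subr_eq0 => /eqP/q_expz_inj e'; case/eqP: wx; rewrite [RHS]muE e'.
    by [].
  apply/inW => i; rewrite kS scaler_sumr; apply: eq_bigr => x _; rewrite scalerA.
  have [|/h->] := boolP (x \in S); last by rewrite mul0r mulr0.
  rewrite inE => /forallP/(_ i)/eqP; rewrite [RHS]muE => /intr_inj ->.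
  by rewrite mulrC.
pose eS' := [seq e x | x : I in S].
have fS : free eS'.
  have /free_codomP := eF; rewrite /codom /image_mem => fr.
  apply: catl_free (_ : free (eS' ++ [seq e x | x <- enum (~: S)])).
  rewrite -(perm_free (_ : perm_eq [seq e x | x <- enum I] _)) // -map_cat perm_map //.
  apply: uniq_perm; rewrite ?cat_uniq ?enum_uniq //=.
    rewrite andbT; apply/hasPn => x; rewrite !mem_enum inE => /negbTE->.
    by [].
  by move=> x; rewrite mem_cat !mem_enum finset.in_setC orbN.
have WE : W = <<eS'>>%VS.
  apply/eqP; rewrite eqEsubv; apply/andP; split.
    apply/subvP => v vW; have [a va] := eS v.
    move: vW; rewrite va => /WP h; rewrite (bigID (mem S)) /= [X in _ + X]big1 ?addr0.
      by apply: memv_suml => x xS; apply/memvZ/memv_span/fintype.image_f.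
    by move=> x /h->; rewrite scale0r.
  apply/span_subvP => _ /fintype.imageP[x xS ->].
  have -> : e x = \sum_y (y == x)%:R *: e y.
    by rewrite (bigD1 x) //= eqxx scale1r big1 ?addr0 // => y /negbTE->; rewrite scale0r.
  by apply/WP => y yS; case: eqP yS => // ->; rewrite xS.
by rewrite WE (eqP fS) size_image.
Qed.

End WeightDimension.

Section EigenBasis.
Variables (K : fieldType) (q : K) (n M : nat) (b : 'I_M -> K).
Variables (V : vectType K) (rho : rep (Uq q n) V) (v : V).
Variable phi : {ffun config n M -> K^o} -> V.
Hypothesis phiP : model_iso b rho v phi.

Lemma iso0 : phi 0 = 0.
Proof. by have := iso_linear phiP (-1) 0 0; rewrite scaler0 addr0 scaleN1r addNr. Qed.

Lemma iso_scale c x : phi (c *: x) = c *: phi x.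
Proof. by have := iso_linear phiP c x 0; rewrite iso0 !addr0. Qed.

Lemma iso_sum (I : Type) (s : seq I) (P : pred I) F :
  phi (\sum_(i <- s | P i) F i) = \sum_(i <- s | P i) phi (F i).
Proof.
apply: (big_morph phi) => [x y|]; last exact: iso0.
by have := iso_linear phiP 1 x y; rewrite !scale1r.
Qed.

Definition eigvec (c : config n M) : V := phi (delta_fun K c).

Lemma isoE x : phi x = \sum_c (x c : K) *: eigvec c.
Proof. by rewrite {1}[x]delta_fun_sum iso_sum; apply: eq_bigr => c _; rewrite iso_scale. Qed.

Lemma eigvec_free : free_family eigvec.
Proof.
move=> a a0 c; pose x : {ffun config n M -> K^o} := [ffun c => a c].
suff /(iso_inj phiP) /ffunP/(_ c) : phi x = phi 0 by rewrite !ffunE.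
by rewrite iso0 -[RHS]a0 isoE; apply: eq_bigr => c' _; rewrite ffunE.
Qed.

Lemma eigvec_span w : exists a : config n M -> K, w = \sum_c a c *: eigvec c.
Proof. by have [x ->] := iso_surj phiP w; exists x; exact: isoE. Qed.

Lemma eigvec_K e i c : rho (uq_K q e i) (eigvec c) = Kval q e i c *: eigvec c.
Proof.
rewrite -(iso_K phiP) -iso_scale; congr phi; apply/ffunP => c'; rewrite !ffunE.
by rewrite /GRing.scale /=; case: eqP => [->|_]; rewrite ?mulr0.
Qed.

Hypotheses (q0 : q != 0) (qroot : forall k, q ^+ k.+1 != 1).

Lemma V_wt_dim (mu : 'I_n -> rat) :
  \dim (V_wt rho mu) = #|[set c : config n M | [forall i, (wt i c)%:~R == mu i]]|.
Proof.
apply: (wtspace_dim q0 qroot _ _ eigvec_free eigvec_span) => [i c u w|i c].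
  by rewrite actDr actZr.
exact: eigvec_K.
Qed.

Section Tensor.
Variable k : nat.
Local Notation words := {ffun 'I_k -> config n M}.

Definition tvec (g : words) : tpow V k := tpure (fun j => eigvec (g j)).

Lemma tpure_scale (a : 'I_k -> K) (u : 'I_k -> V) :
  tpure (fun j => a j *: u j) = (\prod_j a j) *: tpure u.
Proof.
apply/ffunP => c; rewrite !ffunE /GRing.scale /= -big_split /=; apply: eq_bigr => j _.
by rewrite linearZ.
Qed.

Lemma tvec_span t : exists a : words -> K, t = \sum_g a g *: tvec g.
Proof.
have base (u : 'I_k -> V) : exists a : words -> K, tpure u = \sum_g a g *: tvec g.
  have [A uA] : exists A : 'I_k -> config n M -> K, forall j, u j = \sum_c A j c *: eigvec c.
    by have [A hA] := choice (fun j => eigvec_span (u j)); exists A.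
  exists (fun g : words => \prod_j A j (g j)); apply/ffunP => c.
  rewrite sum_ffunE [LHS]ffunE.
  under eq_bigr do [rewrite uA linear_sum /=; under eq_bigr do rewrite linearZ /=].
  rewrite bigA_distr_bigA /=; apply: eq_bigr => g _.
  by rewrite !ffunE big_split.
have [A hA] := choice (fun c : {ffun 'I_k -> 'I_(\dim {:V})} =>
   base (fun j => (vbasis {:V})`_(c j))).
exists (fun g => \sum_c (t c : K) * A c g).
rewrite [LHS]tpure_basis; under eq_bigr do rewrite hA scaler_sumr.
rewrite exchange_big /=; apply: eq_bigr => g _; rewrite scaler_suml.
by apply: eq_bigr => c _; rewrite scalerA.
Qed.

Lemma dim_iso : \dim {:V} = #|{: config n M}|.
Proof.
have /free_codomP fr := eigvec_free.
have -> : fullv = <<codom eigvec>>%VS.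
  apply/eqP; rewrite eqEsubv subvf andbT; apply/subvP => w _.
  have [a ->] := eigvec_span w; apply: memv_suml => c _.
  exact/memvZ/memv_span/codom_f.
by rewrite (eqP fr) size_codom.
Qed.

Lemma dim_tpow : \dim {:tpow V k} = (#|{: config n M}| ^ k)%N.
Proof.
rewrite dimvf -dim_iso -[dim _]/(#|{ffun 'I_k -> 'I_(\dim {:V})}| * 1)%N muln1.
by rewrite card_ffun !card_ord.
Qed.

(** A spanning family whose cardinality is the dimension is free. *)
Lemma tvec_free : free_family tvec.
Proof.
apply/free_codomP; have : basis_of {:tpow V k} (codom tvec).
  rewrite basisEdim size_codom dim_tpow card_ffun card_ord leqnn andbT.
  apply/subvP => t _; have [a ->] := tvec_span t; apply: memv_suml => g _.
  exact/memvZ/memv_span/codom_f.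
exact: basis_free.
Qed.

Lemma tmap_tvec i g :
  tmap (rho (uq_K q true i)) (tvec g) = q ^ (\sum_j wt i (g j)) *: tvec g.
Proof.
have rL : linear (rho (uq_K q true i)).
  by move=> c u w; rewrite actDr actZr.
pose L := GRing.isLinear.Build K V V *:%R (rho (uq_K q true i)) rL.
pose F : {linear V -> V} := HB.pack (act rho (uq_K q true i)) L.
rewrite -[tmap _ _]/(tmap F _) tmap_pure q_sum // -tpure_scale; congr tpure.
by apply/funext => j /=; rewrite eigvec_K.
Qed.

Lemma tensor_wt_dim (mu : 'I_n -> rat) :
  \dim (tensor_wt rho k mu) =
  #|[set g : words | [forall i, (\sum_j wt i (g j))%:~R == mu i]]|.
Proof.
have kL i (c : K) (u w : tpow V k) : tmap (rho (uq_K q true i)) (c *: u + w) =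
    c *: tmap (rho (uq_K q true i)) u + tmap (rho (uq_K q true i)) w.
  rewrite /tmap scaler_sumr -big_split /=; apply: eq_bigr => x _.
  by rewrite !ffunE scalerDl scalerA.
exact: (@wtspace_dim K q q0 qroot n (tpow V k) _ tvec (fun i g => \sum_j wt i (g j)) _
  kL tmap_tvec tvec_free tvec_span mu).
Qed.

End Tensor.
End EigenBasis.

(** A word of [k] configurations with one box is a configuration with [k] boxes. *)
Lemma card_words n k (mu : 'I_n -> rat) :
  #|[set g : {ffun 'I_k -> config n 1} | [forall i, (\sum_j wt i (g j))%:~R == mu i]]| =
  #|[set c : config n k | [forall i, (wt i c)%:~R == mu i]]|.
Proof.
pose F (c : config n k) : {ffun 'I_k -> config n 1} := [ffun j => [ffun=> c j]].
have FI : injective F.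
  by move=> c c' /ffunP e; apply/ffunP => j; have /ffunP/(_ ord0) := e j; rewrite !ffunE.
rewrite -(card_imset _ FI); apply: eq_card => g; rewrite inE; apply/idP/imsetP.
  move=> h; exists [ffun j => g j ord0]; last first.
    by apply/ffunP => j; apply/ffunP => l; rewrite !ffunE ord1.
  rewrite inE; apply: etrans h; apply: eq_forallb => i; congr (_%:~R == _).
  by rewrite /wt; apply: eq_bigr => j _; rewrite big_ord1 ffunE.
case=> c; rewrite inE => h ->; apply: etrans h; apply: eq_forallb => i; congr (_%:~R == _).
by rewrite /wt; apply: eq_bigr => j _; rewrite big_ord1 !ffunE.
Qed.

(** * Generators and degrees *)

Section UqeGenerators.
Variables (K : fieldType) (q : K) (n : nat).

Lemma malgU_M (k1 k2 : {fmonom (gen n)}) :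
  (<< monalg.mul k1 k2 >> : {malg K[{fmonom (gen n)}]}) = << k1 >> * << k2 >>.
Proof. by rewrite malgM_def fgmulUU mulr1. Qed.

Lemma freealg_ind (G : freealg K n -> Prop) :
  G 0 -> (forall a b, G a -> G b -> G (a + b)) -> (forall c a, G a -> G (c *: a)) ->
  G 1 -> (forall y b, G b -> G (fgen K y * b)) -> forall a, G a.
Proof.
move=> G0 GD GZ G1 GM a.
rewrite [a]monalgE; apply: (big_ind G) => // k _.
have -> : << a@_k *g k >> = a@_k *: (<< k >> : {malg K[{fmonom (gen n)}]}).
  by apply/malgP => k'; rewrite mcoeffZ !mcoeffU mulr_natr.
apply: GZ; case: k => s.
elim: s => [|y s IHs].
  have -> : FMonom [::] = monalg.one :> {fmonom (gen n)} by apply: val_inj; rewrite /= fm1.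
  exact: G1.
have -> : FMonom (y :: s) = monalg.mul (fmu y) (FMonom s) by apply: val_inj; rewrite /= fmM fmU.
by rewrite malgU_M; exact: GM.
Qed.

Lemma uqe_stable (V : lmodType K) (rho : rep (Uqe q n) V) (N : V -> Prop) :
  (forall v w, N v -> N w -> N (v + w)) -> (forall c v, N v -> N (c *: v)) ->
  (forall y v, N v -> N (rho (ugen q y) v)) -> forall a v, N v -> N (rho a v).
Proof.
move=> ND NZ Ny a v Nv.
have N0 : N 0 by rewrite -(scale0r v); exact: NZ.
have -> : a = @upi K q n (repr a) by rewrite /upi reprK.
move: (repr a) => {}a; move: v Nv.
pose G (a : freealg K n) := forall v, N v -> N (rho (@upi K q n a) v).
apply: (@freealg_ind G) a => [v _|a b Ga Gb v Nv|c a Ga v Nv|v Nv|y b Gb v Nv].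
- by rewrite upi0 rep0l.
- rewrite (_ : @upi K q n (a + b) = @upi K q n a + @upi K q n b).
    by rewrite actDl; apply: ND; [exact: Ga | exact: Gb].
  exact: (raddfD (@upi K q n)).
- by rewrite upiZ actZl; apply/NZ/Ga.
- by rewrite upi1 act1.
- by rewrite upiM actM; apply/Ny/Gb.
Qed.

Let D : Uqe q n := ugen q (gD true).

Lemma Uqe_DDi : D * ugen q (gD false) = 1.
Proof. by rewrite -upi1 -(upi_rel (rel_DDinv q (@fgen K n))) upiM. Qed.

Lemma deg_x e i r : uq_deg r (uq_x q e i r : Uq q n).
Proof. by rewrite /uq_deg (upi_prod3 (upi_rel (rel_Dx q (@fgen K n) e i r))) upiZ. Qed.

Lemma deg_h i r : uq_deg r (uq_h q i r : Uq q n).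
Proof.
have [->|r0] := eqVneq r 0; first by rewrite /uq_deg uq_h0 /= mulr0 mul0r scaler0.
rewrite /uq_deg uq_hE -upi_htot.
by rewrite (upi_prod3 (upi_rel (rel_Dh q (@fgen K n) i r0))) upiZ.
Qed.

Lemma deg_K e i : uq_deg 0 (uq_K q e i : Uq q n).
Proof.
rewrite /uq_deg expr0z scale1r.
have KD : ugen q (gK true i) * D = D * ugen q (gK true i).
  have := upi_prod2 (upi_rel (rel_KD q (@fgen K n) i)); rewrite upiM => h; exact: h.
case: e => /=; first by rewrite -/D -KD -mulrA Uqe_DDi mulr1.
have DK : D * ugen q (gK false i) = ugen q (gK false i) * D.
  rewrite -[LHS]mul1r -(Uqe_VKK q i) -mulrA; congr (_ * _).
  by rewrite mulrA KD -mulrA Uqe_KVK mulr1.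
by rewrite -/D DK -mulrA Uqe_DDi mulr1.
Qed.

End UqeGenerators.

(** * Rotation of configurations *)

Section Rotation.
Variables (K : fieldType) (q : K) (n m : nat) (b : 'I_m -> K) (z : K).
Hypotheses (q0 : q != 0) (z0 : z != 0) (zb : forall j, b (ordS j) = z * b j).

Local Notation cfg := (config n m).
Local Notation model := {ffun cfg -> K^o}.
Implicit Types (c : cfg) (x : model) (i : 'I_n) (a k : int).

Definition rot_config c : cfg := [ffun j => c (ordS j)].
Definition rotf x : model := [ffun c => x (rot_config c)].

Lemma rot_config_inj : injective rot_config.
Proof.
move=> c c' /ffunP e; apply/ffunP => j; have := e (ord_pred j).
by rewrite !ffunE ord_predK.
Qed.

Lemma rot_upd c j s : upd (rot_config c) j s = rot_config (upd c (ordS j) s).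
Proof. by apply/ffunP => l; rewrite !ffunE (inj_eq (@ordS_inj m)). Qed.

(** Rotating a configuration multiplies all parameters by [z], and the exchange
   factors are homogeneous of degree [0]. *)
Lemma rot_Coef d i j c : Coef q b d i j (rot_config c) = Coef q b d i (ordS j) c.
Proof.
rewrite /Coef [RHS](reindex (@ordS m) (onW_bij _ (@ordS_bij m))) /=.
apply: eq_big => [l|l _]; first by rewrite (inj_eq (@ordS_inj m)).
rewrite ffunE !zb; case: ifP => // _; rewrite /cf.
by case: d; rewrite -[z * _ - z * _]mulrBr ![_ * (z * _)]mulrCA -mulrBr
  invfM mulrACA mulfV // mul1r.
Qed.

Lemma rot_beta i j a : beta q b i j ^ a = z ^ (- a) * beta q b i (ordS j) ^ a.
Proof. by rewrite /beta zb -mulrA [(z * _) ^ a]expfzMl mulrA -expfzDr // addNr expr0z mul1r. Qed.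

Lemma rot_wt i c : wt i (rot_config c) = wt i c.
Proof.
rewrite /wt [RHS](reindex (@ordS m) (onW_bij _ (@ordS_bij m))) /=.
by apply: eq_bigr => j _; rewrite ffunE.
Qed.

Lemma rot_Hval i a c : Hval q b i a (rot_config c) = z ^ (- a) * Hval q b i a c.
Proof.
rewrite /Hval [in RHS](reindex (@ordS m) (onW_bij _ (@ordS_bij m))) /= mulr_sumr.
by apply: eq_bigr => j _; rewrite ffunE rot_beta mulrCA.
Qed.

Lemma xop_rotf d i a x : xop q b d i a (rotf x) = z ^ a *: rotf (xop q b d i a x).
Proof.
apply/ffunP => c; rewrite !ffunE !xopE /GRing.scale /= mulr_sumr.
rewrite [LHS](reindex (@ordS m) (onW_bij _ (@ordS_bij m))) /=.
apply: eq_bigr => j _; rewrite rot_Coef rot_upd !ffunE; case: ifP => _; last by rewrite mulr0.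
by rewrite (rot_beta i j) !mulrA -expfzDr // subrr expr0z mul1r.
Qed.

Lemma Hval_rotf i a x : diag_op (Hval q b i a) (rotf x) = z ^ a *: rotf (diag_op (Hval q b i a) x).
Proof.
apply/ffunP => c; rewrite !ffunE rot_Hval /GRing.scale /= !mulrA -expfzDr //.
by rewrite subrr expr0z mul1r.
Qed.

Lemma Kval_rotf e i x : diag_op (Kval q e i) (rotf x) = rotf (diag_op (Kval q e i) x).
Proof. by apply/ffunP => c; rewrite !ffunE /Kval rot_wt. Qed.

Lemma rotf_scale (u : K) x : rotf (u *: x) = u *: rotf x.
Proof. by apply/ffunP => c; rewrite !ffunE. Qed.

Lemma rotf_add x y : rotf (x + y) = rotf x + rotf y.
Proof. by apply/ffunP => c; rewrite !ffunE. Qed.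

(** The [twisted k] functions will be the vectors obtained from [v] by elements of
   degree [k]. *)
Definition twisted k x := rotf x = z ^ (- k) *: x.

Lemma twisted_xop d i a k x : twisted k x -> twisted (k + a) (xop q b d i a x).
Proof.
rewrite /twisted => tx; have := xop_rotf d i a x; rewrite tx xopZ => e.
apply: (scalerI (expfz_neq0 a z0)); rewrite -e scalerA -expfzDr //.
by congr (z ^ _ *: _); lia.
Qed.

Lemma twisted_h i a k x : twisted k x -> twisted (k + a) (diag_op (Hval q b i a) x).
Proof.
rewrite /twisted => tx; have := Hval_rotf i a x; rewrite tx diag_opZ => e.
apply: (scalerI (expfz_neq0 a z0)); rewrite -e scalerA -expfzDr //.
by congr (z ^ _ *: _); lia.
Qed.

Lemma twisted_K e i k x : twisted k x -> twisted k (diag_op (Kval q e i) x).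
Proof. by rewrite /twisted -Kval_rotf => ->; rewrite diag_opZ. Qed.

Lemma iter_rot (t : nat) c j : iter t rot_config c j = c (iter t (@ordS m) j).
Proof. by elim: t c j => //= t IHt c j; rewrite ffunE IHt -iterSr iterS. Qed.

Lemma val_iter_ordS (t : nat) (j : 'I_m) : iter t (@ordS m) j = ((j + t) %% m)%N :> nat.
Proof.
elim: t => [|t IHt]; first by rewrite addn0 modn_small.
by rewrite /= IHt -addn1 modnDml addn1 addnS.
Qed.

Lemma iter_rot_m c : iter m rot_config c = c.
Proof.
apply/ffunP => j; rewrite iter_rot; congr (c _); apply: val_inj.
by rewrite /= val_iter_ordS modnDr modn_small.
Qed.

Lemma rotf_top : rotf (delta_fun K (top_config n m)) = delta_fun K (top_config n m).
Proof.
apply/ffunP => c; rewrite !ffunE; congr (_%:R); congr nat_of_bool.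
rewrite -(inj_eq rot_config_inj c); congr (_ == _).
by apply/ffunP => j; rewrite !ffunE.
Qed.

Lemma twisted_top : twisted 0 (delta_fun K (top_config n m)).
Proof. by rewrite /twisted oppr0 expr0z scale1r rotf_top. Qed.

Hypotheses (m0 : m%:R != 0 :> K) (zm : z ^+ m = 1).

(** The average over rotations that projects onto the [twisted k] functions. *)
Definition proj k x : model := m%:R^-1 *: \sum_(t < m) z ^ (k * t%:Z) *: iter t rotf x.

Lemma iter_rotfE (t : nat) x c : iter t rotf x c = x (iter t rot_config c).
Proof. by elim: t c => //= t IHt c; rewrite ffunE IHt -iterSr. Qed.

Lemma proj_linear k (u : K) x y : proj k (u *: x + y) = u *: proj k x + proj k y.
Proof.
rewrite /proj scalerA mulrC -scalerA -scalerDr; congr (_ *: _).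
rewrite scaler_sumr -big_split /=; apply: eq_bigr => t _; apply/ffunP => c.
by rewrite !ffunE !iter_rotfE !ffunE scalerDr !scalerA mulrC.
Qed.

Lemma proj_id k x : twisted k x -> proj k x = x.
Proof.
move=> tx; have it t : iter t rotf x = z ^ (- (k * t%:Z)) *: x.
  elim: t => [|t IHt]; first by rewrite mulr0 oppr0 expr0z scale1r.
  rewrite /= IHt rotf_scale tx scalerA -expfzDr //; congr (z ^ _ *: _); lia.
rewrite /proj; under eq_bigr do rewrite it scalerA -expfzDr // subrr expr0z scale1r.
by rewrite sumr_const card_ord -scaler_nat scalerA mulVf // scale1r.
Qed.

Lemma xop_proj d i a k x : xop q b d i a (proj k x) = proj (k + a) (xop q b d i a x).
Proof.
have XS (u : nat) (F : 'I_u -> model) : xop q b d i a (\sum_t F t) = \sum_t xop q b d i a (F t).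
  by apply: (big_morph (xop q b d i a)) => [y y'|]; [exact: xopD | exact: xop0].
rewrite /proj xopZ XS; congr (_ *: _); apply: eq_bigr => t _; rewrite xopZ.
have -> : xop q b d i a (iter t rotf x) = z ^ (a * t%:Z) *: iter t rotf (xop q b d i a x).
  elim: (val t) => [|u IHu]; first by rewrite mulr0 expr0z scale1r.
  rewrite /= xop_rotf IHu rotf_scale scalerA -expfzDr //; congr (z ^ _ *: _); lia.
by rewrite scalerA -expfzDr // mulrDl.
Qed.

Lemma proj_top k : proj k (delta_fun K (top_config n m)) = (z ^ k == 1)%:R *: delta_fun K (top_config n m).
Proof.
have itT t : iter t rotf (delta_fun K (top_config n m)) = delta_fun K (top_config n m).
  by elim: t => //= t ->; exact: rotf_top.
rewrite /proj; under eq_bigr do rewrite itT.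
rewrite -scaler_suml scalerA; congr (_ *: _).
have -> : \sum_(t < m) z ^ (k * t%:Z) = \sum_(t < m) (z ^ k) ^+ t.
  by apply: eq_bigr => t _; rewrite exprnP exprz_exp.
have [->|zk] := eqVneq (z ^ k) 1.
  by under eq_bigr do rewrite expr1n; rewrite sumr_const card_ord mulVf.
have : (z ^ k - 1) * (\sum_(t < m) (z ^ k) ^+ t) = 0.
  by rewrite -subrX1 exprnP exprz_exp mulrC -exprz_exp -exprnP zm exp1rz subrr.
move/eqP; rewrite mulf_eq0 subr_eq0 (negbTE zk) => /eqP->.
by rewrite mulr0.
Qed.

End Rotation.

(** * The loop module *)

Section LoopVectors.
Variables (K : fieldType) (V : lmodType K).
Implicit Types (f g : loop V) (t u : int) (w : V).

Lemma loopP f g : (forall t, f t = g t) -> f = g.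
Proof. by move=> fg; apply: val_inj; apply/funext. Qed.

Lemma loop_add f g t : (f + g) t = f t + g t. Proof. by []. Qed.
Lemma loop_scale (c : K) f t : (c *: f) t = c *: f t. Proof. by []. Qed.

Lemma loop_sum (I : Type) (s : seq I) (P : pred I) (F : I -> loop V) t :
  (\sum_(i <- s | P i) F i) t = \sum_(i <- s | P i) F i t.
Proof. by apply: (big_morph (fun f : loop V => f t)). Qed.

Lemma lpureE w t u : lpure w t u = if u == t then w else 0. Proof. by []. Qed.

Lemma lpure_linear (c : K) w w' t : lpure (c *: w + w') t = c *: lpure w t + lpure w' t.
Proof.
apply: loopP => u; rewrite loop_add loop_scale !lpureE.
by case: ifP; rewrite ?scaler0 ?addr0.
Qed.

Lemma lpure0 t : lpure (0 : V) t = 0.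
Proof. by apply: loopP => u; rewrite lpureE if_same. Qed.

Lemma lpureD w w' t : lpure (w + w') t = lpure w t + lpure w' t.
Proof. by have := lpure_linear 1 w w' t; rewrite !scale1r. Qed.

Lemma lpureZ (c : K) w t : lpure (c *: w) t = c *: lpure w t.
Proof. by have := lpure_linear c w 0 t; rewrite lpure0 !addr0. Qed.

Lemma loop_decomp f : exists2 s : seq int, uniq s & f = \sum_(t <- s) lpure (f t) t.
Proof.
have /asboolP/finite_seqP[s0 sE] := loop_valP f.
exists (undup s0); first exact: undup_uniq.
apply: loopP => u; rewrite loop_sum.
have [us|us] := boolP (u \in undup s0).
  rewrite (bigD1_seq u) ?undup_uniq // lpureE eqxx big1 => [|t tu]; first by rewrite -[LHS]addr0.
  by rewrite lpureE eq_sym (negbTE tu).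
rewrite big_seq big1 => [|t ts].
  apply/eqP; apply: contraNT us => fu; rewrite mem_undup.
  by have : [set r | f r != 0]%classic u by []; rewrite sE.
by rewrite lpureE; case: eqP us => // ->; rewrite ts.
Qed.

End LoopVectors.

Section LoopModule.
Variables (K : fieldType) (q : K) (n m : nat) (b : 'I_m -> K) (z : K).
Hypothesis char0 : forall r, r.+1%:R != 0 :> K.
Hypotheses (q0 : q != 0) (qroot : forall k, q ^+ k.+1 != 1).
Hypotheses (b0 : forall j, b j != 0) (bI : injective b).
Hypothesis bq : forall j l, q * b j - q^-1 * b l != 0.
Hypotheses (z0 : z != 0) (zb : forall j, b (ordS j) = z * b j) (zm : z ^+ m = 1).
Hypotheses (n0 : (0 < n)%N) (mp : (0 < m)%N).
Variables (V : vectType K) (rho : rep (Uq q n) V) (v : V).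
Variables (phi : {ffun config n m -> K^o} -> V) (phiP : model_iso b rho v phi).
Variables (L : rep (Uqe q n) (loop V)) (hL : is_loop rho L).
Let qq0 := q_subV_neq0 q0 qroot.
Let m0 : m%:R != 0 :> K. Proof. by case: m mp => // p _; exact: char0. Qed.

Lemma L_homogeneous k (a : Uq q n) (f : loop V) t :
  uq_deg k a -> L (a : Uqe q n) f t = rho a (f (t - k)).
Proof.
move=> ka; have [s us fE] := loop_decomp f.
rewrite {1}fE rep_sumr loop_sum.
rewrite (eq_bigr (fun u => rho a (lpure (f u) u (t - k)))).
  by rewrite -rep_sumr -loop_sum -fE.
move=> u _; rewrite (proj1 hL k a ka) !lpureE subr_eq.
by case: eqP => _ //; rewrite rep0r.
Qed.

Lemma L_D (f : loop V) t : L (ugen q (gD true)) f t = q ^ t *: f t.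
Proof.
have [s us fE] := loop_decomp f.
rewrite {1}fE rep_sumr loop_sum.
rewrite (eq_bigr (fun u => q ^ t *: lpure (f u) u t)).
  by rewrite -scaler_sumr -loop_sum -fE.
move=> u _; rewrite (proj2 hL) loop_scale !lpureE.
by case: eqP => [->|_] //; rewrite !scaler0.
Qed.

Lemma L_Dinv (f : loop V) t : L (ugen q (gD false)) f t = q ^ (- t) *: f t.
Proof.
have e : L (ugen q (gD true)) (L (ugen q (gD false)) f) t = f t.
  by rewrite -actM Uqe_DDi act1.
move: e; rewrite L_D => <-; rewrite scalerA -expfzDr // addNr expr0z scale1r.
by [].
Qed.

Lemma lpure_homogeneous k (a : Uq q n) w t : uq_deg k a ->
  L (a : Uqe q n) (lpure w (t - k)) = lpure (rho a w) t.
Proof. by move=> ka; rewrite (proj1 hL k a ka) subrK. Qed.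

(** An element of degree [k] changes the twist by [k], so the loops whose component
   of degree [t] has twist [t - s] are stable under all generators. *)
Lemma Lsub_twisted s f : Lsub L v s f ->
  forall t, exists2 x, twisted z (t - s) x & f t = phi x.
Proof.
case=> a ->.
pose N (f : loop V) := forall t, exists2 x, twisted z (t - s) x & f t = phi x.
have tD k x y : twisted z k x -> twisted z k y -> twisted z k (x + y).
  by rewrite /twisted => tx ty; rewrite rotf_add tx ty scalerDr.
have tZ k (c : K) x : twisted z k x -> twisted z k (c *: x).
  by rewrite /twisted => tx; rewrite rotf_scale tx !scalerA mulrC.
apply: (@uqe_stable _ _ _ _ L N).
- move=> f1 f2 h1 h2 t; have [x1 t1 e1] := h1 t; have [x2 t2 e2] := h2 t.
  exists (x1 + x2); first exact: tD.
  by rewrite loop_add e1 e2; have := iso_linear phiP 1 x1 x2; rewrite !scale1r.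
- move=> c f1 h1 t; have [x1 t1 e1] := h1 t.
  by exists (c *: x1); [exact: tZ | rewrite loop_scale e1 (iso_scale phiP)].
- case=> [e i r|i r|e i|e] f1 h1 t.
  + have [x tx ex] := h1 (t - r); exists (xop q b e i r x).
      by rewrite (_ : t - s = t - r - s + r); [exact: twisted_xop | lia].
    by rewrite (iso_x phiP) -ex -(L_homogeneous _ _ (deg_x q e i r)).
  + have [x tx ex] := h1 (t - val r); exists (diag_op (Hval q b i (val r)) x).
      by rewrite (_ : t - s = t - val r - s + val r); [exact: twisted_h | lia].
    rewrite (iso_h phiP) -ex -(L_homogeneous _ _ (deg_h q i (val r))) uq_hE.
    by rewrite htot_val.
  + have [x tx ex] := h1 t; exists (diag_op (Kval q e i) x); first exact: twisted_K.
    rewrite (iso_K phiP) -ex; have := L_homogeneous f1 t (deg_K q e i).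
    by rewrite subr0.
  + have [x tx ex] := h1 t; exists (q ^ (if e then t else - t) *: x); first exact: tZ.
    by rewrite (iso_scale phiP) -ex; case: e; [exact: L_D | exact: L_Dinv].
move=> t; rewrite lpureE; case: eqP => [->|_].
  exists (delta_fun K (top_config n m)); last by rewrite (iso_top phiP).
  by rewrite subrr; exact: twisted_top.
exists 0; last by rewrite (iso0 phiP).
by rewrite /twisted scaler0; apply/ffunP => c; rewrite !ffunE.
Qed.

Lemma Lsub_act s a f : Lsub L v s f -> Lsub L v s (L a f).
Proof. by case=> c ->; exists (a * c); rewrite actM. Qed.

Lemma Lsub_add s f g : Lsub L v s f -> Lsub L v s g -> Lsub L v s (f + g).
Proof. by case=> a -> [c ->]; exists (a + c); rewrite actDl. Qed.

Lemma Lsub_scale s c f : Lsub L v s f -> Lsub L v s (c *: f).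
Proof. by case=> a ->; exists (c *: a); rewrite actZl. Qed.

Lemma Lsub0 s : Lsub L v s 0.
Proof. by exists 0; rewrite rep0l. Qed.

(** If [k = t - s] is nonzero and [z^k = 1] then [h_{0,k}] acts on [v] by a
   nonzero scalar, a multiple of [sum_j b_j^k = m b_0^k]. It carries
   [v (x) t^s] to a multiple of [v (x) t^t], so [L^s] is invariant under shifts by
   multiples of [m]. *)
Lemma Lsub_top s t : z ^ (t - s) = 1 -> Lsub L v s (lpure v t).
Proof.
set k := t - s => zk; have [k0|k0] := eqVneq k 0.
  exists 1; rewrite act1; congr lpure.
  by apply/eqP; rewrite -subr_eq0 -/k k0.
pose i := Ordinal n0; pose j0 := Ordinal mp.
have H0 : Hval q b i k (top_config n m) != 0.
  have bk j : b j ^ k = b j0 ^ k.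
    have it u : b (iter u (@ordS m) j0) ^ k = b j0 ^ k.
      by elim: u => //= u IHu; rewrite zb expfzMl zk mul1r.
    rewrite -(it j); congr (b _ ^ k); apply: val_inj.
    by rewrite /= val_iter_ordS add0n modn_small.
  rewrite /Hval (eq_bigr (fun=> hval q i k ord0 * b j0 ^ k)); last first.
    by move=> j _; rewrite ffunE /beta expr0 mulr1 bk.
  rewrite sumr_const card_ord -[_ *+ m]mulr_natr mulf_neq0 // mulf_neq0 ?expfz_neq0 //.
  rewrite /hval (_ : eps i ord0 = 1); last by rewrite /eps -!val_eqE.
  rewrite mulf_neq0 ?invr_eq0 //.
    by rewrite subr_eq0 eq_sym q_expz_neq1 // mulr1 oppr_eq0 mulf_neq0.
  rewrite mulf_neq0 //; case: (k) k0 => [[|p]|p] // _.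
    by rewrite -pmulrn; exact: char0.
  by rewrite NegzE mulrNz oppr_eq0 -pmulrn; exact: char0.
have -> : lpure v t = (Hval q b i k (top_config n m))^-1 *: L (uq_h q i k : Uqe q n) (lpure v s).
  have := lpure_homogeneous v t (deg_h q i k).
  rewrite (_ : t - k = s); last by rewrite /k; lia.
  move=> ->; rewrite -(iso_top phiP) -(iso_h phiP) diag_op_top (iso_scale phiP) lpureZ.
  by rewrite scalerA mulVf // scale1r.
by apply/Lsub_scale/Lsub_act; exists 1; rewrite act1.
Qed.

(** Projections commute with the operators up to a shift of the twist, so the
   functions all of whose projections give elements of [L^s] form a submodule of
   the model. It contains the top function. *)
Lemma twisted_Lsub s t x : twisted z (t - s) x -> Lsub L v s (lpure (phi x) t).
Proof.
move=> /(proj_id q0 z0 m0) <-; move: t.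
apply: (model_gen q0 qq0 bI bq
  (P := fun x => forall t, Lsub L v s (lpure (phi (proj z (t - s) x)) t))).
- move=> x1 x2 h1 h2 t.
  have -> : proj z (t - s) (x1 + x2) = proj z (t - s) x1 + proj z (t - s) x2.
    by have := proj_linear z (t - s) 1 x1 x2; rewrite !scale1r.
  have := iso_linear phiP 1 (proj z (t - s) x1) (proj z (t - s) x2); rewrite !scale1r => ->.
  by rewrite lpureD; exact: Lsub_add.
- move=> c x1 h1 t.
  have -> : proj z (t - s) (c *: x1) = c *: proj z (t - s) x1.
    apply/ffunP => c'; have := proj_linear z (t - s) c x1 0; rewrite addr0 => ->.
    have -> : proj z (t - s) (0 : {ffun config n m -> K^o}) = 0; last by rewrite addr0.
    have := proj_linear z (t - s) (-1) (0 : {ffun config n m -> K^o}) 0.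
    by rewrite scaler0 addr0 scaleN1r addNr.
  by rewrite (iso_scale phiP) lpureZ; exact: Lsub_scale.
- move=> d i r x1 h1 t.
  have -> : proj z (t - s) (xop q b d i r x1) = xop q b d i r (proj z (t - r - s) x1).
    by rewrite (xop_proj q0 z0 zb m0); congr proj; lia.
  rewrite (iso_x phiP) -(lpure_homogeneous _ _ (deg_x q d i r)).
  exact: Lsub_act.
- move=> t; rewrite (proj_top _ m0 zm).
  case: eqP => [zk|_]; last by rewrite scale0r (iso0 phiP) lpure0; exact: Lsub0.
  by rewrite scale1r (iso_top phiP); exact: Lsub_top.
Qed.

(** A weight vector of [D] is concentrated in one degree, and the model reads off
   both its twist and its weight. *)
Lemma Lwt_model nu r s f :
  (Lsub L v s f /\ Lwt L nu r f) <->
  exists2 x : {ffun config n m -> K^o}, f = lpure (phi x) r &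
    twisted z (r - s) x /\ (forall c, x c != 0 -> forall i, wt i c = nu i).
Proof.
have Kf f' i t : L (ugen q (gK true i)) f' t = rho (uq_K q true i) (f' t).
  by have := L_homogeneous f' t (deg_K q true i); rewrite subr0.
have KP (x : {ffun config n m -> K^o}) i : (forall c, x c != 0 -> wt i c = nu i) <->
    rho (uq_K q true i) (phi x) = q ^ nu i *: phi x.
  rewrite -(iso_K phiP) -(iso_scale phiP); split=> [h|/(iso_inj phiP)/ffunP h c xc].
    congr phi; apply/ffunP => c; rewrite !ffunE /GRing.scale /= /Kval /=.
    by have [->|/h->] := eqVneq (x c) 0; rewrite ?mulr0.
  have := h c; rewrite !ffunE /GRing.scale /= /Kval /= => /(mulIf xc).
  exact: (q_expz_inj q0 qroot).
split=> [[Lf [wK wD]]|[x -> [tx wx]]].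
  have f0 t : t != r -> f t = 0.
    move=> tr; have /(congr1 (fun g : loop V => g t)) := wD; rewrite L_D loop_scale.
    move/eqP; rewrite -subr_eq0 -scalerBl scaler_eq0 subr_eq0 => /predU1P[|/eqP//].
    by move=> /(q_expz_inj q0 qroot) e; rewrite e eqxx in tr.
  have [x tx fx] := Lsub_twisted Lf r; exists x.
    by apply: loopP => t; rewrite lpureE; case: eqP => [->//|/eqP/f0].
  split=> // c xc i; move: c xc; apply/KP.
  by have /(congr1 (fun g : loop V => g r)) := wK i; rewrite Kf loop_scale fx.
split; first exact: twisted_Lsub.
split=> [i|]; apply: loopP => t.
  rewrite Kf loop_scale lpureE; case: ifP => _; last by rewrite rep0r scaler0.
  by apply/KP => c xc; exact: wx.
by rewrite L_D loop_scale lpureE; case: eqP => [->|_] //; rewrite !scaler0.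
Qed.

End LoopModule.

(** * Orbits of a cyclic action *)

Section CyclicAction.
Variables (X : finType) (f : X -> X) (m : nat).
Hypotheses (fI : injective f) (m0 : (0 < m)%N) (fm : forall x, iter m f x = x).
Implicit Types (x y o : X).

(** An iterate fixes [x] only if the remainder modulo the orbit size is [0]. *)
Lemma iter_eq_order x t : (iter t f x == x) = (order f x %| t)%N.
Proof.
have op := order_gt0 f x.
have iterq a : iter (a * order f x) f x = x.
  by elim: a => [|a IHa]; rewrite ?mul0n // mulSn iterD IHa iter_order.
rewrite {1}(divn_eq t (order f x)) addnC iterD iterq /dvdn.
have lt : (t %% order f x < order f x)%N by rewrite ltn_mod.
by rewrite eq_sym -(findex_eq0 f) findex_iter.
Qed.

Lemma order_dvd x : (order f x %| m)%N.
Proof. by rewrite -iter_eq_order fm. Qed.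

Lemma order_connect x y : fconnect f x y -> order f x = order f y.
Proof.
move=> xy; apply: eq_card => u.
by rewrite !inE /= (same_connect (fconnect_sym fI) xy).
Qed.

Lemma froot_connect x : fconnect f (froot f x) x.
Proof. by rewrite fconnect_sym // connect_root. Qed.

(** Both sides are computed from the sum over [x] of the divisor sums of [phi_k]
   up to the order [m / order x] of the stabiliser of [x]. Summing first over [x]
   gives fixed points; grouping by orbits, [sum_phi_k] leaves the orbits on whose
   stabilisers the [k]-th power of the character is trivial. *)
Lemma sum_orbits (S : {set X}) (k : int) :
  (forall x, (f x \in S) = (x \in S)) ->
  (#|[set x in S | (froot f x == x) && (m %/ order f x %| `|k|)%N]|)%:R =
  m%:R^-1 * \sum_(d <- divisors m) phi_k k d *
     #|[set x in S | iter (m %/ d) f x == x]|%:R :> rat.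
Proof.
move=> Sf; set R := [set x in S | _ && _].
have iterS t x : (iter t f x \in S) = (x \in S) by elim: t => //= t; rewrite Sf.
have conS x y : fconnect f x y -> (y \in S) = (x \in S).
  by move=> /iter_findex <-; rewrite iterS.
have mq : m%:R != 0 :> rat by rewrite pnatr_eq0 -lt0n.
apply: (mulfI mq); rewrite mulrA mulfV // mul1r.
transitivity (\sum_(x in S) \sum_(d <- divisors (m %/ order f x)) phi_k k d); last first.
  have fixE d : #|[set x in S | iter (m %/ d) f x == x]|%:R =
      \sum_(x in S) (iter (m %/ d) f x == x)%:R :> rat.
    by rewrite -natr_sum -sum1dep_card big_mkcondr.
  under [RHS]eq_bigr do rewrite fixE mulr_sumr.
  rewrite exchange_big /=; apply: eq_bigr => x _.
  rewrite [RHS](eq_big_seq (fun d => if (d %| m %/ order f x)%N then phi_k k d else 0)).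
    rewrite -big_mkcond -[RHS]big_filter; apply: perm_big; apply: uniq_perm.
    - exact: divisors_uniq.
    - exact/filter_uniq/divisors_uniq.
    move=> d; rewrite mem_filter -!dvdn_divisors //; last first.
      by rewrite divn_gt0 ?order_gt0 // dvdn_leq // order_dvd.
    case: (boolP (d %| m %/ _)%N) => // /dvdn_trans -> //.
    by rewrite -{2}(divnK (order_dvd x)) dvdn_mulr.
  move=> d; rewrite -dvdn_divisors // => dm.
  have d0 : (0 < d)%N by exact: dvdn_gt0 dm.
  rewrite iter_eq_order.
  have -> : (order f x %| m %/ d)%N = (d %| m %/ order f x)%N.
    rewrite -(@dvdn_pmul2r d) // divnK // -[RHS](@dvdn_pmul2r (order f x)) ?order_gt0 //.
    by rewrite divnK ?order_dvd // mulnC.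
  by case: ifP; rewrite ?mulr1 ?mulr0.
rewrite (partition_big (froot f) (fun o => (o \in S) && (froot f o == o))) /=; last first.
  move=> x xS; rewrite -(conS _ _ (froot_connect x)) xS /=.
  by rewrite (root_root (fconnect_sym fI)).
rewrite -sum1dep_card natr_sum mulr_sumr.
rewrite [LHS](eq_bigl (fun o => ((o \in S) && (froot f o == o)) && (m %/ order f o %| `|k|)%N)).
  rewrite [LHS]big_mkcondr /=; apply: eq_bigr => o /andP[oS /eqP oR].
  have orb x : (x \in S) && (froot f x == o) = fconnect f o x.
    rewrite -{1}oR (root_connect (fconnect_sym fI)) fconnect_sym //.
    by case: (boolP (fconnect f o x)) => [/conS->|]; rewrite ?oS ?andbF.
  rewrite (eq_bigl _ _ orb) (eq_bigr (fun=> if (m %/ order f o %| `|k|)%N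
     then (m %/ order f o)%:R else 0)); last first.
    move=> x ox; rewrite (order_connect ox) sum_phi_k // divn_gt0 ?order_gt0 //.
    by rewrite dvdn_leq // order_dvd.
  rewrite sumr_const -[#|_|]/(order f o); case: ifP => _; last by rewrite mul0rn.
  by rewrite -mulrnA divnK ?order_dvd // mulr1.
by move=> o; rewrite andbA.
Qed.

Section Equivariant.
Variables (K : fieldType) (z : K).
Hypotheses (char0 : forall r, r.+1%:R != 0 :> K) (zprim : m.-primitive_root z).
Variables (S : {set X}) (Sf : forall x, (f x \in S) = (x \in S)) (k : int).

Definition equivariant (u : X -> K) :=
  (forall x, u (f x) = z ^ (- k) * u x) /\ (forall x, u x != 0 -> x \in S).

Let z0 : z != 0.
Proof. by apply: contraTneq m0 => z0; have := prim_expr_order zprim; rewrite z0 expr0n; case: m => // p /eqP; rewrite eq_sym oner_eq0. Qed.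

Let R := [set x in S | (froot f x == x) && (m %/ order f x %| `|k|)%N].

Lemma expz_eq1 (a : int) : (z ^ a == 1) = (m %| `|a|)%N.
Proof.
case: a => a; first by rewrite /= -exprnP (prim_order_dvd zprim).
by rewrite NegzE -exprnN invr_eq1 (prim_order_dvd zprim) abszN.
Qed.

Lemma order_root x : (z ^ (k * (order f x)%:Z) == 1) = (m %/ order f x %| `|k|)%N.
Proof.
by rewrite expz_eq1 abszM /= -{1}(divnK (order_dvd x)) dvdn_pmul2r //.
Qed.

(** Up to a scalar, the projection of the indicator function of [o] onto the
   functions with [u (f x) = z^-k u x]. *)
Definition orbit_fun o x : K := \sum_(t < m) z ^ (k * t%:Z) * (iter t f x == o)%:R.

Lemma orbit_fun_shift o x : orbit_fun o (f x) = z ^ (- k) * orbit_fun o x.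
Proof.
(* The summand is periodic in [t] with period [m]. *)
pose F (t : nat) := z ^ (- k) * (z ^ (k * t%:Z) * (iter t f x == o)%:R).
have zk : z ^ (k * m%:Z) = 1.
  by rewrite mulrC -exprz_exp -exprnP (prim_expr_order zprim) exp1rz.
have F0m : F m = F 0%N by rewrite /F fm zk mulr0 expr0z.
transitivity (\sum_(0 <= t < m) F t.+1).
  rewrite big_mkord; apply: eq_bigr => t _; rewrite /F -iterSr mulrA -expfzDr //.
  by congr (z ^ _ * _); lia.
rewrite mulr_sumr -(big_mkord xpredT F).
by apply: (addrI (F 0%N)); rewrite -big_nat_recl // big_nat_recr //= F0m addrC.
Qed.

Lemma orbit_fun_connect o x : orbit_fun o x != 0 -> fconnect f x o.
Proof.
apply: contraNT => nc; rewrite /orbit_fun big1 // => t _.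
by case: eqP => [e|]; rewrite ?mulr0 //; move: nc; rewrite -e fconnect_iter.
Qed.

(** Each element of the stabiliser contributes [1]. *)
Lemma orbit_fun_diag o : o \in R -> orbit_fun o o != 0.
Proof.
rewrite inE => /and3P[_ _]; rewrite -order_root => /eqP zo.
have -> : orbit_fun o o = (\sum_(t < m) (iter t f o == o))%:R.
  rewrite natr_sum; apply: eq_bigr => t _; rewrite iter_eq_order.
  case: (boolP (_ %| _)%N) => [/dvdnP[a ->]|]; last by rewrite mulr0.
  by rewrite mulr1 mulnC PoszM mulrA -exprz_exp zo exp1rz.
have : (0 < \sum_(t < m) (iter t f o == o))%N.
  by rewrite (bigD1 (Ordinal m0)) //= eqxx.
by case: (\sum_(t < m) _)%N => // p _; exact: char0.
Qed.

Lemma orbit_fun_equivariant o : o \in R -> equivariant (orbit_fun o).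
Proof.
move=> oR; split; first exact: orbit_fun_shift.
move=> x /orbit_fun_connect/iter_findex e.
have iterS t y : (iter t f y \in S) = (y \in S) by elim: t => //= t; rewrite Sf.
by rewrite -(iterS (findex f x o)) e; move: oR; rewrite inE => /andP[].
Qed.

Lemma orbit_fun_off o o' : o \in R -> o' \in R -> o != o' -> orbit_fun o o' = 0.
Proof.
rewrite !inE => /and3P[_ /eqP oo _] /and3P[_ /eqP oo' _] ne.
apply: contraNeq ne => /orbit_fun_connect.
by rewrite -(root_connect (fconnect_sym fI)) oo oo' eq_sym.
Qed.

Lemma equivariant_iter u t x : equivariant u -> u (iter t f x) = z ^ (- (k * t%:Z)) * u x.
Proof.
move=> [uf _]; elim: t => [|t IHt]; first by rewrite mulr0 oppr0 expr0z mul1r.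
by rewrite /= uf IHt mulrA -expfzDr //; congr (z ^ _ * _); lia.
Qed.

(** Going once around the orbit of [o] multiplies [u o] by a scalar other than
   [1]. *)
Lemma equivariant_root u o : equivariant u -> froot f o = o -> o \notin R -> u o = 0.
Proof.
move=> ue oR; apply: contraNeq => uo; rewrite inE (proj2 ue _ uo) oR eqxx -order_root.
have /eqP := equivariant_iter (order f o) o ue; rewrite iter_order //.
rewrite -{1}[u o]mul1r (inj_eq (mulIf uo)) eq_sym.
by rewrite -invr_expz invr_eq1.
Qed.

(** Both sides are equivariant, so they need only be compared on one element of
   each orbit. *)
Lemma orbit_fun_span u : equivariant u ->
  forall x, u x = \sum_(o in R) (u o / orbit_fun o o) * orbit_fun o x.
Proof.
move=> ue x; pose w y := \sum_(o in R) u o / orbit_fun o o * orbit_fun o y.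
rewrite -[RHS]/(w x).
have wit t y : w (iter t f y) = z ^ (- (k * t%:Z)) * w y.
  rewrite /w mulr_sumr; apply: eq_bigr => o oR.
  by rewrite (equivariant_iter _ _ (orbit_fun_equivariant oR)) mulrCA.
have rr : froot f (froot f x) = froot f x by exact: (root_root (fconnect_sym fI)).
rewrite -(iter_findex (froot_connect x)) (equivariant_iter _ _ ue) wit; congr (_ * _).
move: (froot f x) rr => o rr; have [oR|oR] := boolP (o \in R).
  rewrite /w (bigD1 o) //= divfK ?orbit_fun_diag // big1 ?addr0 // => o' /andP[o'R ne].
  by rewrite (orbit_fun_off o'R oR ne) mulr0.
rewrite (equivariant_root ue rr oR); apply/esym; rewrite /w big1 // => o' o'R.
by rewrite (equivariant_root (orbit_fun_equivariant o'R) rr oR) mulr0.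
Qed.

Lemma orbit_fun_free (a : X -> K) :
  (forall x, \sum_(o in R) a o * orbit_fun o x = 0) -> forall o, o \in R -> a o = 0.
Proof.
move=> h o oR; have := h o; rewrite (bigD1 o) //= big1 ?addr0 => [/eqP|o' /andP[o'R ne]].
  by rewrite mulf_eq0 (negbTE (orbit_fun_diag oR)) orbF => /eqP.
by rewrite (orbit_fun_off o'R oR ne) mulr0.
Qed.

End Equivariant.
End CyclicAction.

(** * Periodic configurations *)

Section Periodic.
Variables (n m d : nat).
Hypotheses (m0 : (0 < m)%N) (dm : (d %| m)%N).
Let p := (m %/ d)%N.
Let d0 : (0 < d)%N. Proof. exact: dvdn_gt0 dm. Qed.
Let p0 : (0 < p)%N. Proof. by rewrite divn_gt0 // dvdn_leq. Qed.
Let mE : m = (d * p)%N. Proof. by rewrite mulnC divnK. Qed.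

Let res (a : nat) : 'I_p := Ordinal (ltn_pmod a p0).

Definition periodic_extension (c : config n p) : config n m := [ffun j : 'I_m => c (res j)].

Lemma wt_periodic i c : wt i (periodic_extension c) = d%:Z * wt i c.
Proof.
have resE a u : res (a + u * p) = res a.
  by apply: val_inj; rewrite /= addnC modnMDl.
have H u : \sum_(0 <= j < u * p) eps i (c (res j)) = u%:Z * wt i c.
  elim: u => [|u IHu]; first by rewrite big_geq // mul0r.
  rewrite mulSnr (@big_cat_nat _ _ _ (u * p)) ?leq_addr //= IHu.
  rewrite -{1}[(u * p)%N]add0n big_addn addKn big_mkord.
  rewrite (eq_bigr (fun j : 'I_p => eps i (c j))) => [|j _].
    by rewrite (intS u) mulrDl mul1r addrC.
  by rewrite resE; congr (eps i (c _)); apply: val_inj; rewrite /= modn_small.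
rewrite -H -mE big_mkord; apply: eq_bigr => j _; by rewrite ffunE.
Qed.

Lemma periodic_extension_inj : injective periodic_extension.
Proof.
move=> c c' /ffunP e; apply/ffunP => l.
have lm : (l < m)%N by apply: leq_trans (ltn_ord l) _; exact: leq_div.
have := e (Ordinal lm); rewrite !ffunE /=.
by have -> : res l = l by apply: val_inj; rewrite /= modn_small.
Qed.

Lemma periodic_fixed c :
  (iter p (@rot_config n m) c == c) = (c \in codom periodic_extension).
Proof.
apply/eqP/codomP => [fc|[c' ->]]; last first.
  apply/ffunP => j; rewrite iter_rot !ffunE; congr (c' _); apply: val_inj => /=.
  by rewrite val_iter_ordS modn_dvdm ?modnDr // mE dvdn_mull.
have pm : (p <= m)%N by exact: leq_div.
exists [ffun l : 'I_p => c (widen_ord pm l)]; apply/ffunP => j; rewrite !ffunE.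
have fct t : iter (t * p) (@rot_config n m) c = c.
  by elim: t => // t IHt; rewrite mulSn iterD IHt.
rewrite -[in RHS](fct (j %/ p)%N) iter_rot; congr (c _); apply: val_inj.
by rewrite /= val_iter_ordS /= addnC -divn_eq modn_small.
Qed.

(** The configurations fixed by the rotation by [m / d] steps are the periodic ones
   and consist of [d] copies of one period, so the weight of a period is that of
   the configuration divided by [d]. *)
Lemma card_fixed (nu : 'I_n -> int) :
  #|[set c in [set c : config n m | [forall i, wt i c == nu i]]
      | iter p (@rot_config n m) c == c]| =
  #|[set c : config n p | [forall i, (wt i c)%:~R == (nu i)%:~R / d%:R :> rat]]|.
Proof.
rewrite -(card_imset _ periodic_extension_inj); apply: eq_card => c.
have wtP c' i : (wt i (periodic_extension c') == nu i) =
    ((wt i c')%:~R == (nu i)%:~R / d%:R :> rat).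
  have dq : d%:R != 0 :> rat by rewrite pnatr_eq0 -lt0n.
  rewrite wt_periodic -(inj_eq (mulIf dq)) divfK // -(eqr_int rat).
  by rewrite intrM mulrC.
rewrite !inE periodic_fixed; apply/andP/imsetP => [[wc /codomP[c' e]]|[c' wc ->]].
  exists c' => //; rewrite inE; move: wc; rewrite e => /forallP h.
  by apply/forallP => i; rewrite -wtP.
split; last exact: codom_f.
by move: wc; rewrite inE => /forallP h; apply/forallP => i; rewrite wtP.
Qed.

End Periodic.

(** * Coefficient field and spectral parameters *)

Section CoefficientField.
Variable R : realType.
Local Notation K := (Cq R).

Lemma Cq_char0 r : r.+1%:R != 0 :> K.
Proof.
rewrite -(rmorph_nat (@tofrac {poly R[i]})) tofrac_eq0 -polyC_natr polyC_eq0.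
by rewrite pnatr_eq0.
Qed.

Lemma qvar_neq0 : qvar R != 0.
Proof. by rewrite /qvar tofrac_eq0 polyX_eq0. Qed.

Lemma qvar_root k : qvar R ^+ k.+1 != 1.
Proof.
rewrite /qvar -tofracXn -tofrac1 tofrac_eq; apply/eqP => /(congr1 (fun p : {poly R[i]} => size p)).
by rewrite size_polyXn size_poly1.
Qed.

Lemma Cq_const_root m (zeta : R[i]) :
  m.-primitive_root zeta -> m.-primitive_root (Cq_const zeta).
Proof.
pose f : {rmorphism R[i] -> K} := (@tofrac {poly R[i]} \o @polyC R[i]).
by rewrite -[Cq_const zeta]/(f zeta) fmorph_primitive_root.
Qed.

Section Generic.
Variables (m : nat) (z : K) (m0 : (0 < m)%N) (zm : m.-primitive_root z).

(** If [q b_j = q^-1 b_l], the [m]-th power gives [q^(2 m) = 1]. *)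
Lemma roots_generic (I : Type) (b : I -> K) : (forall j, b j ^+ m = 1) ->
  (forall j, b j != 0) /\ (forall j l, qvar R * b j - (qvar R)^-1 * b l != 0).
Proof.
move=> bm; have b0 j : b j != 0.
  by apply: contra_eqT (bm j) => /negPn/eqP->; rewrite expr0n (gtn_eqF m0) eq_sym oner_eq0.
split=> [|j l]; first exact: b0.
rewrite subr_eq0; apply/eqP => e; have := qvar_root (2 * m).-1.
rewrite prednK ?muln_gt0 ?m0 // exprM => /negP; apply.
have e2 : qvar R ^+ 2 * b j = b l.
  by rewrite expr2 -mulrA e mulrA mulfV ?qvar_neq0 // mul1r.
by have := bm l; rewrite -e2 exprMn bm mulr1 => ->; rewrite eqxx.
Qed.

Let z0 : z != 0.
Proof. by have [h _] := @roots_generic unit (fun=> z) (fun=> prim_expr_order zm); exact: (h tt). Qed.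

Definition full_param (j : 'I_m) : K := z ^ (j%:Z - 1).
Definition root_param d (j : 'I_(m %/ d)) : K := z ^+ (j * d).

Lemma full_paramE j : full_param j = z ^+ j * z^-1.
Proof. by rewrite /full_param expfzDr // exprN1. Qed.

Lemma full_param_m j : full_param j ^+ m = 1.
Proof.
rewrite full_paramE exprMn -exprM mulnC exprM (prim_expr_order zm) expr1n mul1r.
by rewrite exprVn (prim_expr_order zm) invr1.
Qed.

Lemma full_param_inj : injective full_param.
Proof.
move=> j l; rewrite !full_paramE => /(mulIf (invr_neq0 z0))/eqP.
by rewrite (eq_prim_root_expr zm) !modn_small ?ltn_ord // => /eqP/val_inj.
Qed.

Lemma full_param_shift j : full_param (ordS j) = z * full_param j.
Proof. by rewrite !full_paramE /= (prim_expr_mod zm) exprS mulrA. Qed.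

Lemma root_param_m d j : @root_param d j ^+ m = 1.
Proof. by rewrite /root_param -exprM mulnC exprM (prim_expr_order zm) expr1n. Qed.

Lemma root_param_inj d : (d %| m)%N -> injective (@root_param d).
Proof.
move=> dm j l /eqP; rewrite /root_param (eq_prim_root_expr zm).
have d0 : (0 < d)%N by exact: dvdn_gt0 dm.
have lt (a : 'I_(m %/ d)) : (a * d < m)%N by rewrite -{2}(divnK dm) ltn_pmul2r.
by rewrite !modn_small ?lt // eqn_pmul2r // => /eqP/val_inj.
Qed.

End Generic.

Lemma pi_fullE n m (z : K) : @pi_full K n m z = @drinfeld K n m (@full_param m z).
Proof. by []. Qed.

Lemma pi_rootE n m (z : K) d : @pi_root K n m z d = @drinfeld K n (m %/ d) (@root_param m z d).
Proof.
apply/funext => i; rewrite /pi_root /drinfeld /pi0; case: ifP => _.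
  by apply: eq_bigr => j _; rewrite rmorphB /= comp_polyX rmorph1.
by rewrite big1 // => j _; rewrite rmorph1.
Qed.

Lemma pi0E n : pi0 K n = @drinfeld K n 1 (fun=> 1).
Proof. by apply/funext => i; rewrite /pi0 /drinfeld big_ord1 scale1r. Qed.

End CoefficientField.

(** * The weight multiplicities *)

Theorem proposition5p7 (R : realType) (n m : nat) (zeta : R[i])
    (hn : (0 < n)%N) (hm : (0 < m)%N) (hzeta : m.-primitive_root zeta)
    (* V(pi) *)
    (V : vectType (Cq R)) (rho : rep (Uq (qvar R) n) V) (v : V)
    (hV : is_V (pi_full m (Cq_const zeta)) rho v)
    (* L(V(pi)) *)
    (L : rep (Uqe (qvar R) n) (loop V)) (hL : is_loop rho L)
    (* V(pi ^ (1/d)) for d | m *)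
    (Vd : nat -> vectType (Cq R)) (rhod : forall d, rep (Uq (qvar R) n) (Vd d))
    (vd : forall d, Vd d)
    (hVd : forall d, (d %| m)%N ->
       is_V (pi_root m (Cq_const zeta) d) (rhod d) (vd d))
    (* V(pi ^ 0) *)
    (V0 : vectType (Cq R)) (rho0 : rep (Uq (qvar R) n) V0) (v0 : V0)
    (hV0 : is_V (pi0 (Cq R) n) rho0 v0)
    (nu : 'I_n -> int) (r : int) (s : nat) (hs : (s < m)%N) :
  exists k : nat,
    [/\ has_dim (fun w => Lsub L v s%:Z w /\ Lwt L nu r w) k,
        k%:R = m%:R^-1 * \sum_(d <- divisors m) phi_k (r - s%:Z) d *
          (\dim (V_wt (rhod d) (fun i => (nu i)%:~R / d%:R)))%:R :> rat
      & m%:R^-1 * \sum_(d <- divisors m) phi_k (r - s%:Z) d *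
          (\dim (V_wt (rhod d) (fun i => (nu i)%:~R / d%:R)))%:R
        = m%:R^-1 * \sum_(d <- divisors m) phi_k (r - s%:Z) d *
          (\dim (tensor_wt rho0 (m %/ d) (fun i => (nu i)%:~R / d%:R)))%:R
          :> rat].
Proof.
set z := Cq_const zeta in hV hVd; have zm : m.-primitive_root z by exact: Cq_const_root.
have char0 := Cq_char0 R; have q0 := qvar_neq0 R; have qroot := @qvar_root R.
set k := r - s%:Z.
pose S := [set c : config n m | [forall i, wt i c == nu i]].
have Sf c : (rot_config c \in S) = (c \in S).
  by rewrite !inE; apply: eq_forallb => i; rewrite rot_wt.
have rI := @rot_config_inj n m; have rm := @iter_rot_m n m.
pose O := [set c in S | (froot (@rot_config n m) c == c) &&
   (m %/ order (@rot_config n m) c %| `|k|)%N].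
have dimd d : (d %| m)%N -> \dim (V_wt (rhod d) (fun i => (nu i)%:~R / d%:R)) =
    #|[set c in S | iter (m %/ d) (@rot_config n m) c == c]|.
  move=> dm; have [b0 bq] := roots_generic hm (@root_param_m R m z zm d).
  have hVd' := hVd d dm; rewrite pi_rootE in hVd'.
  have [phi phiP] := model_unique char0 q0 qroot b0 (root_param_inj hm zm dm) bq hVd'.
  by rewrite (V_wt_dim phiP q0 qroot) card_fixed.
have dim0 d : (d %| m)%N ->
    \dim (tensor_wt rho0 (m %/ d) (fun i => (nu i)%:~R / d%:R)) =
    #|[set c in S | iter (m %/ d) (@rot_config n m) c == c]|.
  move=> dm.
  have [b0 bq] := @roots_generic R m hm 'I_1 (fun=> 1) (fun=> expr1n _ _).
  rewrite pi0E in hV0.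
  have [phi phiP] := model_unique char0 q0 qroot b0 (fun j l _ => etrans (ord1 j) (esym (ord1 l))) bq hV0.
  by rewrite (tensor_wt_dim phiP q0 qroot) card_words card_fixed.
exists #|O|; split; last first.
- congr (_ * _); apply: eq_big_seq => d; rewrite -dvdn_divisors // => dm.
  by rewrite dimd // dim0.
- rewrite (sum_orbits rI hm rm k Sf); congr (_ * _); apply: eq_big_seq => d.
  by rewrite -dvdn_divisors // => dm; rewrite dimd.
have [b0 bq] := roots_generic hm (full_param_m hm zm).
have bI := full_param_inj hm zm; have zb := full_param_shift hm zm.
have z0 : z != 0.
  by have [h _] := @roots_generic R m hm unit (fun=> z) (fun=> prim_expr_order zm); exact: (h tt).
have hV' := hV; rewrite pi_fullE in hV'.
have [phi phiP] := model_unique char0 q0 qroot b0 bI bq hV'.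
have W f := Lwt_model char0 q0 qroot b0 bI bq z0 zb (prim_expr_order zm) hn hm phiP hL nu r s f.
pose E (o : config n m) : {ffun config n m -> (Cq R)^o} :=
  [ffun c => orbit_fun (@rot_config n m) m z k o c].
have phiS (N : nat) (a : 'I_N -> Cq R) (F : 'I_N -> {ffun config n m -> (Cq R)^o}) :
    \sum_i a i *: lpure (phi (F i)) r = lpure (phi (\sum_i a i *: F i)) r.
  rewrite (iso_sum phiP) (big_morph (fun w => lpure w r) (id1 := 0) (op1 := +%R)).
  - by apply: eq_bigr => i _; rewrite (iso_scale phiP) lpureZ.
  - by move=> w w'; exact: lpureD.
  - exact: lpure0.
exists (fun i => lpure (phi (E (enum_val i))) r); split.
- move=> i; apply/W; exists (E (enum_val i)) => //.
  have [sh su] := orbit_fun_equivariant hm rm zm Sf (enum_valP i).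
  split; first by apply/ffunP => c; rewrite !ffunE sh.
  move=> c; rewrite ffunE => /su; rewrite inE => /forallP h i'; exact/eqP.
- move=> a; rewrite phiS => a0 i.
  have e0 : \sum_i a i *: E (enum_val i) = 0.
    apply: (iso_inj phiP); rewrite (iso0 phiP).
    by have /(congr1 (fun f : loop V => f r)) := a0; rewrite lpureE eqxx.
  have iO := enum_valP i.
  rewrite -(enum_valK_in iO i); apply: (orbit_fun_free rI hm rm char0 zm
    (a := fun o => a (enum_rank_in iO o)) _ iO) => c.
  rewrite big_enum_val /=; have /ffunP/(_ c) := e0; rewrite sum_ffunE ffunE => ec.
  rewrite -[RHS]ec; by apply: eq_bigr => j _; rewrite !ffunE enum_valK_in /GRing.scale.
move=> f /W[x -> [tx wx]].
have xe : equivariant (@rot_config n m) z S k x.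
  split=> [c|c xc]; last by rewrite inE; apply/forallP => i; rewrite (wx c xc).
  by have /ffunP/(_ c) := tx; rewrite !ffunE.
exists (fun i => x (enum_val i) / orbit_fun (@rot_config n m) m z k (enum_val i) (enum_val i)).
rewrite phiS; congr (lpure (phi _) r); apply/ffunP => c.
rewrite (orbit_fun_span rI hm rm char0 zm Sf xe) big_enum_val sum_ffunE.
by apply: eq_bigr => j _; rewrite !ffunE.
Qed.
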